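(* Let $G=(V,E)$ be a finite, simple, connected graph which is locally connected. The following are equivalent: (i) $G$ is effective Bonnet Myers sharp, i.e. $K:=\min_{x\sim y}\kappa(x,y)>0$ and $\operatorname{diam}_{\operatorname{eff}}(G)=\frac{\max_v\operatorname{Deg}(v)}{K}$; (ii) $G$ is reflective; (iii) $G$ is distance regular and Lichnerowicz sharp; (iv) $G$ is one of: a cocktail party graph with at least $6$ vertices, a Johnson graph, a halved cube, the Schläfli graph, the Gosset graph.
   Context: Locally connected: for every vertex $v$, the subgraph induced on the neighbors of $v$ is connected. $d$ is the combinatorial distance, $\operatorname{Deg}$ the degree, $\operatorname{diam}_{\operatorname{eff}}(G)=\frac{1}{|V|^2}\sum_{x,y}d(x,y)$. Laplacian $\Delta f(x)=\sum_{y\sim x}(f(y)-f(x))$. Ollivier curvature of an edge: $\kappa(x,y)=\inf\{\Delta f(x)-\Delta f(y): f(y)-f(x)=1,\ \max_{u\sim v}|f(u)-f(v)|=1\}$. Lichnerowicz sharp: the smallest positive eigenvalue $\lambda$ of $-\Delta$ equals $\min_{x\sim y}\kappa(x,y)$. Distance regular: there are numbers $b_n,c_n$ such that for every $x$ and every $z$ with $d(x,z)=n$, $z$ has $b_n$ neighbors at distance $n+1$ from $x$ and $c_n$ neighbors at distance $n-1$ from $x$. For adjacent $x\sim y$ let $V_x^y=\{v: d(v,x)<d(v,y)\}$, $V^{xy}=\{v:d(v,x)=d(v,y)\}$. A reflection from $x$ to $y$ is a graph automorphism $\phi$ with $\phi\circ\phi=\mathrm{id}$, $\phi(x)=y$,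 such that the edges between $V_x^y$ and $V_y^x$ are exactly $\{\{x',\phi(x')\}:x'\in V_x^y\}$ and $\phi$ fixes $V^{xy}$ pointwise. $G$ is reflective if every edge $x\sim y$ admits a reflection from $x$ to $y$. Cocktail party graph: $K_{2k}$ minus a perfect matching. Johnson graph $J(n,k)$: $k$-subsets of an $n$-set, adjacent iff sharing $k-1$ elements. Halved cube: even-weight binary strings of length $n$, adjacent iff differing in exactly two coordinates. Schläfli graph: srg$(27,16,10,8)$. Gosset graph: the 56-vertex 27-regular distance regular graph (1-skeleton of the $3_{21}$ polytope). *)

(* Defs.v *)
From HB Require Import structures.
From mathcomp Require Import all_boot all_order all_algebra.
From mathcomp Require Import boolp classical_sets reals.

Set Implicit Arguments.
Unset Strict Implicit.
Unset Printing Implicit Defensive.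

Import Order.TTheory GRing.Theory Num.Theory.

Section GraphDefs.
Variables (T : finType) (e : rel T).

Definition simple_graph : Prop :=
  (forall x y, e x y = e y x) /\ (forall x, ~~ e x x).

Definition connected_graph : Prop := forall x y, connect e x y.

Definition locally_connected : Prop :=
  forall v x y, e v x -> e v y ->
    connect (fun a b => [&& e v a, e v b & e a b]) x y.

Fixpoint ball (n : nat) (x : T) : {set T} :=
  match n with
  | 0 => [set x]
  | n'.+1 => ball n' x :|: [set y | [exists z in ball n' x, e z y]]
  end.

(* combinatorial distance: least n with y in ball n x
   (= #|T| if y is unreachable, which does not happen for connected graphs) *)
Definition dist (x y : T) : nat := find (fun n => y \in ball n x) (iota 0 #|T|).

Definition Deg (v : T) : nat := #|[set w | e v w]|.

Definition maxDeg : nat := \max_(v : T) Deg v.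

Definition distance_regular : Prop :=
  exists b c : nat -> nat, forall x z,
    #|[set w | e z w & dist x w == (dist x z).+1]| = b (dist x z) /\
    #|[set w | e z w & (dist x w).+1 == dist x z]| = c (dist x z).

Definition automorphism (phi : T -> T) : Prop :=
  bijective phi /\ forall a b, e (phi a) (phi b) = e a b.

Definition Vside (x y : T) : {set T} := [set v | dist v x < dist v y].
Definition Vmid (x y : T) : {set T} := [set v | dist v x == dist v y].

Definition reflection (x y : T) (phi : T -> T) : Prop :=
  [/\ automorphism phi, (forall a, phi (phi a) = a), phi x = y,
      (forall a, a \in Vmid x y -> phi a = a) &
      (
      (forall a, a \in Vside x y -> phi a \in Vside y x /\ e a (phi a)) /\
      (forall a b, a \in Vside x y -> b \in Vside y x -> e a b -> b = phi a))].

Definition reflective : Prop :=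
  forall x y, e x y -> exists phi, reflection x y phi.

Definition srg (nv k lam mu : nat) : Prop :=
  [/\ #|T| = nv, (forall v, Deg v = k),
      (forall x y, e x y -> #|[set w | e x w & e y w]| = lam)
    & (forall x y, x != y -> ~~ e x y -> #|[set w | e x w & e y w]| = mu)].

Definition iso_to (U : finType) (S : {set U}) (r : rel U) : Prop :=
  exists f : T -> U, [/\ injective f, [set f x | x in T] = S
                       & forall x y, e x y = r (f x) (f y)].

Variable R : realType.
Local Open Scope ring_scope.

Definition lap (f : T -> R) (x : T) : R := \sum_(y | e x y) (f y - f x).

Definition max_grad (f : T -> R) : R :=
  \big[Num.max/0]_(u : T) \big[Num.max/0]_(v | e u v) `|f u - f v|.

Local Open Scope classical_set_scope.

(* Ollivier curvature (in the Laplacian / Lipschitz formulation) *)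
Definition curvature (x y : T) : R :=
  inf [set lap f x - lap f y | f in [set f : T -> R | f y - f x = 1 /\ max_grad f = 1]].

(* K = min over edges of the curvature (inf of a finite nonempty set) *)
Definition Kmin : R := inf [set k | exists x y, e x y /\ k = curvature x y].

Definition diam_eff : R :=
  (\sum_(x : T) \sum_(y : T) (dist x y)%:R) / (#|T|%:R ^+ 2).

Definition eff_BM_sharp : Prop :=
  0 < Kmin /\ diam_eff = maxDeg%:R / Kmin.

Definition is_eig_negLap (lam : R) : Prop :=
  exists f : T -> R, (exists x, f x != 0) /\ forall x, - lap f x = lam * f x.

Definition smallest_pos_eig (lam : R) : Prop :=
  [/\ 0 < lam, is_eig_negLap lam & forall mu, 0 < mu -> is_eig_negLap mu -> lam <= mu].

Definition Lichnerowicz_sharp : Prop := smallest_pos_eig Kmin.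

End GraphDefs.

(* cocktail party graph on 2k vertices: K_{2k} minus the matching {(i,false),(i,true)} *)
Definition cocktail_rel (k : nat) : rel ('I_k * bool) := fun p q => p.1 != q.1.

Definition johnson_verts (n k : nat) : {set {set 'I_n}} := [set A : {set 'I_n} | #|A| == k].
Definition johnson_rel (n k : nat) : rel {set 'I_n} := fun A B : {set 'I_n} => #|A :&: B| + 1 == k.

Definition halved_verts (n : nat) : {set {ffun 'I_n -> bool}} :=
  [set f : {ffun 'I_n -> bool} | ~~ odd #|[set i | f i]|].
Definition halved_rel (n : nat) : rel {ffun 'I_n -> bool} :=
  fun f g : {ffun 'I_n -> bool} => #|[set i | f i != g i]| == 2.

(* Gosset graph: the 56 vectors of R^8 obtained from +-(3,3,-1,-1,-1,-1,-1,-1)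
   by permuting coordinates, adjacent iff their inner product is 8.
   A vertex is (A, s) with A the 2-set of positions of the +-3 and s the sign. *)
Definition gosset_vec (p : {set 'I_8} * bool) (i : 'I_8) : int :=
  ((if p.2 then 1 else -1) * (if i \in p.1 then 3 else -1))%R.
Definition gosset_verts : {set {set 'I_8} * bool} := [set p : {set 'I_8} * bool | #|p.1| == 2].
Definition gosset_rel : rel ({set 'I_8} * bool) :=
  fun p q : {set 'I_8} * bool => (\sum_(i < 8) gosset_vec p i * gosset_vec q i == 8)%R.

Definition in_family (T : finType) (e : rel T) : Prop :=
  (exists k, 3 <= k /\ iso_to e [set: 'I_k * bool] (@cocktail_rel k))
  \/ (exists n k, iso_to e (johnson_verts n k) (@johnson_rel n k))
  \/ (exists n, iso_to e (halved_verts n) (@halved_rel n))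
  \/ srg e 27 16 10 8
  \/ iso_to e gosset_verts gosset_rel.

(* Main.v *)
Require Import Defs.
From HB Require Import structures.
From mathcomp Require Import all_boot all_order all_algebra.
From mathcomp Require Import boolp classical_sets reals.
From mathcomp Require Import zify ring lra.

Set Implicit Arguments.
Unset Strict Implicit.
Unset Printing Implicit Defensive.

Import Order.TTheory GRing.Theory Num.Theory.

(* All four conditions are equivalent to a parallelogram property: with edges compared as vectors through
   distance differences (parallel), every path y' - y - z with d(y',z) = 2 completes to a parallelogram
   y, z, z', y' whose opposite edges are equal vectors (completable).

   For an edge xy, transporting it along geodesics pairs each v nearer to x with a neighbour v' such that
   the vectors vv' and xy agree; swapping v and v' is the reflection. Conversely, reflections produce the
   parallelograms. If f is an optimal potential for the curvature of an edge yz, lowering f on the vertices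
   reachable from y' by tight edges shows that such an edge leads from y' to a neighbour z' of z. When (i)
   holds all distance functions are optimal, so y'z' and yz agree as vectors. When (iii) holds the optimal
   potentials come from the representation of the graph on a sphere in the lambda-eigenspace: equality in
   Cauchy-Schwarz turns tightness into equality of vectors, and moving one edge along a geodesic shows that
   the cosine sequence is linear in the distance.

   With local connectedness, reflections make the number t of triangles on an edge constant, every edge has
   curvature K = t + 2, and the Laplacian of d(x,.) is deg - K d(x,.). Summing gives the effective diameter;
   deg/K - d(x,.) is an eigenfunction for K. Reflections act transitively on each sphere around x, because
   the neighbours of a vertex that are farther from x form a connected graph.

   A completable graph is determined by the graph H induced on the neighbours of a vertex, since vertices are
   recovered from their inner products with the edge vectors at that vertex. H is again completable and has
   diameter at most 2. If it is locally connected, induction gives H complete, cocktail party, J(n,2), a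
   halved 4- or 5-cube or Schlaefli; if not, H is a product of two cliques and the graph is a Johnson graph. *)

(** * Distances, parallel edges and reflections *)

(** Apart from the eigenspace representation no embedding is constructed: equality of vectors is an
    identity between distances to all vertices, so most steps become linear arithmetic on natural
    numbers. The known graphs are handled by guessing their distance and exhibiting the fourth
    corner of every parallelogram.

    The classification closes because H has diameter at most 2, which excludes the Gosset graph,
    halved cubes of dimension 6 or more and J(n,k) with k and n - k at least 3. What remains
    continues uniquely: a cocktail party graph is local in the next larger one, J(n,2) in the halved
    n-cube, the halved 5-cube in the Schlaefli graph, and that in the Gosset graph.

    The Schlaefli graph is given in (iv) by parameters only. Completability is therefore derived
    from the generalized quadrangle formed by nonadjacency, and the classification has to recover
    the parameters, which it does from the equation for the Laplacian of d(x,.). *)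

Section Distance.
Variables (T : finType) (e : rel T).
Hypotheses (e_sym : symmetric e) (e_conn : connected_graph e).
Local Notation d := (dist e).

Lemma ballP n x y :
  reflect (exists p, [/\ path e x p, last x p = y & size p <= n]) (y \in ball e n x).
Proof.
elim: n y => [|n IHn] y /=.
  rewrite inE; apply: (iffP eqP) => [->|[p [_ <-]]]; first by exists [::].
  by rewrite leqn0 size_eq0 => /eqP ->.
rewrite !inE; apply: (iffP orP) => [[/IHn[p [pP lP sP]]|/existsP[z /andP[/IHn[p [pP lP sP]] ezy]]]|].
- by exists p; split => //; apply: leqW.
- by exists (rcons p y); rewrite rcons_path last_rcons size_rcons lP ezy pP; split.
case=> p [pP lP sP]; case/lastP: p pP lP sP => [|p z].
  by move=> _ /= <- _; left; apply/IHn; exists [::].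
rewrite rcons_path last_rcons size_rcons => /andP[pP ez] <- sP; right.
by apply/existsP; exists (last x p); rewrite ez andbT; apply/IHn; exists p.
Qed.

(** A path without repetition has fewer than [#|T|] edges, so the search that defines [dist] always
    succeeds and never returns its default. *)
Lemma ball_dist n x y : (y \in ball e n x) = (d x y <= n).
Proof.
have short : exists2 m, m < #|T| & y \in ball e m x.
  have /connectP[p pP ->] := e_conn x y; case/shortenP: pP => q qP uq _.
  exists (size q); last by apply/ballP; exists q.
  by have := max_card (mem (x :: q)); rewrite (card_uniqP uq).
have mono m m' : m <= m' -> y \in ball e m x -> y \in ball e m' x.
  move=> le_mm /ballP[p [pP lP sP]]; apply/ballP; exists p; split=> //.
  exact: leq_trans le_mm.
have hasb : has (fun m => y \in ball e m x) (iota 0 #|T|).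
  by case: short => m lt_m ym; apply/hasP; exists m => //; rewrite mem_iota.
have lt_d : d x y < #|T| by rewrite /dist -[X in _ < X](size_iota 0) -has_find.
apply/idP/idP => [yn|le_dn]; last first.
  by apply: mono le_dn _; have := nth_find 0 hasb; rewrite nth_iota.
rewrite leqNgt; apply/negP => lt_nd.
have := before_find 0 lt_nd; rewrite nth_iota ?add0n ?yn //.
exact: ltn_trans lt_d.
Qed.

Lemma dist_eq0 x y : (d x y == 0) = (x == y).
Proof. by rewrite -leqn0 -ball_dist inE eq_sym. Qed.

Lemma distxx x : d x x = 0.
Proof. by apply/eqP; rewrite dist_eq0. Qed.

Lemma dist0P x y : d x y = 0 -> x = y.
Proof. by move/eqP; rewrite dist_eq0 => /eqP. Qed.

Lemma distC x y : d x y = d y x.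
Proof.
suff le_d a b : d a b <= d b a by apply/eqP; rewrite eqn_leq !le_d.
have /ballP[p [pP lP sP]] : a \in ball e (d b a) b by rewrite ball_dist.
rewrite -ball_dist; apply/ballP; exists (rev (belast b p)); split.
- by rewrite -lP rev_path; under eq_path do rewrite e_sym.
- by case: p lP {pP sP} => [|c p] //= _; rewrite rev_cons last_rcons.
- by rewrite size_rev size_belast.
Qed.

Lemma dist_step v x y : e x y -> d v y <= (d v x).+1.
Proof.
move=> exy; rewrite -ball_dist /= !inE; apply/orP; right.
by apply/existsP; exists x; rewrite exy ball_dist leqnn.
Qed.

Lemma dist_stepC v x y : e x y -> d v x <= (d v y).+1.
Proof. by rewrite e_sym; apply: dist_step. Qed.

Lemma dist_pred x y : 0 < d x y -> exists z, e z y /\ (d x z).+1 = d x y.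
Proof.
case def_d: (d x y) => [//|n] _.
have: y \in ball e n.+1 x by rewrite ball_dist def_d.
rewrite /= !inE ball_dist def_d ltnn => /existsP[z /andP[]]; rewrite ball_dist => le_dz ezy.
exists z; split=> //; have := dist_step x ezy; lia.
Qed.

Lemma dist1 x y : x != y -> e x y -> d x y = 1.
Proof. by move=> nxy exy; have := dist_step x exy; rewrite distxx; have := dist_eq0 x y; lia. Qed.

Lemma dist1P x y : d x y = 1 -> e x y.
Proof.
move=> dxy; have [|z [ezy]] := @dist_pred x y; first by rewrite dxy.
by rewrite dxy => -[/dist0P ->].
Qed.

(** The tool for computing distances: a candidate [g] that grows by at most one along an edge and is
    lowered by some neighbour is the distance. *)
Lemma dist_uniq (g : T -> T -> nat) :
  (forall x, g x x = 0) -> (forall v x y, e x y -> g v y <= (g v x).+1) ->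
  (forall v y, 0 < g v y -> exists z, e z y /\ g v z < g v y) ->
  (forall x y, g x y = 0 -> x = y) -> forall x y, d x y = g x y.
Proof.
move=> g0 g_step g_pred g_inj x y; apply/eqP; rewrite eqn_leq; apply/andP; split.
  have [n le_n] := ubnP (g x y); elim: n y le_n => // n IHn y lt_n.
  have [/g_inj->|/g_pred[z [ezy lt_z]]] := posnP (g x y); first by rewrite distxx.
  have := dist_step x ezy; have := IHn z; lia.
have [n le_n] := ubnP (d x y); elim: n y le_n => // n IHn y lt_n.
have [/dist0P->|/dist_pred[z [ezy lt_z]]] := posnP (d x y); first by rewrite g0.
have := g_step x _ _ ezy; have := IHn z; lia.
Qed.

End Distance.

Lemma iso_dist (T U : finType) (e : rel T) (r : rel U) (f : T -> U) (g : U -> T) :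
  connected_graph e -> connected_graph r -> cancel f g -> cancel g f ->
  (forall a b, r (f a) (f b) = e a b) -> forall a b, dist r (f a) (f b) = dist e a b.
Proof.
move=> e_conn r_conn fK gK fe a b; apply/esym; move: a b.
apply: dist_uniq => // [x|v x y exy|v y|x y].
- exact: distxx.
- by apply: dist_step; rewrite ?fe.
- case/(dist_pred r_conn) => z [rz lt_z]; exists (g z); rewrite gK -lt_z; split=> //.
  by rewrite -fe gK.
- by move/(dist0P r_conn)/(can_inj fK).
Qed.

(* The vectors from a to b and from c to c' agree: d v a - d v b = d v c - d v c' for every v, without
   subtraction. *)
Definition parallel (T : finType) (e : rel T) (a b c c' : T) : bool :=
  [forall v, dist e v a + dist e v c' == dist e v b + dist e v c].

Definition completable (T : finType) (e : rel T) : Prop :=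
  forall y z y', e y z -> e y y' -> dist e y' z = 2 -> exists z', parallel e y z y' z'.

Section Reflections.
Variables (T : finType) (e : rel T).
Hypotheses (e_sym : symmetric e) (e_irr : irreflexive e) (e_conn : connected_graph e).
Local Notation d := (dist e).
Local Notation par := (parallel e).
Local Notation dC := (distC e_sym e_conn).

Lemma dist_edge x y : e x y -> d x y = 1.
Proof. by move=> exy; apply: dist1 => //; apply: contraTneq exy => ->; rewrite e_irr. Qed.

Lemma edge_dist x y : e x y = (d x y == 1).
Proof. by apply/idP/eqP => [/dist_edge|/(dist1P e_conn)]. Qed.

Lemma dist2 v x y : e v x -> e v y -> x != y -> ~~ e x y -> d x y = 2.
Proof.
move=> evx evy nxy; rewrite edge_dist => nexy.
have := dist_step e_conn x evy; have := dist_eq0 e_conn x y; rewrite (dC x v) (dist_edge evx); lia.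
Qed.

Lemma common_dist v x y : e v x -> e v y -> d x y <= 2.
Proof. by move=> evx evy; have := dist_step e_conn x evy; rewrite (dC x v) (dist_edge evx). Qed.

Lemma parP a b c c' : reflect (forall v, d v a + d v c' = d v b + d v c) (par a b c c').
Proof. by apply: (iffP forallP) => H v; apply/eqP. Qed.

Lemma par_swap a b c c' : par a b c c' = par c c' a b.
Proof. by apply/parP/parP => H v; have := H v; lia. Qed.

Lemma par_rev a b c c' : par a b c c' = par b a c' c.
Proof. by apply/parP/parP => H v; have := H v; lia. Qed.

Lemma par_trans a b c c' g g' : par a b c c' -> par c c' g g' -> par a b g g'.
Proof. by move=> /parP H /parP H'; apply/parP => v; have := H v; have := H' v; lia. Qed.

Lemma par_uniq a b c c1 c2 : par a b c c1 -> par a b c c2 -> c1 = c2.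
Proof.
move=> /parP/(_ c1) H1 /parP/(_ c1) H2; apply: (dist0P e_conn).
by move: H1 H2; rewrite (distxx e_conn); lia.
Qed.

Lemma par_edge a b c c' : e a b -> d c b = (d c a).+1 -> par a b c c' -> e c c'.
Proof.
move=> eab dc /parP/(_ c); rewrite (distxx e_conn) edge_dist dc; lia.
Qed.

Lemma edge_side v x y : e x y -> [\/ d v x = d v y, d v y = (d v x).+1 | d v x = (d v y).+1].
Proof.
move=> exy; have := dist_step e_conn v exy; have := dist_stepC e_sym e_conn v exy.
case: (ltngtP (d v x) (d v y)) => ? ? ?; [apply: Or32|apply: Or33|apply: Or31]; lia.
Qed.

(** Total by the default [v], which is reached only if a partner is missing; [side_partner] excludes
    this in completable graphs. *)
Definition rfl (x y v : T) : T :=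
  if d v x < d v y then odflt v [pick w | par x y v w]
  else if d v y < d v x then odflt v [pick w | par y x v w] else v.

Lemma rfl_sym x y v : rfl x y v = rfl y x v.
Proof. by rewrite /rfl; case: ltngtP. Qed.

Lemma rfl_fix x y v : d v x = d v y -> rfl x y v = v.
Proof. by rewrite /rfl => ->; rewrite ltnn. Qed.

Section Completable.
Hypothesis compl : completable e.

Lemma side_partner x y v : e x y -> d v x < d v y -> exists w, par x y v w.
Proof.
move=> exy; have [n le_n] := ubnP (d x v); elim: n v le_n => // n IHn v lt_n lt_v.
have [/(dist0P e_conn)<-|/(dist_pred e_conn)[w [ewv lt_w]]] := posnP (d x v).
  by exists y; apply/parP => u; rewrite addnC.
have dw : d w y = (d w x).+1.
  have := dist_step e_conn y ewv; have := dist_step e_conn w exy.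
  rewrite (dC w x) (dC w y) ; move: lt_w lt_v; rewrite (dC v x) (dC v y); lia.
have [||w' pw] := IHn w; try lia.
have eww' := par_edge exy dw pw.
(* The hypothesis of completability comes for free: v is nearer to x by one and adjacent to w, so
   the parallel equation at v reads 1 + 1. *)
have dvw' : d v w' = 2.
  have /parP/(_ v) := pw; rewrite (dC v w) (dist_edge ewv).
  by have [] := edge_side v exy; lia.
have [v' pv] := compl eww' ewv dvw'.
by exists v'; apply: par_trans pw pv.
Qed.

Lemma rfl_par x y v : e x y -> d v x < d v y -> par x y v (rfl x y v).
Proof.
move=> exy lt_v; rewrite /rfl lt_v; case: pickP => [//|nw].
by have [w] := side_partner exy lt_v; rewrite nw.
Qed.

Lemma rfl_parE x y v w : e x y -> d v x < d v y -> par x y v w -> rfl x y v = w.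
Proof. by move=> exy lt_v; apply: par_uniq (rfl_par exy lt_v). Qed.

Variant rfl_spec x y v : T -> Type :=
| RflMid of d v x = d v y : rfl_spec x y v v
| RflNear w of d v y = (d v x).+1 & par x y v w & e v w : rfl_spec x y v w
| RflFar w of d v x = (d v y).+1 & par y x v w & e v w : rfl_spec x y v w.

Lemma rflP x y v : e x y -> rfl_spec x y v (rfl x y v).
Proof.
move=> exy; have eyx : e y x by rewrite e_sym.
have := edge_side v exy; case: (ltngtP (d v x) (d v y)) => dv side.
- have pv := rfl_par exy dv; have dv1 : d v y = (d v x).+1 by case: side; lia.
  by apply: RflNear (par_edge exy dv1 pv).
- rewrite rfl_sym; have pv := rfl_par eyx dv.
  have dv1 : d v x = (d v y).+1 by case: side; lia.
  by apply: RflFar (par_edge eyx dv1 pv).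
- by rewrite rfl_fix //; apply: RflMid.
Qed.

Lemma rfl_isom x y a b : e x y -> d (rfl x y a) (rfl x y b) = d a b.
Proof.
move=> exy; case: (rflP a exy) => [ha|a' ha /parP pa _|a' ha /parP pa _];
  case: (rflP b exy) => [hb|b' hb /parP pb _|b' hb /parP pb _] //;
  (try have := pa a); (try have := pa a'); (try have := pa b); (try have := pa b');
  (try have := pb a); (try have := pb a'); (try have := pb b); (try have := pb b');
  rewrite ?(distxx e_conn) ?(dC b a) ?(dC b a') ?(dC b' a) ?(dC b' a') ?(dC b' b) ?(dC a' a); lia.
Qed.

Lemma rfl_left x y : e x y -> rfl x y x = y.
Proof.
move=> exy; apply: rfl_parE; rewrite ?(distxx e_conn) ?dist_edge //.
by apply/parP => u; rewrite addnC.
Qed.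

Lemma rfl_right x y : e x y -> rfl x y y = x.
Proof. by rewrite e_sym => eyx; rewrite rfl_sym rfl_left. Qed.

Lemma rfl_dist_right x y v : e x y -> d (rfl x y v) y = d v x.
Proof. by move=> exy; have := rfl_isom v x exy; rewrite rfl_left. Qed.

Lemma rfl_dist_left x y v : e x y -> d (rfl x y v) x = d v y.
Proof. by move=> exy; have := rfl_isom v y exy; rewrite rfl_right. Qed.

Lemma rflK x y : e x y -> involutive (rfl x y).
Proof.
move=> exy v; move: (rfl_dist_left v exy) (rfl_dist_right v exy);
  case: (rflP v exy) => [hv|w hv pv _|w hv pv _] dx dy; first by rewrite rfl_fix.
  by rewrite rfl_sym; apply: rfl_parE; rewrite ?(e_sym y) 1?par_rev //; lia.
by apply: rfl_parE; rewrite 1?par_rev //; lia.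
Qed.

Lemma rfl_edge x y a b : e x y -> e (rfl x y a) (rfl x y b) = e a b.
Proof. by move=> exy; rewrite !edge_dist rfl_isom. Qed.

Lemma completable_reflective : reflective e.
Proof.
move=> x y exy; exists (rfl x y); have eyx : e y x by rewrite e_sym.
split.
- split=> [|a b]; last exact: rfl_edge.
  by exists (rfl x y); exact: rflK.
- exact: rflK.
- exact: rfl_left.
- by move=> a; rewrite inE => /eqP; apply: rfl_fix.
split=> [a|a b]; rewrite !inE.
  by move=> lt_a; rewrite rfl_dist_left // rfl_dist_right //; split=> //; case: (rflP a exy); lia.
move=> lt_a lt_b eab; have /parP pa := rfl_par exy lt_a.
apply/esym/(dist0P e_conn); rewrite dC.
have := pa b; rewrite (dC b a) (dist_edge eab); lia.
Qed.

End Completable.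

(** The fourth corner is z' = [phi y']. Folding the z side onto the y side by [phi] never increases
    distances from a v on the y side, so v is not nearer to z' than to y'. The reflection [psi]
    along y'z' also swaps y and z, which excludes equality. Applying [phi] settles the z side, and
    [phi] fixes the middle. *)
Lemma reflective_completable : reflective e -> completable e.
Proof.
move=> refl y z y' eyz eyy' dy'z.
have [phi [[phi_bij phi_e] phiK phiy phi_mid [phi_side phi_uniq]]] := refl _ _ eyz.
have phiz : phi z = y by rewrite -phiy phiK.
have isom psi a b : automorphism e psi -> d (psi a) (psi b) = d a b.
  by case=> [[psi' psiK psiK'] psi_e]; apply: iso_dist psiK psiK' psi_e _ _.
have phi_d a b : d (phi a) (phi b) = d a b by apply: isom.
have ezy : e z y by rewrite e_sym.
have phi_far a : d a z < d a y -> d (phi a) y < d (phi a) z.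
  by rewrite -(phi_d a z) -(phi_d a y) phiy phiz.
pose fold w := if d w z < d w y then phi w else w.
have fold_edge u w : e u w -> fold u = fold w \/ e (fold u) (fold w).
  have aux a b : e a b -> d a z < d a y -> d b y <= d b z -> phi a = b \/ e (phi a) b.
    move=> eab lt_a; rewrite leq_eqVlt => /orP[/eqP eq_b|lt_b].
      by right; rewrite -(phi_mid b) ?phi_e // inE; apply/eqP.
    left; rewrite (_ : a = phi b) ?phiK //; apply: phi_uniq; rewrite ?inE //.
    by rewrite e_sym.
  move=> euw; rewrite /fold; case: ltnP => hu; case: ltnP => hw.
  - by right; rewrite phi_e.
  - exact: aux.
  - rewrite e_sym in euw; have [->|ew] := aux w u euw hw hu; first by left.
    by right; rewrite e_sym.
  - by right.
have fold_le a w : d a y < d a z -> d a (fold w) <= d a w.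
  move=> lt_a; have [n le_n] := ubnP (d a w); elim: n w le_n => // n IHn w lt_n.
  have [/(dist0P e_conn)<-|/(dist_pred e_conn)[u [euw lt_u]]] := posnP (d a w).
    by rewrite /fold ifN // -leqNgt ltnW.
  have le_u := IHn u; case: (fold_edge _ _ euw) => [<-|/(dist_step e_conn a)]; lia.
have hy' : y' \in Vside e y z by rewrite inE dy'z dC (dist_edge eyy').
have [phi_y' ey'z'] := phi_side _ hy'; set z' := phi y' in phi_y' ey'z'.
have dzz' : d z z' = 1 by rewrite -phiy phi_d dist_edge.
have dyz' : d y z' = 2 by rewrite -phiz phi_d dC.
have [psi [psi_aut psiK psiy' psi_mid [psi_side psi_uniq]]] := refl _ _ ey'z'.
(* The edge yz crosses from the y' side to the z' side, and [psi] accounts for every crossing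
   edge. *)
have psiy : psi y = z.
  apply/esym/psi_uniq => //; rewrite inE; first by rewrite (dist_edge eyy') dyz'.
  by rewrite dzz' dC dy'z.
have near v : d v y < d v z -> d v z' = (d v y').+1.
  move=> lt_v; have [eq_v|//|far_v] := edge_side v ey'z'.
    have psiv : psi v = v by apply: psi_mid; rewrite inE eq_v.
    by have := isom _ v y psi_aut; rewrite psiv psiy => eq'; move: lt_v; rewrite eq' ltnn.
  have := fold_le v z' lt_v; rewrite /fold.
  have -> : d z' z < d z' y by rewrite inE in phi_y'.
  by rewrite /z' phiK -/z'; lia.
exists z'; apply/parP => v.
have [eq_v|near_v|far_v] := edge_side v eyz.
- have phiv : phi v = v by apply: phi_mid; rewrite inE eq_v.
  by have := phi_d v y'; rewrite phiv -/z' => ->; rewrite eq_v.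
- by rewrite (near v) ?near_v //; lia.
- have := near (phi v); rewrite -(phi_d (phi v) y') -(phi_d (phi v) z') phiK /z' phiK -/z'.
  have := phi_far v; lia.
Qed.

End Reflections.

(** * Distance transitivity *)

Section LocallyConnected.
Variables (T : finType) (e : rel T).
Hypotheses (e_sym : symmetric e) (e_irr : irreflexive e) (e_conn : connected_graph e).
Hypothesis compl : completable e.
Local Notation d := (dist e).
Local Notation par := (parallel e).
Local Notation dC := (distC e_sym e_conn).
Local Notation dxx := (distxx e_conn).
Local Notation dE := (dist_edge e_irr e_conn).
Local Notation rfl := (rfl e).

Lemma connect_const (A : Type) (r : rel T) (f : T -> A) x y :
  (forall a b, r a b -> f a = f b) -> connect r x y -> f x = f y.
Proof.
move=> fr /connectP[p pP ->]; elim: p x pP => //= z p IHp x /andP[/fr -> /IHp //].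
Qed.

Lemma rfl_inj x y : e x y -> injective (rfl x y).
Proof. by move=> exy; exact: inv_inj (rflK e_sym e_irr e_conn compl exy). Qed.

Lemma rfl_aut x y : e x y -> automorphism e (rfl x y).
Proof.
move=> exy; split=> [|a b]; last exact: rfl_edge.
by apply: inv_bij; apply: rflK.
Qed.

Lemma aut_dist f a b : automorphism e f -> d (f a) (f b) = d a b.
Proof. by case=> [[g fK gK] fe]; apply: iso_dist fK gK fe _ _. Qed.

Lemma aut_comp f g : automorphism e f -> automorphism e g -> automorphism e (f \o g).
Proof.
case=> fb fe [gb ge]; split=> [|a b] /=; first exact: bij_comp.
by rewrite fe.
Qed.

Lemma Deg_edge x y : e x y -> Deg e x = Deg e y.
Proof.
move=> exy; rewrite /Deg -(card_imset _ (rfl_inj exy)); congr #|pred_of_set _|.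
apply/setP => w; rewrite inE -[w in RHS](rflK e_sym e_irr e_conn compl exy).
rewrite -[X in e X _](rfl_left e_sym e_irr e_conn compl exy) rfl_edge //.
apply/imsetP/idP => [[v + ->]|exw]; first by rewrite inE rflK.
by exists (rfl x y w); rewrite ?inE ?rflK.
Qed.

Lemma Deg_const x y : Deg e x = Deg e y.
Proof. exact: connect_const Deg_edge (e_conn x y). Qed.

Lemma vertex_trans x y : exists2 f, automorphism e f & f x = y.
Proof.
have /connectP[p pP ->] := e_conn x y; elim: p x pP => [|z p IHp] x /=.
  by exists id => //; split=> //; exists id.
case/andP=> exz /IHp[f fA fz]; exists (f \o rfl x z); first exact: aut_comp fA (rfl_aut exz).
by rewrite /= rfl_left.
Qed.

(* With s the parallel copy of the edge p -> s at q, the triangle inequality at the third neighbour would fail. *)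
Lemma no_claw v s p q r : e v s -> e v p -> e v q -> e v r -> e s p -> e s q -> e s r ->
  d p q = 2 -> d p r = 2 -> d q r = 2 -> False.
Proof.
move=> evs evp evq evr esp esq esr dpq dpr dqr.
have [w /parP pw] : exists w, par s p q w by apply: compl; rewrite // dC.
have := pw v; have := pw r; rewrite !(dC r) dpr dqr (dC s r) (dE evs) (dE evp) (dE evq).
rewrite (dC r s) (dE esr).
have := dist_step e_conn w evr; rewrite (dC v w); lia.
Qed.

(** Induction on the path. If p1 follows p and s is common to p1 and q but not adjacent to p, moving
    the edge p1 s to p ends at a common neighbour of p and q. *)
Lemma local_mid x p q : e x p -> e x q ->
  connect (fun a b => [&& e x a, e x b & e a b]) p q -> p != q -> ~~ e p q ->
  exists s, [/\ e x s, e p s & e q s].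
Proof.
move=> exp exq /connectP[t tP lt] npq nepq; move: tP lt npq nepq.
elim: t p exp => [|p1 t IHt] p exp /=; first by move=> _ ->; rewrite eqxx.
case/andP=> /and3P[_ exp1 epp1] tP lt npq nepq.
have [eq1|n1q] := eqVneq p1 q; first by rewrite -eq1 epp1 in nepq.
have [e1q|ne1q] := boolP (e p1 q); first by exists p1; rewrite (e_sym q).
have [s [exs e1s eqs]] := IHt _ exp1 tP lt n1q ne1q.
have [eq_ps|nps] := eqVneq p s; first by rewrite eq_ps e_sym eqs in nepq.
have [eps|neps] := boolP (e p s); first by exists s.
have dps : d p s = 2 by apply: dist2 exp exs nps neps.
have d1q : d p1 q = 2 by apply: dist2 exp1 exq n1q ne1q.
have dpq : d p q = 2 by apply: dist2 exp exq npq nepq.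
have epp1' : e p1 p by rewrite e_sym.
have [w pw] := compl e1s epp1' dps.
move/parP: (pw) => pv; have dqw := pv q; have dxw := pv x; have dpw := pv p.
exists w; rewrite !(edge_dist e_irr e_conn); move: dqw dxw dpw.
rewrite dxx (dC q p1) (dC q p) d1q dpq dps (dC p p1) (dE epp1') (dE eqs) (dE exs) (dE exp) (dE exp1).
move: (d x w) (d p w) (d q w) => n1 n2 n3; clear=> ? ? ?; split; lia.
Qed.

Hypothesis loc : locally_connected e.

Definition triangles x y := #|[set w | e x w & e y w]|.

Lemma trianglesC x y : triangles x y = triangles y x.
Proof. by rewrite /triangles; apply: eq_card => w; rewrite !inE andbC. Qed.

Lemma triangles_rfl a b x y : e a b -> triangles (rfl a b x) (rfl a b y) = triangles x y.
Proof.
move=> eab; rewrite /triangles -[RHS](card_imset _ (rfl_inj eab)); apply: eq_card => w.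
have rK := rflK e_sym e_irr e_conn compl eab.
rewrite -[w in LHS]rK inE !rfl_edge //.
apply/idP/imsetP => [exw|[v + ->]]; last by rewrite inE rK.
by exists (rfl a b w); rewrite ?inE ?rK.
Qed.

Lemma triangles_local x y z : e x y -> e x z -> triangles x y = triangles x z.
Proof.
move=> exy exz; apply: connect_const (loc exy exz) => a b /and3P[exa exb eab].
by rewrite -(triangles_rfl x a eab) rfl_left // rfl_fix // (dE exa) (dE exb).
Qed.

Lemma triangles_const x y z w : e x y -> e z w -> triangles x y = triangles z w.
Proof.
have /connectP[p pP ->] := e_conn x z; elim: p x y pP => [|v p IHp] x y /=.
  by move=> _; exact: triangles_local.
case/andP=> exv pP exy ezw; rewrite (triangles_local exy exv) trianglesC.
by apply: IHp => //; rewrite e_sym.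
Qed.

(* The claim is transported by reflection towards x, where it becomes local connectedness. *)
Lemma upper_mid x y p q : e y p -> e y q -> d x p = (d x y).+1 -> d x q = (d x y).+1 ->
  p != q -> ~~ e p q -> exists s, [/\ e y s, d x s = (d x y).+1, e p s & e q s].
Proof.
have [n le_n] := ubnP (d x y); elim: n y p q le_n => // n IHn y p q lt_n.
have [/(dist0P e_conn)<-|/(dist_pred e_conn)[v [evy lt_v]]] := posnP (d x y).
  move=> exp exq _ _ npq nepq; have [s [exs eps eqs]] := local_mid exp exq (loc exp exq) npq nepq.
  by exists s; rewrite dxx (dE exs).
move=> eyp eyq dp dq npq nepq.
have rK := rflK e_sym e_irr e_conn compl evy.
have re a b : e (rfl v y a) (rfl v y b) = e a b by apply: rfl_edge.
have ry : rfl v y y = v by apply: rfl_right.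
have rv : rfl v y v = y by apply: rfl_left.
have upper z : e y z -> d x z = (d x y).+1 ->
    [/\ e v (rfl v y z), d (rfl v y z) y = 2 & d x (rfl v y z) = (d x v).+1].
  move=> eyz dz; rewrite -{1}ry re eyz rfl_dist_right //.
  have dvz : d z v = 2.
    have dzy : d z y = 1 by rewrite dC dE.
    case: (edge_side e_sym e_conn z evy); rewrite dzy => dzv; last by [].
      by have := dist_stepC e_sym e_conn x (dist1P e_conn dzv); lia.
    have /(dist0P e_conn) eq_z : d z v = 0 by lia.
    by move: dz; rewrite eq_z; lia.
  split=> //; have /parP/(_ x) : par y v z (rfl v y z).
    by rewrite rfl_sym; apply: rfl_par; rewrite 1?e_sym // dvz dC dE.
  lia.
have [evp dpy dxp] := upper p eyp dp; have [evq dqy dxq] := upper q eyq dq.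
have [|||s [evs dxs eps eqs]] := IHn v _ _ _ evp evq dxp dxq.
- by clear -lt_n lt_v; lia.
- by rewrite (inj_eq (rfl_inj evy)).
- by rewrite re.
(* Were s adjacent to y, then y and the reflected p and q would form a claw at s among the
   neighbours of v. *)
have dsy : d s y = 2.
  apply: (dist2 e_sym e_irr e_conn evs evy).
    by apply: contraTneq eps => ->; rewrite (edge_dist e_irr e_conn) dpy.
  apply/negP => esy; apply: (@no_claw v s y (rfl v y p) (rfl v y q)); rewrite ?(e_sym s (rfl _ _ _)) // 1?dC //.
  rewrite dC; apply: (dist2 e_sym e_irr e_conn evp evq); first by rewrite (inj_eq (rfl_inj evy)).
  by rewrite re.
exists (rfl v y s); split.
- by rewrite -{1}rv re.
- have /parP/(_ x) : par v y s (rfl v y s) by apply: rfl_par; rewrite // dsy dC dE.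
  by clear -dxs lt_v; lia.
- by rewrite -[p]rK re.
- by rewrite -[q]rK re.
Qed.

Lemma level_rfl x p q : e p q -> d x p = d x q ->
  exists f, [/\ automorphism e f, f x = x & f p = q].
Proof.
move=> epq dpq; exists (rfl p q); split; [exact: rfl_aut|exact: rfl_fix|exact: rfl_left].
Qed.

(** Once predecessors are matched by induction, the image of p and q are upper neighbours of one
    vertex, joined by at most two edges inside their sphere. Reflecting in such an edge fixes x. *)
Lemma distance_trans0 x p q : d x p = d x q -> exists f, [/\ automorphism e f, f x = x & f p = q].
Proof.
have [n le_n] := ubnP (d x p); elim: n p q le_n => // n IHn p q lt_n dpq.
have aut1 : automorphism e id by split=> //; exists id.
have [dp0|/(dist_pred e_conn)[p1 [ep1 dp1]]] := posnP (d x p).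
  by exists id; split=> //; rewrite -(dist0P e_conn dp0); apply: (dist0P e_conn); rewrite -dpq.
have [|q1 [eq1 dq1]] := @dist_pred _ _ e_conn x q; first by rewrite -dpq -dp1.
have [||f [fA fx fp]] := IHn p1 q1; try lia.
have dfp : d x (f p) = d x q by rewrite -{1}fx aut_dist.
have efp : e q1 (f p) by rewrite -fp; case: fA => _ ->.
have [eq_fp|nfp] := eqVneq (f p) q; first by exists f.
have [efpq|nefp] := boolP (e (f p) q).
  have [g [gA gx gp]] := level_rfl efpq dfp.
  by exists (g \o f); split=> /=; [exact: aut_comp|rewrite fx|].
have [||||s [eqs dxs efs es]] := @upper_mid x q1 (f p) q efp eq1; rewrite ?dfp ?dq1 //.
have [|g [gA gx gp]] := @level_rfl x _ _ efs; first by rewrite dxs dfp.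
have [||h [hA hx hp]] := @level_rfl x s q; rewrite 1?e_sym ?dxs //.
exists (h \o (g \o f)); split=> /=; [|by rewrite fx gx|by rewrite gp].
by apply: aut_comp => //; apply: aut_comp.
Qed.

Lemma distance_trans x p x' p' : d x p = d x' p' ->
  exists f, [/\ automorphism e f, f x = x' & f p = p'].
Proof.
move=> eq_d; have [f fA fx] := vertex_trans x x'.
have [|g [gA gx gp]] := @distance_trans0 x' (f p) p'; first by rewrite -{1}fx aut_dist.
by exists (g \o f); split=> /=; [exact: aut_comp|rewrite fx|].
Qed.

Lemma completable_distance_regular : distance_regular e.
Proof.
(* The count is read off one arbitrary pair at distance n; transitivity makes the choice immaterial.
   The value 0 is for n that occur as no distance. *)
pose cnt (P : nat -> nat -> bool) n := if [pick p : T * T | d p.1 p.2 == n] is Some p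
  then #|[set w | e p.2 w & P (d p.1 w) n]| else 0.
have cntE P x z : #|[set w | e z w & P (d x w) (d x z)]| = cnt P (d x z).
  rewrite /cnt; case: pickP => [[x' z'] /= /eqP eq_d|/(_ (x, z))]; last by rewrite /= eqxx.
  have [f [fA fx fz]] := distance_trans eq_d.
  have [[g fK gK] fe] := fA; rewrite -[RHS](card_imset _ (can_inj fK)); apply: eq_card => w.
  rewrite inE; apply/idP/imsetP => [hw|[v hv ->]]; last first.
    move: hv; rewrite !inE => /andP[ev Pv].
    by rewrite -{1}fz fe ev -{1}fx (aut_dist _ _ fA).
  by exists (g w); rewrite ?gK // inE -fe fz gK -(aut_dist _ _ fA) fx gK.
exists (cnt (fun m n => m == n.+1)), (cnt (fun m n => m.+1 == n)) => x z.
by rewrite -!cntE.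
Qed.

End LocallyConnected.

(** * Curvature and the Laplacian of the distance *)

Section Curvature.
Local Open Scope ring_scope.
Variables (R : realType) (T : finType) (e : rel T).
Hypotheses (e_sym : symmetric e) (e_irr : irreflexive e) (e_conn : connected_graph e).
Local Notation d := (dist e).
Local Notation lap := (@lap T e R).

Definition realdist (x : T) : T -> R := fun y => (d x y)%:R.

Definition lipschitz (f : T -> R) := forall u v, e u v -> f v - f u <= 1.

Definition potential x y (f : T -> R) := f y - f x = 1 /\ max_grad e f = 1.

Lemma le_max_grad (f : T -> R) u v : e u v -> `|f u - f v| <= max_grad e f.
Proof.
move=> euv; apply: le_trans (le_bigmax _ _ u).
exact: (le_bigmax_cond _ (fun v => `|f u - f v|)).
Qed.

(** The edge xy itself attains gradient 1, so [max_grad e f = 1] reduces to the Lipschitz bound,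
    one-sided because [e] is symmetric. *)
Lemma potentialP x y f : e x y -> potential x y f <-> f y - f x = 1 /\ lipschitz f.
Proof.
move=> exy; split=> -[fxy f1]; split=> //.
  by move=> u v euv; rewrite -f1; apply: le_trans (le_max_grad f euv); rewrite distrC ler_norm.
apply/eqP; rewrite eq_le; apply/andP; split.
  apply: bigmax_le => // u _; apply: bigmax_le => // v euv.
  rewrite ler_norml; have := f1 u v euv; have := f1 v u; rewrite e_sym => /(_ euv); lra.
by rewrite -fxy; apply: le_trans (le_max_grad f exy); rewrite distrC ler_norm.
Qed.

Lemma lap_lb f x : lipschitz f -> - #|T|%:R <= lap f x.
Proof.
move=> fL; rewrite /Defs.lap.
have : \sum_(y | e x y) (-1 : R) <= \sum_(y | e x y) (f y - f x).
  by apply: ler_sum => y exy; have := fL y x; rewrite e_sym => /(_ exy); lra.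
apply: le_trans; rewrite sumr_const mulNrn lerN2 ler_nat; exact: max_card.
Qed.

Lemma lapN f x : lap (fun v => - f v) x = - lap f x.
Proof. by rewrite /Defs.lap -sumrN; apply: eq_bigr => y _; rewrite opprB addrC opprK. Qed.

(** A crude bound that makes the infima defining [curvature] and [Kmin] genuine; its value is
    immaterial. *)
Lemma lap_diff_lb x y f : e x y -> potential x y f -> - (#|T|%:R *+ 2) <= lap f x - lap f y.
Proof.
move=> exy /potentialP[] // _ fL; have := lap_lb x fL.
have /(@lap_lb _ y) : lipschitz (fun v => - f v).
  by move=> u v euv; have := fL v u; rewrite e_sym => /(_ euv); lra.
rewrite lapN mulr2n; lra.
Qed.

Lemma curvature_le x y f : e x y -> potential x y f -> curvature e R x y <= lap f x - lap f y.
Proof.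
move=> exy fP; apply: ge_inf; last by exists f.
by exists (- (#|T|%:R *+ 2)) => _ [g gP <-]; apply: lap_diff_lb.
Qed.

Lemma realdist_lipschitz x : lipschitz (realdist x).
Proof. by move=> u v euv; have := dist_step e_conn x euv; rewrite -(ler_nat R) /realdist -natr1; lra. Qed.

Lemma realdist_potential x y z : e y z -> d x z = (d x y).+1 -> potential y z (realdist x).
Proof.
move=> eyz dz; apply/potentialP => //; split; last exact: realdist_lipschitz.
by rewrite /realdist dz -natr1; lra.
Qed.

Lemma edge_potential x y : e x y -> potential x y (realdist x).
Proof.
by move=> exy; apply: realdist_potential => //; rewrite (dist_edge e_irr e_conn exy) (distxx e_conn).
Qed.

Lemma curvature_ge x y c : e x y -> (forall f, potential x y f -> c <= lap f x - lap f y) ->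
  c <= curvature e R x y.
Proof.
move=> exy cP; apply: lb_le_inf => [|_ [f fP <-]]; last exact: cP.
by exists (lap (realdist x) x - lap (realdist x) y); exists (realdist x) => //; apply: edge_potential.
Qed.

Lemma Kmin_le x y : e x y -> Kmin e R <= curvature e R x y.
Proof.
move=> exy; apply: ge_inf; last by exists x, y.
exists (- (#|T|%:R *+ 2)) => _ [u [v [euv ->]]].
by apply: curvature_ge => // f; apply: lap_diff_lb.
Qed.

Lemma Kmin_le_potential x y f : e x y -> potential x y f -> Kmin e R <= lap f x - lap f y.
Proof. by move=> exy fP; apply: le_trans (Kmin_le exy) (curvature_le exy fP). Qed.

Lemma Kmin_ge x y c : e x y -> (forall u v, e u v -> c <= curvature e R u v) -> c <= Kmin e R.
Proof.
move=> exy cP; apply: lb_le_inf => [|_ [u [v [euv ->]]]]; last exact: cP.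
by exists (curvature e R x y), x, y.
Qed.

Lemma sum_lap f : \sum_x lap f x = 0.
Proof.
have antisym : \sum_x lap f x = - \sum_x lap f x.
  rewrite -sumrN /Defs.lap (exchange_big_dep xpredT) //=; apply: eq_bigr => x _.
  rewrite -sumrN; apply: eq_big => [y|y _]; first by rewrite e_sym.
  by rewrite opprB.
lra.
Qed.

Lemma connected_nbr : (1 < #|T|)%N -> forall x, exists y, e x y.
Proof.
move=> T2 x; have /card_gt0P[y] : (0 < #|[set~ x]|)%N by rewrite cardsC1; lia.
rewrite !inE => nyx; have /connectP[[|z p] /= pP ly] := e_conn x y.
  by rewrite ly eqxx in nyx.
by exists z; case/andP: pP.
Qed.

(** * Curvature of completable graphs *)

Section Rigid.
Hypothesis compl : completable e.
Local Notation rfl := (rfl e).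

(** The reflection matches the neighbours of y with those of z, so the difference becomes a single
    sum; each 1 is [f z - f y]. *)
Lemma lap_rfl f y z : e y z -> f z - f y = 1 ->
  lap f y - lap f z = \sum_(w | e y w) (1 + (f w - f (rfl y z w))).
Proof.
move=> eyz fyz; rewrite /Defs.lap [X in _ - X](reindex_inj (rfl_inj e_sym e_irr e_conn compl eyz)) /=.
have ez w : e z (rfl y z w) = e y w.
  by rewrite -{1}(rfl_left e_sym e_irr e_conn compl eyz) rfl_edge.
rewrite [X in _ - X](eq_bigl _ _ ez).
by rewrite -sumrB; apply: eq_bigr => w _; rewrite -fyz; lra.
Qed.

(** Origin of K = t + 2: among the neighbours of y, z weighs 2, a common neighbour 1 and a private
    one 0. *)
Lemma sum_nbr_types y z : e y z ->
  \sum_(w | e y w) (((w == z).*2 + e z w)%N%:R : R) = (triangles e y z).+2%:R.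
Proof.
move=> eyz; rewrite -natr_sum; congr _%:R; rewrite big_split /= (bigD1 z) //= eqxx.
rewrite big1 => [|w /andP[_ /negPf->]] //; rewrite addn0 /triangles -sum1_card.
rewrite big_mkcond [in RHS]big_mkcond /= add2n; congr _.+2.
by apply: eq_bigr => w _; rewrite inE; case: (e y w); case: (e z w).
Qed.

Lemma rfl_private y z w : e y z -> e y w -> w != z -> ~~ e z w ->
  d w z = 2 /\ parallel e y z w (rfl y z w).
Proof.
move=> eyz eyw nwz nezw; have dwz : d w z = 2.
  by apply: (dist2 e_sym e_irr e_conn eyw eyz); rewrite 1?e_sym.
by split=> //; apply: rfl_par; rewrite // dwz (distC e_sym e_conn) (dist_edge e_irr e_conn eyw).
Qed.

Lemma rfl_common y z w : e y z -> e y w -> e z w -> rfl y z w = w.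
Proof.
move=> eyz eyw ezw; apply: rfl_fix.
by rewrite !(distC e_sym e_conn w) !(dist_edge e_irr e_conn).
Qed.

(** A private neighbour w is adjacent to its mirror image, so its term is nonnegative; the other
    terms equal their weights. *)
Lemma lap_diff_ge y z f : e y z -> potential y z f ->
  (triangles e y z).+2%:R <= lap f y - lap f z.
Proof.
move=> eyz /potentialP[] // fyz fL; rewrite lap_rfl // -sum_nbr_types //.
apply: ler_sum => w eyw; have [->|nwz] := eqVneq w z.
  by rewrite (negPf (negbT (e_irr z))) rfl_right //= fyz.
have [ezw|nezw] := boolP (e z w); first by rewrite rfl_common //= subrr addr0.
rewrite /= add0n; have [dwz /(par_edge e_irr e_conn)] := rfl_private eyz eyw nwz nezw.
rewrite dwz (distC e_sym e_conn) (dist_edge e_irr e_conn eyw) => /(_ eyz erefl) /fL; lra.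
Qed.

(** Here private terms vanish: d(x,.) rises by one along every edge parallel to yz. *)
Lemma lap_diff_realdist x y z : e y z -> d x z = (d x y).+1 ->
  lap (realdist x) y - lap (realdist x) z = (triangles e y z).+2%:R.
Proof.
move=> eyz dz; have fyz : realdist x z - realdist x y = 1 by rewrite /realdist dz -natr1; lra.
rewrite lap_rfl // -sum_nbr_types //; apply: eq_bigr => w eyw.
have [->|nwz] := eqVneq w z.
  by rewrite (negPf (negbT (e_irr z))) rfl_right //= fyz.
have [ezw|nezw] := boolP (e z w); first by rewrite rfl_common //= subrr addr0.
have [_ /parP/(_ x)] := rfl_private eyz eyw nwz nezw.
rewrite /= add0n dz /realdist => eq_d; rewrite (_ : d x (rfl y z w) = (d x w).+1); last by lia.
by rewrite -natr1; lra.
Qed.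

Hypotheses (loc : locally_connected e) (T2 : (1 < #|T|)%N).

Lemma completable_Kmin y z : e y z -> Kmin e R = (triangles e y z).+2%:R.
Proof.
move=> eyz; apply/eqP; rewrite eq_le; apply/andP; split.
  rewrite -(@lap_diff_realdist y); rewrite ?(distxx e_conn) ?(dist_edge e_irr e_conn) //.
  exact: Kmin_le_potential (edge_potential eyz).
apply: Kmin_ge (eyz) _ => u v euv; apply: curvature_ge => // f fP.
by rewrite (triangles_const e_sym e_irr e_conn compl loc eyz euv); apply: lap_diff_ge.
Qed.

Lemma lap_realdist x y : lap (realdist x) y = (Deg e x)%:R - Kmin e R * realdist x y.
Proof.
have [n le_n] := ubnP (d x y); elim: n y le_n => // n IHn y lt_n.
have [/(dist0P e_conn)<-|/(dist_pred e_conn)[z [ezy dz]]] := posnP (d x y).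
  rewrite /Defs.lap {3}/realdist (distxx e_conn) mulr0 subr0 /Deg -sum1_card natr_sum.
  apply: eq_big => [w|w exw]; first by rewrite inE.
  by rewrite /realdist (distxx e_conn) (dist_edge e_irr e_conn exw) subr0.
have := @lap_diff_realdist x z y ezy (esym dz); rewrite -completable_Kmin // IHn; last by lia.
by rewrite {2 4}/realdist -dz -natr1; lra.
Qed.

Lemma completable_eff_BM_sharp : eff_BM_sharp e R.
Proof.
have /card_gt0P[x0 _] : (0 < #|T|)%N by apply: ltn_trans T2.
have [y0 exy0] := connected_nbr T2 x0.
have K_gt0 : 0 < Kmin e R by rewrite (completable_Kmin exy0) ltr0n.
split=> //; have DegE x : Deg e x = Deg e x0 by apply: Deg_const.
have -> : maxDeg e = Deg e x0.
  apply/eqP; rewrite eqn_leq (@leq_bigmax _ (Deg e)) andbT.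
  by apply/bigmax_leqP => x _; rewrite DegE.
have T_gt0 : #|T|%:R != 0 :> R by rewrite pnatr_eq0; lia.
have sum_realdist x : \sum_y realdist x y = #|T|%:R * ((Deg e x0)%:R / Kmin e R).
  have := sum_lap (realdist x); under eq_bigr do rewrite lap_realdist DegE.
  rewrite sumrB sumr_const -mulr_sumr -[_ *+ #|_|]mulr_natl => /eqP; rewrite subr_eq0 => /eqP sumE.
  rewrite mulrA sumE mulrAC divff ?mul1r //; exact: lt0r_neq0.
rewrite /diam_eff; under eq_bigr do rewrite sum_realdist.
rewrite sumr_const -[X in X / _]mulr_natl mulrA -expr2 mulrAC divff ?mul1r //.
by rewrite expf_neq0.
Qed.

(** Lichnerowicz's bound. Divided by its largest increment over an edge, an eigenfunction is a
    potential for the maximising edge, and there the difference of Laplacians is [mu]. *)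
Lemma eig_ge_Kmin mu : 0 < mu -> is_eig_negLap e mu -> Kmin e R <= mu.
Proof.
move=> mu_gt0 [f [[x0 fx0] fE]].
have lapx0 : lap f x0 != 0 by rewrite -oppr_eq0 fE mulf_neq0 // lt0r_neq0.
have [y0 exy0 fy0] : exists2 y, e x0 y & f y != f x0.
  apply/exists_inP; apply: contraNT lapx0; rewrite negb_exists_in => /forall_inP f0.
  by rewrite /Defs.lap big1 // => y /f0; rewrite negbK => /eqP ->; rewrite subrr.
(* An edge oriented so that f increases makes the maximal increment positive, which permits dividing
   by it. *)
pose p0 := if f x0 < f y0 then (x0, y0) else (y0, x0).
have ep0 : e p0.1 p0.2 by rewrite /p0; case: ifP => _ //=; rewrite e_sym.
have fp0 : 0 < f p0.2 - f p0.1.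
  by rewrite /p0 subr_gt0; case: ifPn => //= nlt; rewrite lt_neqAle fy0 leNgt.
case: (@arg_maxP _ _ _ p0 (fun p => e p.1 p.2) (fun p => f p.2 - f p.1) ep0) => -[x y] /= exy fmax.
set g := f y - f x in fmax.
have g_gt0 : 0 < g by apply: lt_le_trans fp0 (fmax _ ep0).
have gN0 := lt0r_neq0 g_gt0.
pose h v := f v / g.
have hP : potential x y h.
  apply/potentialP => //; split=> [|u v euv]; rewrite /h -mulrBl; first by rewrite divff.
  by rewrite ler_pdivrMr // mul1r; apply: fmax (u, v) euv.
have lap_h v : lap h v = - mu * h v.
  rewrite /h mulrA mulNr -fE opprK /Defs.lap mulr_suml.
  by apply: eq_bigr => w _; rewrite mulrBl.
apply: le_trans (Kmin_le_potential exy hP) _; rewrite !lap_h.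
by case: hP => hxy _; rewrite (_ : _ - _ = mu * (h y - h x)); [rewrite hxy mulr1|lra].
Qed.

Lemma completable_Lichnerowicz : Lichnerowicz_sharp e R.
Proof.
have /card_gt0P[x _] : (0 < #|T|)%N by apply: ltn_trans T2.
have [y exy] := connected_nbr T2 x.
have K_gt0 : 0 < Kmin e R by rewrite (completable_Kmin exy) ltr0n.
split=> //; last exact: eig_ge_Kmin.
pose f v := (Deg e x)%:R / Kmin e R - realdist x v.
have KN0 := lt0r_neq0 K_gt0.
exists f; split.
  exists x; rewrite /f /realdist (distxx e_conn) subr0 mulf_neq0 ?invr_eq0 // pnatr_eq0 /Deg.
  by rewrite -lt0n; apply/card_gt0P; exists y; rewrite inE.
move=> v; rewrite /f mulrBr mulrCA divff // mulr1 -lap_realdist /Defs.lap -sumrN.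
by apply: eq_bigr => w _; lra.
Qed.

End Rigid.
End Curvature.

(** * Optimal potentials *)

Section Tight.
Local Open Scope ring_scope.
Variables (R : realType) (T : finType) (e : rel T).
Hypotheses (e_sym : symmetric e) (e_irr : irreflexive e) (e_conn : connected_graph e).
Local Notation d := (dist e).
Local Notation par := (parallel e).
Local Notation lap := (@lap T e R).
Local Notation potential := (@potential R T e).
Local Notation dst := (@realdist R T e).
Local Notation dC := (distC e_sym e_conn).
Local Notation dxx := (distxx e_conn).
Local Notation dE := (dist_edge e_irr e_conn).

Lemma finite_gap (I : finType) (P : pred I) (F : I -> R) :
  (forall i, P i -> 0 < F i) -> exists2 eps, 0 < eps & forall i, P i -> eps <= F i.
Proof.
case: (pickP P) => [i0 Pi0|P0 _]; last by exists 1 => // i; rewrite P0.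
by case: (arg_minP F Pi0) => i Pi le_i /(_ i Pi); exists (F i).
Qed.

Definition tight (f : T -> R) : rel T := fun u v => e u v && (f v - f u == 1).

(* Lowering f on the set C reachable from x' by tight edges keeps it Lipschitz, so minimality forces C to
   meet the neighbours of y. *)
Lemma tight_exists (f : T -> R) x y x' : e x y -> potential x y f ->
  (forall g, potential x y g -> lap f x - lap f y <= lap g x - lap g y) ->
  e x x' -> ~~ connect (tight f) x' x -> ~~ connect (tight f) x' y ->
  exists2 w, connect (tight f) x' w & e y w.
Proof.
move=> exy fP f_min exx' ncx ncy; pose C := connect (tight f) x'.
have Cx : C x = false := negbTE ncx; have Cy : C y = false := negbTE ncy.
have [fxy fL] := (potentialP e_sym f exy).1 fP.
(* [eps] is at most the slack of every edge leaving C. These edges are not tight, as C is closed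
   under tight edges, so the slack is positive. *)
have [|eps eps_gt0 epsP] := @finite_gap _
    (fun p : T * T => [&& C p.1, ~~ C p.2 & e p.1 p.2]) (fun p => 1 - (f p.2 - f p.1)).
  move=> [u v] /= /and3P[Cu nCv euv]; rewrite subr_gt0 lt_neqAle fL // andbT.
  apply: contra nCv => /eqP tight_uv; apply: connect_trans Cu _.
  by apply: connect1; rewrite /tight euv tight_uv eqxx.
pose g v := f v - eps * (C v)%:R.
have gP : potential x y g.
  apply/potentialP => //; rewrite /g Cx Cy mulr0 !subr0; split=> // u v euv.
  have := epsP (u, v); rewrite /= euv andbT; have := fL u v euv.
  by case: (C u); case: (C v) => /=; rewrite ?mulr1 ?mulr0 => ?; [|move/(_ isT)| |] ; lra.
have lap_g v : ~~ C v -> lap g v = lap f v - eps * \sum_(w | e v w) (C w)%:R.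
  move=> nCv; rewrite /Defs.lap mulr_sumr -sumrB; apply: eq_bigr => w _.
  by rewrite /g (negPf nCv) mulr0; lra.
have := f_min g gP; rewrite !lap_g ?Cx ?Cy // => le_fg.
(* Minimality says that x has at most as many neighbours in C as y; since x' is one of them, y has
   one too. *)
have le_C : \sum_(w | e x w) (C w)%:R <= \sum_(w | e y w) (C w)%:R :> R.
  rewrite -subr_ge0 -(pmulr_rge0 _ eps_gt0); lra.
apply/exists_inP; apply: contraLR le_C; rewrite negb_exists_in => /forall_inP nC.
rewrite -ltNge [X in X < _]big1 => [|w eyw]; last first.
  by case Cw: (C w) => //; have := nC w Cw; rewrite eyw.
rewrite (bigD1 x') //= (_ : C x'); last exact: connect0.
by rewrite ltr_wpDr // sumr_ge0.
Qed.

Section Sharp.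
Hypothesis sharp : forall x y z, e y z -> d x z = (d x y).+1 ->
  lap (dst x) y - lap (dst x) z = Kmin e R.

(** The average f of d(x,.) over all x nearer to y is still optimal, and an edge tight for f is
    tight for each of these functions. Hence one z' serves all x at once. *)
Lemma tight_partner y z y' : e y z -> e y y' -> d y' z = 2 ->
  exists z', [/\ e z z', e y' z' & forall x, (d x y < d x z)%N -> d x z' = (d x y').+1].
Proof.
move=> eyz eyy' dy'z; pose A := [set x | (d x y < d x z)%N].
have AP x : x \in A -> d x z = (d x y).+1.
  by rewrite inE; have := dist_step e_conn x eyz; lia.
have Ay : y \in A by rewrite inE dxx dE.
have m_gt0 : 0 < #|A|%:R :> R by rewrite ltr0n; apply/card_gt0P; exists y.
have m_neq0 := lt0r_neq0 m_gt0.
pose f v := (\sum_(x in A) dst x v) / #|A|%:R.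
have fB u v : f v - f u = (\sum_(x in A) (dst x v - dst x u)) / #|A|%:R.
  by rewrite sumrB mulrBl.
have cardA : #|A|%:R = \sum_(x in A) 1 :> R by rewrite -sum1_card natr_sum.
have fL : lipschitz e f.
  move=> u v euv; rewrite fB ler_pdivrMr // mul1r cardA.
  by apply: ler_sum => x _; apply: realdist_lipschitz.
have fyz : f z - f y = 1.
  rewrite fB (eq_bigr (fun=> 1)) ?sumr_const ?divff // => x /AP dz.
  by rewrite /realdist dz -natr1; lra.
have fP : potential y z f by apply/potentialP.
have lap_f v : lap f v = (\sum_(x in A) lap (dst x) v) / #|A|%:R.
  by rewrite /Defs.lap exchange_big /= mulr_suml; apply: eq_bigr => w _; rewrite fB.
have f_min g : potential y z g -> lap f y - lap f z <= lap g y - lap g z.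
  move=> gP; apply: le_trans (Kmin_le_potential e_sym e_irr e_conn eyz gP).
  rewrite !lap_f -mulrBl -sumrB (eq_bigr (fun=> Kmin e R)) => [|x /AP dz]; last exact: sharp.
  by rewrite sumr_const -[X in X / _]mulr_natr mulfK.
have tightP u v : tight f u v -> forall x, x \in A -> d x v = (d x u).+1.
  case/andP=> euv /eqP; rewrite fB => /(congr1 ( *%R^~ #|A|%:R));
    rewrite mulfVK // mul1r cardA => /esym/eqP; rewrite -subr_eq0 -sumrB.
  rewrite psumr_eq0 => [/allP H x Ax|x Ax]; last by rewrite subr_ge0; apply: realdist_lipschitz.
  have := H x (mem_index_enum x); rewrite Ax subr_eq0 /realdist => /eqP eq1.
  by apply/eqP; rewrite -(eqr_nat R) -natr1; apply/eqP; rewrite [in X in _ = _ + X]eq1; lra.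
have tight_path p u : path (tight f) u p -> d y (last u p) = (d y u + size p)%N.
  elim: p u => [|v p IHp] u /=; first by rewrite addn0.
  by case/andP=> /tightP/(_ y Ay) dv /IHp ->; rewrite dv; lia.
have dyy' := dE eyy'; have dyz := dE eyz.
have [||w /connectP[p pP lw] ezw] := tight_exists eyz fP f_min eyy'.
- by apply/negP => /connectP[p /tight_path dp ly]; move: dp; rewrite -ly dxx; lia.
- apply/negP => /connectP[[|v p] /tight_path dp ly]; last by move: dp; rewrite -ly dyz /=; lia.
  by move: dy'z; rewrite ly /= dxx.
(* The distance from y grows by one per tight edge, but a neighbour of z is within distance 2 of y;
   so the tight path from y' to it has exactly one edge. *)
have := tight_path _ _ pP; rewrite -lw; have := dist_step e_conn y ezw.
rewrite dyz dyy'; case: p pP lw => [|v [|v' p]] /=.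
- by move=> _ lw; move: dy'z; rewrite -lw dC dE.
- rewrite andbT => tv wv _ _; subst w; exists v; split=> // [|x Ax]; first by case/andP: tv.
  by apply: tightP tv _ _; rewrite inE.
- by clear => _ _; lia.
Qed.

(** The argument for the edge zy and the vertex z' returns some y''. It lies on the y side and is
    adjacent to z', which forces y'' = y' and yields the condition for the z side. *)
Lemma tight_partner2 y z y' : e y z -> e y y' -> d y' z = 2 ->
  exists z', [/\ e z z', e y' z', forall x, (d x y < d x z)%N -> d x z' = (d x y').+1 &
                 forall x, (d x z < d x y)%N -> d x y' = (d x z').+1].
Proof.
move=> eyz eyy' dy'z; have [z' [ezz' ey'z' near]] := tight_partner eyz eyy' dy'z.
have ezy : e z y by rewrite e_sym.
have dz'y : d z' y = 2 by rewrite dC near ?dxx ?dE.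
have [y'' [eyy'' ez'y'' far]] := tight_partner ezy ezz' dz'y.
have dzy'' : d y'' z = 2 by rewrite dC far ?dxx ?dE.
have := near y''; rewrite dzy'' (dC y'' y) (dC y'' z') (dE eyy'') (dE ez'y'') => /(_ isT) dy''.
have eq_y : y'' = y' by apply: (dist0P e_conn); lia.
by exists z'; split=> //; rewrite -eq_y.
Qed.

(** What is left are vertices equidistant from y and z. Exchanging the roles of yz and y'z' recovers
    z as the partner at y, so a strict inequality at y'z' would force one at yz. *)
Lemma sharp_completable : completable e.
Proof.
move=> y z y' eyz eyy' dy'z.
have [z' [ezz' ey'z' near far]] := tight_partner2 eyz eyy' dy'z; exists z'.
have dyz' : d y z' = 2 by rewrite near ?dxx ?dE.
have ey'y : e y' y by rewrite e_sym.
have [w [ez'w eyw near' far']] := tight_partner2 ey'z' ey'y dyz'.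
have dzw : z = w.
  apply: (dist0P e_conn).
  have := far' z; rewrite (dC z y') dy'z (dE ezz') => /(_ isT).
  by rewrite (dC z y) (dE eyz); lia.
apply/parP => v; case: (edge_side e_sym e_conn v eyz) => dv.
- case: (edge_side e_sym e_conn v ey'z') => dv'.
  + by rewrite dv dv'.
  + by have := near' v; rewrite dv' -dzw dv; lia.
  + by have := far' v; rewrite dv' -dzw dv; lia.
- by rewrite near ?dv //; lia.
- by rewrite far ?dv //; lia.
Qed.

End Sharp.

Lemma lap_realdist_le x y : lap (dst x) y <= (Deg e x)%:R - Kmin e R * dst x y.
Proof.
have [n le_n] := ubnP (d x y); elim: n y le_n => // n IHn y lt_n.
have [/(dist0P e_conn)<-|/(dist_pred e_conn)[z [ezy dz]]] := posnP (d x y).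
  rewrite /Defs.lap {3}/realdist dxx mulr0 subr0 /Deg -sum1_card natr_sum.
  rewrite le_eqVlt; apply/orP; left; apply/eqP; apply: eq_big => [w|w exw]; first by rewrite inE.
  by rewrite /realdist dxx (dE exw) subr0.
have := Kmin_le_potential e_sym e_irr e_conn ezy (realdist_potential R e_sym e_conn ezy (esym dz)).
have dyz : dst x y = dst x z + 1 by rewrite /realdist -dz natr1.
by have := IHn z; rewrite dyz => /(_ ltac:(lia)); lra.
Qed.

(** The defect of [lap_realdist_le], with the maximal degree in place of the degree, is nonnegative.
    As Laplacians sum to zero, (i) says that all defects sum to zero, so each vanishes. *)
Lemma eff_BM_sharp_completable : (1 < #|T|)%N -> eff_BM_sharp e R -> completable e.
Proof.
move=> T2 [K_gt0 diamE]; pose K := Kmin e R.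
have KN0 := lt0r_neq0 K_gt0.
pose defect x y := (maxDeg e)%:R - K * dst x y - lap (dst x) y.
have defect_ge0 x y : 0 <= defect x y.
  have : (Deg e x)%:R <= (maxDeg e)%:R :> R by rewrite ler_nat (@leq_bigmax _ (Deg e)).
  by have := lap_realdist_le x y; rewrite /defect /K; lra.
have T_neq0 : #|T|%:R != 0 :> R by rewrite pnatr_eq0; lia.
have sum_defect : \sum_x \sum_y defect x y = 0.
  have -> : \sum_x \sum_y defect x y =
      #|T|%:R ^+ 2 * (maxDeg e)%:R - K * \sum_x \sum_y dst x y.
    rewrite mulr_sumr expr2 -mulrA 2!mulr_natl -!sumr_const -sumrB; apply: eq_bigr => x _.
    by rewrite sumrB sum_lap // subr0 sumrB -mulr_sumr sumr_const.
  rewrite (_ : \sum_x _ = #|T|%:R ^+ 2 * ((maxDeg e)%:R / K)); first by field.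
  by rewrite -diamE /diam_eff mulrCA mulfV ?mulr1 ?expf_neq0.
have defect0 x y : defect x y = 0.
  have /eqP := sum_defect; rewrite psumr_eq0 => [/allP/(_ x (mem_index_enum x))/eqP sum_x|u _].
    have /eqP := sum_x; rewrite psumr_eq0 // => /allP/(_ y (mem_index_enum y))/eqP //.
  exact: sumr_ge0.
apply: sharp_completable => x y z eyz dz; have := defect0 x y; have := defect0 x z.
have dyz : dst x z = dst x y + 1 by rewrite /realdist dz natr1.
by rewrite /defect -/K dyz; lra.
Qed.

End Tight.

(** * The eigenspace representation of a distance regular graph *)

Section DistanceRegular.
Local Open Scope ring_scope.
Variables (R : realType) (T : finType) (e : rel T).
Hypotheses (e_sym : symmetric e) (e_irr : irreflexive e) (e_conn : connected_graph e).
Local Notation d := (dist e).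
Local Notation potential := (@potential R T e).
Local Notation lap := (@lap T e R).
Local Notation dC := (distC e_sym e_conn).
Local Notation dxx := (distxx e_conn).
Local Notation dE := (dist_edge e_irr e_conn).
Variables b c : nat -> nat.
Hypothesis dr : forall x z,
  #|[set w | e z w & d x w == (d x z).+1]| = b (d x z) /\
  #|[set w | e z w & (d x w).+1 == d x z]| = c (d x z).

Let k : R := (b 0%N)%:R.
Let a i : R := k - (b i)%:R - (c i)%:R.

Definition level (i : nat) x z : R := (d x z == i)%:R.

Lemma drg_Deg x : Deg e x = b 0%N.
Proof.
rewrite -(dxx x) -(dr x x).1 /Deg; apply: eq_card => w; rewrite !inE dxx.
by case exw: (e x w) => //=; rewrite (dE exw).
Qed.

Lemma drg_c0 (x : T) : c 0%N = 0%N.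
Proof.
have [_] := dr x x; rewrite dxx => <-.
by apply: eq_card0 => v; rewrite !inE andbF.
Qed.

Lemma sum_nbr_const x : \sum_(w | e x w) (1 : R) = k.
Proof. by rewrite /k -(drg_Deg x) /Deg -sum1_card natr_sum; apply: eq_bigl => w; rewrite inE. Qed.

Lemma sum_up x z : \sum_(w | e z w) level (d x z).+1 x w = (b (d x z))%:R.
Proof.
rewrite -(dr x z).1 -sum1_card natr_sum big_mkcond [in RHS]big_mkcond; apply: eq_bigr => w _.
by rewrite inE /level; case: (e z w) => //=; case: eqP.
Qed.

Lemma sum_down x z : \sum_(w | e z w) ((d x w).+1 == d x z)%:R = (c (d x z))%:R :> R.
Proof.
rewrite -(dr x z).2 -sum1_card natr_sum big_mkcond [in RHS]big_mkcond; apply: eq_bigr => w _.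
by rewrite inE; case: (e z w) => //=; case: eqP.
Qed.

Lemma level_split x z w : e z w ->
  level (d x z).+1 x w + ((d x w).+1 == d x z)%:R + level (d x z) x w = 1.
Proof.
move=> ezw; rewrite /level; case: (edge_side e_sym e_conn x ezw) => ->.
- by rewrite eqxx (gtn_eqF (ltnSn _)) (ltn_eqF (ltnSn _)) !add0r.
- by rewrite eqxx !(gtn_eqF _) ?addr0 //; lia.
- by rewrite eqxx !(ltn_eqF _) ?addr0 ?add0r //; lia.
Qed.

Lemma sum_flat x z : \sum_(w | e z w) level (d x z) x w = a (d x z).
Proof.
rewrite /a -(sum_nbr_const z) -(sum_up x z) -(sum_down x z) -!sumrB; apply: eq_bigr => w ezw.
by have := level_split x ezw; move: (level _ _ _) (level _ _ _) ((_ == _)%:R) => l1 l2 l3; lra.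
Qed.

Lemma sum_radial (u : nat -> R) x z : \sum_(w | e z w) u (d x w) =
  (b (d x z))%:R * u (d x z).+1 + (c (d x z))%:R * u (d x z).-1 + a (d x z) * u (d x z).
Proof.
rewrite -sum_up -sum_down -sum_flat !mulr_suml -!big_split; apply: eq_bigr => w ezw /=.
rewrite /level; case: (edge_side e_sym e_conn x ezw) => ->.
- by rewrite eqxx (gtn_eqF (ltnSn _)) (ltn_eqF (ltnSn _)) !mul0r mul1r !add0r.
- by rewrite eqxx !(gtn_eqF _) ?mul0r ?mul1r ?addr0 //; lia.
- by rewrite eqxx !(ltn_eqF _) ?mul0r ?mul1r ?addr0 ?add0r //; lia.
Qed.

(** The distance-i matrix A_i applied to f. *)
Definition sphere_sum i (f : T -> R) x := \sum_z level i x z * f z.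

Lemma sphere_sum0 f x : sphere_sum 0%N f x = f x.
Proof.
rewrite /sphere_sum (bigD1 x) //= /level dxx mul1r big1 ?addr0 // => z nzx.
by rewrite (dist_eq0 e_conn) eq_sym (negPf nzx) mul0r.
Qed.

Lemma sphere_sum_empty i f x : (forall z, d x z != i) -> sphere_sum i f x = 0.
Proof. by move=> Si; rewrite /sphere_sum big1 // => z _; rewrite /level (negPf (Si z)) mul0r. Qed.

Definition inflow i f x := if i is j.+1 then (b j)%:R * sphere_sum j f x else 0.

(** The three-term recurrence A A_i = b_{i-1} A_{i-1} + a_i A_i + c_{i+1} A_{i+1}; [inflow] is its
    first term, read as 0 for i = 0. *)
Lemma sphere_sum_step i f x :
  \sum_z level i x z * \sum_(w | e z w) f w = inflow i f x
  + a i * sphere_sum i f x + (c i.+1)%:R * sphere_sum i.+1 f x.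
Proof.
transitivity (\sum_w (\sum_(z | e w z) level i x z) * f w).
  under eq_bigr do rewrite mulr_sumr big_mkcond.
  rewrite exchange_big; apply: eq_bigr => w _; rewrite -big_mkcond mulr_suml /=.
  by apply: eq_bigl => z; rewrite e_sym.
have -> : inflow i f x =
    \sum_w (if i is j.+1 then (b j)%:R * level j x w else 0) * f w.
  case: i => [|j]; first by rewrite big1 // => w _; rewrite mul0r.
  by rewrite /inflow /sphere_sum mulr_sumr; apply: eq_bigr => w _; rewrite mulrA.
rewrite /sphere_sum !mulr_sumr -!big_split; apply: eq_bigr => w _ /=.
rewrite !mulrA -!mulrDl; congr (_ * _).
rewrite (sum_radial (fun n => (n == i)%:R)) /level.
have [eq_i|ne_i] := eqVneq (d x w) i.
  rewrite eq_i (gtn_eqF (ltnSn _)) (ltn_eqF (ltnSn _)) !mulr0 addr0 mulr1.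
  case: i eq_i => [|j] eq_i; last first.
    by rewrite /= (gtn_eqF (ltnSn _)) (ltn_eqF (ltnSn _)) !mulr0 add0r.
  by rewrite (drg_c0 x) mulr0n mul0r addr0.
rewrite !mulr0 !addr0; congr (_ + _).
  case: i ne_i => [|j] ne_i; first by rewrite mulr0.
  by rewrite eqSS; case: eqP => [->|]; rewrite ?mulr0.
have [->|] := eqVneq (d x w) i.+1; first by rewrite eqxx.
case: (d x w) ne_i => [|n]; rewrite ?eqSS /=; last by move=> _ /negPf->; rewrite !mulr0.
by move=> /negPf-> _; rewrite !mulr0.
Qed.

Definition eig lam (f : T -> R) := forall z, - lap f z = lam * f z.

Lemma eig_sum lam f z : eig lam f -> \sum_(w | e z w) f w = (k - lam) * f z.
Proof.
move=> /(_ z); rewrite /Defs.lap sumrB -(sum_nbr_const z) mulrBl => <-.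
by rewrite mulr_suml; under [X in X - _]eq_bigr do rewrite mul1r; lra.
Qed.

Lemma eig_rec lam f i x : eig lam f ->
  (c i.+1)%:R * sphere_sum i.+1 f x = (k - lam - a i) * sphere_sum i f x
    - inflow i f x.
Proof.
move=> feig; have := sphere_sum_step i f x.
under eq_bigr do rewrite (eig_sum _ feig) mulrCA; rewrite -mulr_sumr -/(sphere_sum i f x) !mulrBl.
by rewrite -/(inflow i f x); lra.
Qed.

Lemma c_neq0 i x z : d x z = i.+1 -> c i.+1 != 0%N.
Proof.
move=> dz; have [|w [ewz dw]] := @dist_pred _ _ e_conn x z; first by rewrite dz.
rewrite -dz -(dr x z).2 -lt0n; apply/card_gt0P; exists w.
by rewrite inE e_sym ewz dw dz eqxx.
Qed.

Lemma sphere_sum_empty_all i f x : c i.+1 = 0%N -> sphere_sum i.+1 f x = 0.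
Proof.
by move=> c0; apply: sphere_sum_empty => z; apply: contra_eq_neq c0 => /c_neq0; apply.
Qed.

(* Cross-multiplied, since f and g may vanish at the centres x and y. *)
Lemma sphere_sum_prop lam f g x y i : eig lam f -> eig lam g ->
  sphere_sum i f x * g y = sphere_sum i g y * f x.
Proof.
move=> feig geig; suff: sphere_sum i f x * g y = sphere_sum i g y * f x /\
  sphere_sum i.+1 f x * g y = sphere_sum i.+1 g y * f x by case.
have step j : (if j is j'.+1 then sphere_sum j' f x * g y = sphere_sum j' g y * f x else True) ->
    sphere_sum j f x * g y = sphere_sum j g y * f x ->
    sphere_sum j.+1 f x * g y = sphere_sum j.+1 g y * f x.
  (* If c_{j+1} = 0 there are no vertices at distance j + 1, so both sums are empty; otherwise the
     recurrence can be divided by it. *)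
  move=> IH1 IH2; have [c0|cN0] := eqVneq (c j.+1) 0%N.
    by rewrite !sphere_sum_empty_all // !mul0r.
  have cR : (c j.+1)%:R != 0 :> R by rewrite pnatr_eq0.
  apply: (mulfI cR); rewrite !mulrA (eig_rec j x feig) (eig_rec j y geig) !mulrBl -!mulrA IH2.
  by congr (_ - _); rewrite /inflow; case: (j) IH1 => [_|j' IH1']; rewrite ?mul0r // -!mulrA IH1'.
elim: i => [|i [IH1 IH2]]; last by split=> //; apply: step.
by split; [|apply: step]; rewrite // !sphere_sum0 mulrC.
Qed.

(** * The cosine sequence of an eigenvalue *)

Variables (lam : R) (f0 : T -> R) (x0 : T).
Hypotheses (lam_gt0 : 0 < lam) (f0_eig : eig lam f0) (f0x0 : f0 x0 != 0).

(** [q i] is the eigenvalue of A_i on the eigenspace, [k_ i] the size of a sphere and [u i] the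
    cosine sequence, equal to 0 where the spheres are empty. *)
Let q (i : nat) := sphere_sum i f0 x0 / f0 x0.
Let k_ (i : nat) := sphere_sum i (fun=> 1) x0.
Let u (i : nat) := q i / k_ i.

(** The function [cosine x] is also the vector representing x in the eigenspace: by [cosine_conv],
    the inner product of [cosine x] and [cosine z] is [v0] times [cosine x z]. *)
Definition cosine x z := u (d x z).

Lemma sphere_sum_eig f x i : eig lam f -> sphere_sum i f x = q i * f x.
Proof.
move=> feig; apply: (mulIf f0x0); rewrite (sphere_sum_prop x x0 i feig f0_eig) /q.
by rewrite mulrAC divfK.
Qed.

(** Constants are eigenfunctions for 0, so [sphere_sum_prop] applies to sphere sizes as well. *)
Lemma sphere_card x i : sphere_sum i (fun=> 1) x = k_ i.
Proof.
have eig1 : eig 0 (fun=> 1).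
  by move=> z; rewrite /Defs.lap mul0r big1 ?oppr0 // => w _; rewrite subrr.
by have := sphere_sum_prop x x0 i eig1 eig1; rewrite !mulr1.
Qed.

Lemma sphere_neq0 x z : k_ (d x z) != 0.
Proof.
rewrite -(sphere_card x) /sphere_sum (bigD1 z) //= /level eqxx mulr1 lt0r_neq0 //.
by rewrite ltr_pwDl // sumr_ge0 // => w _; rewrite mulr_ge0.
Qed.

Lemma sphere_sum_empty_eig i : k_ i = 0 -> q i = 0.
Proof.
move=> ki0; rewrite /q sphere_sum_empty ?mul0r // => z; apply: contra_eqN ki0 => /eqP <-.
exact: sphere_neq0.
Qed.

Lemma radialK i : k_ i * u i = q i.
Proof.
have [ki0|ki] := eqVneq (k_ i) 0; last by rewrite /u mulrC divfK.
by rewrite ki0 mul0r sphere_sum_empty_eig.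
Qed.

Lemma edge_count i : k_ i * (b i)%:R = k_ i.+1 * (c i.+1)%:R.
Proof.
transitivity (\sum_z level i x0 z * \sum_(w | e z w) level i.+1 x0 w).
  rewrite /k_ /sphere_sum mulr_suml; apply: eq_bigr => z _; rewrite mulr1 /level.
  by case: eqP => [<-|]; rewrite ?mul0r // !mul1r -sum_up.
rewrite /k_ /sphere_sum mulr_suml; under eq_bigr do rewrite mulr_sumr big_mkcond.
rewrite exchange_big; apply: eq_bigr => w _; rewrite -big_mkcond mulr1 /level.
under eq_bigr do rewrite mulrC.
rewrite -mulr_sumr /=; case: eqP => [dw|]; rewrite ?mul0r // !mul1r -dw -sum_down.
by apply: eq_big => z; rewrite e_sym // dw eqSS.
Qed.

(** Multiplication by [k_ i] turns the claim into the recurrence for [q], because [edge_count]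
    exchanges the coefficients b and c between neighbouring spheres. *)
Lemma cosine_eig x : eig lam (cosine x).
Proof.
move=> z; set i := d x z; have ki : k_ i != 0 := sphere_neq0 x z.
suff sumE : \sum_(w | e z w) cosine x w = (k - lam) * cosine x z.
  have constE : \sum_(w | e z w) cosine x z = k * cosine x z.
    by rewrite -(sum_nbr_const z) mulr_suml; apply: eq_bigr => w _; rewrite mul1r.
  by rewrite /Defs.lap sumrB sumE constE; lra.
rewrite sum_radial -/i /cosine -/i; apply: (mulfI ki).
have := eig_rec i x0 f0_eig; rewrite !(sphere_sum_eig _ _ f0_eig) => rec.
pose m := if i is j.+1 then (b j)%:R * q j else 0.
have inflowE : inflow i f0 x0 = m * f0 x0.
  by rewrite /m /inflow; case: (i) => [|j]; rewrite ?mul0r // sphere_sum_eig // mulrA.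
have {}rec : (c i.+1)%:R * q i.+1 = (k - lam - a i) * q i - m.
  by apply: (mulIf f0x0); rewrite -mulrA rec inflowE; ring.
have up : k_ i * ((b i)%:R * u i.+1) = (c i.+1)%:R * q i.+1.
  by rewrite mulrA edge_count mulrAC radialK mulrC.
have down : k_ i * ((c i)%:R * u i.-1) = m.
  rewrite /m; case: (i) => [|j] /=; last by rewrite mulrA -edge_count mulrAC radialK mulrC.
  by rewrite (drg_c0 x) mulr0n mul0r mulr0.
by rewrite !mulrDr up down rec [k_ i * (a i * _)]mulrCA [k_ i * (_ * u i)]mulrCA radialK; lra.
Qed.

Lemma cosineC x z : cosine x z = cosine z x.
Proof. by rewrite /cosine dC. Qed.

Lemma cosinexx x : cosine x x = 1.
Proof.
rewrite /cosine dxx /u /q /k_ !sphere_sum0 divr1 divff //.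
Qed.

Let diam := (\max_(p : T * T) d p.1 p.2).+1.
Let v0 := \sum_(i < diam) u i * q i.

Lemma cosine_conv f x : eig lam f -> \sum_z cosine x z * f z = v0 * f x.
Proof.
move=> feig; rewrite mulr_suml.
under [RHS]eq_bigr => i _ do rewrite -mulrA -sphere_sum_eig // /sphere_sum mulr_sumr.
rewrite exchange_big; apply: eq_bigr => z _ /=.
have ltz : (d x z < diam)%N by rewrite ltnS (@leq_bigmax _ (fun p => d p.1 p.2) (x, z)).
rewrite (bigD1 (Ordinal ltz)) //= /level eqxx mul1r big1 ?addr0 // => i ni.
rewrite (_ : (d x z == i) = false) ?mul0r ?mulr0 //.
by apply: contra_neqF ni => /eqP dz; apply: val_inj; rewrite /= dz.
Qed.

Lemma conv_factor_gt0 : 0 < v0.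
Proof.
have <- : \sum_z cosine x0 z * cosine x0 z = v0.
  by rewrite (cosine_conv _ (cosine_eig x0)) cosinexx mulr1.
rewrite (bigD1 x0) //= cosinexx mulr1 ltr_pwDl // sumr_ge0 // => z _.
by rewrite -expr2 sqr_ge0.
Qed.

Definition cos_vec x y z := cosine x z - cosine y z.

Lemma cos_vec_dist x y z w : \sum_v (cos_vec x y v - cos_vec z w v) ^+ 2 =
  v0 * (cosine x x - cosine x y *+ 2 + cosine y y + cosine z z - cosine z w *+ 2 + cosine w w
        - (cosine x z - cosine x w - cosine y z + cosine y w) *+ 2).
Proof.
have conv p r : \sum_v cosine p v * cosine r v = v0 * cosine p r.
  by rewrite (cosine_conv _ (cosine_eig r)) cosineC.
transitivity (\sum_v (cosine x v * cosine x v - (cosine x v * cosine y v) *+ 2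
    + cosine y v * cosine y v + cosine z v * cosine z v - (cosine z v * cosine w v) *+ 2
    + cosine w v * cosine w v - (cosine x v * cosine z v - cosine x v * cosine w v
    - cosine y v * cosine z v + cosine y v * cosine w v) *+ 2)).
  by apply: eq_bigr => v _; rewrite /cos_vec; ring.
rewrite !(big_split, sumrN, sumrMnl) /= !conv.
by ring.
Qed.

Let delta := u 0%N - u 1%N.

Lemma radial0 : u 0%N = 1.
Proof. by have := cosinexx x0; rewrite /cosine dxx. Qed.

Lemma cosine_edge x y : e x y -> cosine x y = 1 - delta.
Proof. by move=> exy; rewrite /cosine dE // /delta radial0; lra. Qed.

Lemma delta_gt0 x y : e x y -> 0 < delta.
Proof.
move=> exy; have := eig_sum x (cosine_eig x); rewrite cosinexx mulr1.
rewrite (eq_bigr (fun=> 1 * (1 - delta))) => [|w /cosine_edge->]; last by rewrite mul1r.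
rewrite -mulr_suml sum_nbr_const => eq_k; have : k * delta = lam by lra.
have k_ge0 : 0 <= k by rewrite ler0n.
move=> kd; rewrite ltNge; apply/negP => le0; have := mulr_ge0_le0 k_ge0 le0.
by rewrite kd leNgt lam_gt0.
Qed.

(** Up to the factor [v0], all edge vectors have squared length 2 [delta]; this is Cauchy-Schwarz
    with its equality case, read off the squared distance of two of them. *)
Lemma cos_vec_edge x y z w : e x y -> e z w ->
  cosine x z - cosine x w - cosine y z + cosine y w <= delta *+ 2 /\
  (cosine x z - cosine x w - cosine y z + cosine y w = delta *+ 2 -> cos_vec x y =1 cos_vec z w).
Proof.
move=> exy ezw; have := cos_vec_dist x y z w.
rewrite (cosine_edge exy) (cosine_edge ezw) !cosinexx.
set s := cosine x z - _ - _ + _ => sumE; split.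
  rewrite -subr_ge0 -(pmulr_rge0 _ conv_factor_gt0) -(pmulr_rge0 _ (ltr0n _ 2)).
  have: 0 <= \sum_v (cos_vec x y v - cos_vec z w v) ^+ 2 by rewrite sumr_ge0 // => v _; exact: sqr_ge0.
  by rewrite sumE; congr (_ <= _); ring.
move=> sE; move/eqP: sumE; rewrite sE (_ : v0 * _ = 0); last by ring.
rewrite psumr_eq0 => [/allP H v|v _]; last exact: sqr_ge0.
by have := H v (mem_index_enum v); rewrite sqrf_eq0 subr_eq0 => /eqP.
Qed.

Hypothesis lam_Kmin : lam = Kmin e R.

(** Let f be the inner product with the vector y - x, scaled to rise by 1 along xy. It is an
    eigenfunction, so its difference of Laplacians is [lam], which equals [Kmin]; thus f is optimal,
    and its tight edges represent the same vector as xy. *)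
Lemma cos_partner x y x' : e x y -> e x x' -> d x' y = 2 ->
  exists w, [/\ e x' w, e y w & cos_vec x y =1 cos_vec x' w].
Proof.
move=> exy exx' dx'y; have delta0 := delta_gt0 exy.
have eyx : e y x by rewrite e_sym.
pose f v := (cosine y v - cosine x v) / (delta *+ 2).
have d2_gt0 : 0 < delta *+ 2 by rewrite pmulrn_rgt0.
have d2_neq0 := lt0r_neq0 d2_gt0.
have fB v w : f w - f v =
    (cosine x v - cosine x w - cosine y v + cosine y w) / (delta *+ 2).
  by rewrite /f -mulrBl; congr (_ / _); lra.
have fL : lipschitz e f.
  move=> v w evw; rewrite fB ler_pdivrMr // mul1r.
  by case: (cos_vec_edge exy evw).
have fxy : f y - f x = 1.
  by rewrite fB !cosinexx (cosine_edge exy) (cosine_edge eyx) -(divff d2_neq0); congr (_ / _); lra.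
have fP : potential x y f by apply/potentialP.
have lap_f v : lap f v = - lam * f v.
  transitivity ((lap (cosine y) v - lap (cosine x) v) / (delta *+ 2)).
    rewrite /Defs.lap -sumrB mulr_suml; apply: eq_bigr => w _.
    by rewrite /f -mulrBl; congr (_ / _); ring.
  have := cosine_eig x v; have := cosine_eig y v; rewrite /f => /(canRL opprK) -> /(canRL opprK) ->.
  by ring.
have f_min g : potential x y g -> lap f x - lap f y <= lap g x - lap g y.
  move=> /(Kmin_le_potential e_sym e_irr e_conn exy); apply: le_trans.
  have -> : lap f x - lap f y = lam * (f y - f x) by rewrite !lap_f; ring.
  by rewrite fxy mulr1 lam_Kmin.
have tightP v w : tight e f v w -> cos_vec x y =1 cos_vec v w.
  case/andP=> evw /eqP; rewrite fB => /(congr1 ( *%R^~ (delta *+ 2))).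
  by rewrite mulfVK // mul1r; case: (cos_vec_edge exy evw) => _; apply.
(* Consecutive edges with equal vectors would give -[delta] = [delta] at their common vertex; hence
   tight paths from x' have at most one edge. *)
have no_two p v w : e p v -> e v w -> cos_vec p v =1 cos_vec v w -> False.
  move=> epv evw /(_ v); rewrite /cos_vec cosinexx (cosineC w) !cosine_edge //.
  by move: delta0; lra.
have tight_path p w : path (tight e f) x' p -> w = last x' p -> w = x' \/ tight e f x' w.
  case: p => [|v [|w' p]] /=; first by left.
    by rewrite andbT => t ->; right.
  case/and3P=> t1 t2 _ _; case: (@no_two x' v w'); [by case/andP: t1|by case/andP: t2|].
  by move=> z; rewrite -(tightP _ _ t1) (tightP _ _ t2).
have ne_x : x' <> x by move=> eq_x; move: exx'; rewrite eq_x e_irr.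
have ne_y : x' <> y by move=> eq_y; move: dx'y; rewrite eq_y dxx.
have nex'y : ~~ e x' y by apply: contra_eqN dx'y => /dE ->.
have [||w /connectP[p pP lw] eyw] := tight_exists e_sym exy fP f_min exx'.
- apply/negP => /connectP[p pP lx]; case: (tight_path p x pP lx) => [/esym//|/tightP t].
  by apply: (@no_two x' x y); rewrite 1?e_sym // => z; rewrite t.
- apply/negP => /connectP[p pP ly]; case: (tight_path p y pP ly) => [/esym//|/andP[]].
  by rewrite (negPf nex'y).
case: (tight_path p w pP lw) => [eq_w|t]; last first.
  by exists w; split=> //; [case/andP: t|apply: tightP].
by move: nex'y; rewrite -eq_w e_sym eyw.
Qed.

(** Let p, x1, x2 descend towards x from distance i + 2. The edge x1 x2 moved to p ends at some w at
    distance i + 1, and comparing the two vectors at x makes consecutive differences of [u]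
    equal. *)
Lemma u_linear i x p : d x p = i -> u i = 1 - i%:R * delta.
Proof.
have [n le_n] := ubnP i; elim: n i x p le_n => // n IHn [|[|i]] x p lt_n dxp.
- by rewrite radial0 mul0r subr0.
- by rewrite /delta radial0; lra.
have [|x1 [e1 d1]] := @dist_pred _ _ e_conn x p; first by rewrite dxp.
have [|x2 [e2 d2]] := @dist_pred _ _ e_conn x x1; first by lia.
have d02 : d p x2 = 2.
  have := common_dist e_sym e_irr e_conn e1 (etrans (e_sym x1 x2) e2).
  case dp2: (d p x2) => [|[|[|m]]] //.
    by have := dist0P e_conn dp2 => eq_p; move: d1 d2; rewrite eq_p; lia.
  by have := dist_stepC e_sym e_conn x (dist1P e_conn dp2); lia.
have e12 : e x1 x2 by rewrite e_sym.
have [w [epw e2w /(_ x)]] := cos_partner e12 e1 d02.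
have dxw : d x w = i.+1.
  by have := dist_stepC e_sym e_conn x epw; have := dist_step e_conn x e2w; lia.
rewrite /cos_vec /cosine !(dC _ x) dxw dxp.
have -> : d x x1 = i.+1 by lia.
have dx2 : d x x2 = i by lia.
rewrite dx2 (IHn i x x2 _ dx2) ?(IHn i.+1 x w _ dxw) ?ltnS; try lia.
by rewrite -[in RHS]natr1 -natr1; lra.
Qed.

Lemma drg_completable : completable e.
Proof.
move=> y z y' eyz eyy' dy'z; have [w [_ _ cos_w]] := cos_partner eyz eyy' dy'z.
exists w; apply/parP => v; have := cos_w v; rewrite /cos_vec /cosine.
rewrite !(dC _ v) !(@u_linear _ v _ erefl) => cosE.
apply/eqP; rewrite -(eqr_nat R) !natrD; apply/eqP.
by apply: (mulIf (lt0r_neq0 (delta_gt0 eyz))); lra.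
Qed.

End DistanceRegular.

Lemma Lichnerowicz_sharp_completable (R : realType) (T : finType) (e : rel T) :
  symmetric e -> irreflexive e -> connected_graph e ->
  distance_regular e -> Lichnerowicz_sharp e R -> completable e.
Proof.
move=> e_sym e_irr e_conn [b [c dr]] [K_gt0 [f [[x fx] f_eig]] _].
exact: (drg_completable e_sym e_irr e_conn dr K_gt0 f_eig fx).
Qed.

(** * Johnson graphs, halved cubes and cocktail party graphs *)

Record reflective_graph (T : finType) (e : rel T) : Prop := ReflectiveGraph {
  rg_sym : symmetric e;
  rg_irr : irreflexive e;
  rg_conn : connected_graph e;
  rg_compl : completable e }.

Definition giso (T U : finType) (e : rel T) (r : rel U) : Prop :=
  exists f g, [/\ cancel f g, cancel g f & forall x y : T, r (f x) (f y) = e x y].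

Lemma giso_sym (T U : finType) (e : rel T) (r : rel U) : giso e r -> giso r e.
Proof. by case=> f [g [fK gK fe]]; exists g, f; split=> // x y; rewrite -fe !gK. Qed.

Lemma giso_trans (T U V : finType) (e : rel T) (r : rel U) (s : rel V) :
  giso e r -> giso r s -> giso e s.
Proof.
move=> [f [g [fK gK fe]]] [f' [g' [fK' gK' fe']]]; exists (f' \o f), (g \o g').
by split=> [x|x|x y] /=; rewrite ?fK' ?gK ?fe' // fK.
Qed.

Lemma giso_connected (T U : finType) (e : rel T) (r : rel U) :
  giso e r -> connected_graph e -> connected_graph r.
Proof.
move=> [f [g [fK gK fe]]] e_conn x y; have /connectP[p pP lp] := e_conn (g x) (g y).
apply/connectP; exists (map f p); last by rewrite -[x]gK last_map -lp gK.
by rewrite -[x]gK path_map; under eq_path do rewrite /= fe.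
Qed.

Lemma giso_dist (T U : finType) (e : rel T) (r : rel U) (f : T -> U) g :
  connected_graph e -> cancel f g -> cancel g f -> (forall x y, r (f x) (f y) = e x y) ->
  forall x y, dist r (f x) (f y) = dist e x y.
Proof.
move=> e_conn fK gK fe; have r_conn : connected_graph r.
  by apply: giso_connected e_conn; exists f, g.
exact: iso_dist fK gK fe.
Qed.

Lemma giso_reflective (T U : finType) (e : rel T) (r : rel U) :
  giso e r -> reflective_graph e -> reflective_graph r.
Proof.
move=> er [e_sym e_irr e_conn compl]; have r_conn := giso_connected er e_conn.
have [g [f [gK fK ge]]] := giso_sym er.
split=> [x y|x||y z y' ryz ryy' dyz] //; first by rewrite -!ge e_sym.
  by rewrite -ge.
have gd := giso_dist r_conn gK fK ge.
have [||| z' /forallP pz] := compl (g y) (g z) (g y'); rewrite ?ge ?gd //.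
exists (f z'); apply/forallP => v; have := pz (g v).
by rewrite -{1}[z']fK !gd.
Qed.

Lemma metric_connected (T : finType) (e : rel T) (g : T -> T -> nat) :
  (forall v y, 0 < g v y -> exists z, e z y /\ g v z < g v y) ->
  (forall x y, g x y = 0 -> x = y) -> connected_graph e.
Proof.
move=> g_pred g0 x y; have [n le_n] := ubnP (g x y); elim: n y le_n => // n IHn y lt_n.
have [/g0->|/g_pred[z [ezy lt_z]]] := posnP (g x y); first exact: connect0.
by apply: connect_trans (IHn z _) (connect1 ezy); apply: leq_trans lt_z _.
Qed.

Section Johnson.
Variables (U : finType) (k : nat).
(** The ground set is an arbitrary finite type, because disjoint unions of index sets arise in the
    classification. *)
Definition jvert := {A : {set U} | #|A| == k}.
Definition jset (A : jvert) : {set U} := val A.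
Definition jrel : rel jvert := fun A B => #|jset A :&: jset B| + 1 == k.

Lemma jsetK (S : {set U}) (cS : #|S| == k) : jset (Sub S cS) = S.
Proof. exact: SubK. Qed.

Lemma jset_inj : injective jset.
Proof. exact: val_inj. Qed.

(** The change of the intersection with V depends on a and b alone: edges of a Johnson graph making
    the same exchange are parallel. *)
Lemma cardI_swap (V A : {set U}) a b : a \in A -> b \notin A ->
  #|V :&: (b |: A :\ a)| + (a \in V) = #|V :&: A| + (b \in V).
Proof.
move=> Aa nAb; have -> : #|V :&: A| = (a \in V) + #|V :&: (A :\ a)|.
  by rewrite (cardsD1 a) inE Aa andbT -finset.setIDA.
have -> : #|V :&: (b |: A :\ a)| = (b \in V) + #|V :&: (A :\ a)|.
  rewrite (cardsD1 b) !inE eqxx andbT; congr (_ + _); apply: eq_card => i; rewrite !inE.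
  by case: eqVneq => //= ->; rewrite (negPf nAb) !andbF.
by lia.
Qed.

Lemma card_swap (A : {set U}) a b : a \in A -> b \notin A -> #|b |: A :\ a| = #|A|.
Proof. by move=> Aa nAb; have := cardI_swap (finset.setT) Aa nAb; rewrite !finset.setTI !inE; lia. Qed.

Lemma jswap_proof (A : jvert) a b : a \in jset A -> b \notin jset A -> #|b |: jset A :\ a| == k.
Proof. by move=> Aa nAb; rewrite card_swap // (valP A). Qed.

Lemma jvert_card (A : jvert) : #|jset A| = k.
Proof. exact/eqP/(valP A). Qed.

Lemma cardI_le (A B : jvert) : #|jset A :&: jset B| <= k.
Proof. by apply: leq_trans (eq_leq (jvert_card A)); rewrite subset_leq_card // subsetIl. Qed.

Lemma jinter_eq (A B : jvert) : k <= #|jset A :&: jset B| -> A = B.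
Proof.
move=> le_k; have AI : jset A = jset A :&: jset B.
  by apply/esym/eqP; rewrite eqEcard subsetIl jvert_card.
have BI : jset B = jset A :&: jset B.
  by apply/esym/eqP; rewrite eqEcard subsetIr jvert_card.
by apply: jset_inj; rewrite AI -BI.
Qed.

Lemma jdiff (A B : jvert) : #|jset A :&: jset B| < k ->
  exists a b, [/\ a \in jset A, a \notin jset B, b \in jset B & b \notin jset A].
Proof.
move=> lt_k; have [a] : exists a, a \in jset A :\: jset B.
  by apply/card_gt0P; rewrite -(ltn_add2l #|jset A :&: jset B|) cardsID jvert_card addn0.
have [b] : exists b, b \in jset B :\: jset A.
  by apply/card_gt0P; rewrite -(ltn_add2l #|jset B :&: jset A|) cardsID jvert_card finset.setIC addn0.
by rewrite !inE => /andP[? ?] /andP[? ?]; exists a, b.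
Qed.

Lemma jrelP (A B : jvert) : jrel A B ->
  exists a b, [/\ a \in jset A, b \notin jset A & jset B = b |: jset A :\ a].
Proof.
move=> /eqP eAB; have [|a [b [Aa nBa Bb nAb]]] := @jdiff A B; first by lia.
exists a, b; split=> //; have cAb := jswap_proof Aa nAb.
suff -> : B = Sub (b |: jset A :\ a) cAb by rewrite jsetK.
apply: jinter_eq; rewrite jsetK; have := cardI_swap (jset B) Aa nAb.
by rewrite (negPf nBa) Bb (finset.setIC _ (jset A)); lia.
Qed.

Lemma jrel_swap (A : jvert) a b (Aa : a \in jset A) (nAb : b \notin jset A) :
  jrel A (Sub (b |: jset A :\ a) (jswap_proof Aa nAb)).
Proof.
rewrite /jrel jsetK; have := cardI_swap (jset A) Aa nAb.
by rewrite Aa (negPf nAb) finset.setIid jvert_card; lia.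
Qed.

Let g (A B : jvert) := k - #|jset A :&: jset B|.

Lemma jrel_sym : symmetric jrel.
Proof. by move=> A B; rewrite /jrel finset.setIC. Qed.

Lemma jrel_step v x y : jrel x y -> g v y <= (g v x).+1.
Proof.
case/jrelP => a [b [xa nxb yE]]; have := cardI_swap (jset v) xa nxb.
by rewrite -yE /g; lia.
Qed.

Lemma jrel_pred v y : 0 < g v y -> exists z, jrel z y /\ g v z < g v y.
Proof.
rewrite subn_gt0 => lt_k; have [a [b [va nya yb nvb]]] := jdiff lt_k.
exists (Sub (a |: jset y :\ b) (jswap_proof yb nya)); rewrite jrel_sym jrel_swap; split=> //.
by rewrite /g jsetK; have := cardI_swap (jset v) yb nya; rewrite va (negPf nvb); lia.
Qed.

Lemma jrel_conn : connected_graph jrel.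
Proof.
apply: (@metric_connected _ _ g jrel_pred) => A B /eqP; rewrite subn_eq0; exact: jinter_eq.
Qed.

Lemma jrel_dist A B : dist jrel A B = k - #|jset A :&: jset B|.
Proof.
move: A B; apply: (dist_uniq jrel_conn (g := g)) => [x|||].
- by rewrite /g finset.setIid jvert_card subnn.
- exact: jrel_step.
- exact: jrel_pred.
- by move=> A B /eqP; rewrite subn_eq0; exact: jinter_eq.
Qed.

Lemma johnson_reflective : reflective_graph jrel.
Proof.
split; [exact: jrel_sym| |exact: jrel_conn|].
  by move=> A; rewrite /jrel finset.setIid jvert_card; lia.
move=> y z y' ryz; have := ryz; rewrite /jrel => /eqP Iyz.
case/jrelP: ryz => a [b [ya nyb zE]] /jrelP[c [d [yc nyd y'E]]].
rewrite jrel_dist => Iy'z; have := cardI_swap (jset z) yc nyd.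
rewrite -y'E (finset.setIC (jset z) (jset y')) (finset.setIC (jset z) (jset y)) => swap.
(* Distance 2 means that z and y' drop different elements of y and add different ones, so the
   exchange of a for b is still possible at y'. *)
have zc : c \in jset z by lia.
have nzd : d \notin jset z by apply/negP => zd; lia.
have y'a : a \in jset y'.
  rewrite y'E !inE ya andbT orbC; case: eqVneq => //= ac.
  by move: zc; rewrite zE -ac !inE eqxx /= orbF => /eqP ab; rewrite -ab ya in nyb.
have ny'b : b \notin jset y'.
  rewrite y'E !inE (negPf nyb) andbF orbF; apply: contra nzd => /eqP <-.
  by rewrite zE !inE eqxx.
exists (Sub (b |: jset y' :\ a) (jswap_proof y'a ny'b)); apply/forallP => v; rewrite !jrel_dist jsetK.
have := cardI_swap (jset v) ya nyb; have := cardI_swap (jset v) y'a ny'b; rewrite -zE.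
have := cardI_le v y; have := cardI_le v z; have := cardI_le v y'.
have := cardI_le v (Sub (b |: jset y' :\ a) (jswap_proof y'a ny'b)); rewrite jsetK.
by clear; lia.
Qed.

End Johnson.

Section Halved.
Variable U : finType.
Definition hvert := {A : {set U} | ~~ odd #|A|}.
Definition sdiff (A B : {set U}) : {set U} := [set i | (i \in A) != (i \in B)].
Definition hset (A : hvert) : {set U} := val A.
Definition hrel : rel hvert := fun A B => #|sdiff (hset A) (hset B)| == 2.

Lemma hsetK (S : {set U}) (cS : ~~ odd #|S|) : hset (Sub S cS) = S.
Proof. exact: SubK. Qed.

Lemma hset_inj : injective hset.
Proof. exact: val_inj. Qed.

Lemma hset_even (A : hvert) : ~~ odd #|hset A|.
Proof. exact: (valP A). Qed.

Lemma sdiffC A B : sdiff A B = sdiff B A.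
Proof. by apply/setP => i; rewrite !inE eq_sym. Qed.

Lemma sdiff_eq0 A B : #|sdiff A B| = 0 -> A = B.
Proof.
move/eqP; rewrite cards_eq0 => /eqP/setP AB; apply/setP => i.
by have := AB i; rewrite !inE => /negbFE/eqP.
Qed.

Lemma card_sdiff A B : #|sdiff A B| + #|A :&: B|.*2 = #|A| + #|B|.
Proof.
rewrite -addnn -!sum1_card !(big_mkcond (fun i => i \in _)) -!big_split /=.
by apply: eq_bigr => i _; rewrite !inE; case: (i \in A); case: (i \in B).
Qed.

Lemma card_sdiff2 V A a b : a != b ->
  #|sdiff V (sdiff A [set a; b])| + (((a \in V) != (a \in A)) + ((b \in V) != (b \in A))).*2
  = #|sdiff V A| + 2.
Proof.
move=> nab; have nba : b == a = false by rewrite eq_sym (negPf nab).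
have dec (X : {set U}) : #|X| = (a \in X) + ((b \in X) + #|X :\ a :\ b|).
  by rewrite (cardsD1 a) (cardsD1 b) !inE nba.
rewrite (dec (sdiff V A)) (dec (sdiff V _)) !inE !eqxx nba orbT /=.
set S := sdiff V _ :\ a :\ b; set S' := sdiff V A :\ a :\ b.
have -> : S = S'.
  by apply/setP => i; rewrite !inE; case: (i == b); case: (i == a); case: (i \in A).
by case: (a \in V); case: (b \in V); case: (a \in A); case: (b \in A) => /=; lia.
Qed.

Lemma hflip_proof (A : hvert) a b : a != b -> ~~ odd #|sdiff (hset A) [set a; b]|.
Proof.
move=> nab; have := card_sdiff (hset A) [set a; b]; rewrite cards2 nab; have := hset_even A; lia.
Qed.

Lemma sdiff_even (A B : hvert) : ~~ odd #|sdiff (hset A) (hset B)|.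
Proof. have := card_sdiff (hset A) (hset B); have := hset_even A; have := hset_even B; lia. Qed.

Lemma sdiff_pair (A B : {set U}) : 1 < #|sdiff A B| ->
  exists a b, [/\ a != b, (a \in A) != (a \in B) & (b \in A) != (b \in B)].
Proof. by case/card_gt1P => a [b []]; rewrite !inE => ? ? ?; exists a, b. Qed.

Lemma hrelP (A B : hvert) : hrel A B -> exists a b, a != b /\ hset B = sdiff (hset A) [set a; b].
Proof.
move=> /eqP AB2; have [|a [b [nab Aa Ab]]] := @sdiff_pair (hset A) (hset B); first by rewrite AB2.
exists a, b; split=> //; apply: sdiff_eq0; have := card_sdiff2 (hset B) (hset A) nab.
by rewrite (sdiffC (hset B) (hset A)) AB2 !(eq_sym (_ \in hset B)) Aa Ab; lia.
Qed.

Lemma hrel_sym : symmetric hrel.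
Proof. by move=> A B; rewrite /hrel sdiffC. Qed.

Lemma sdiffxx A : #|sdiff A A| = 0.
Proof. by apply: eq_card0 => i; rewrite !inE eqxx. Qed.

Lemma hrel_flip (A : hvert) a b (nab : a != b) :
  hrel A (Sub (sdiff (hset A) [set a; b]) (hflip_proof A nab)).
Proof.
by rewrite /hrel hsetK; have := card_sdiff2 (hset A) (hset A) nab; rewrite !eqxx sdiffxx /=; lia.
Qed.

Let g (A B : hvert) := #|sdiff (hset A) (hset B)|./2.

Lemma hrel_step v x y : hrel x y -> g v y <= (g v x).+1.
Proof.
case/hrelP => a [b [nab yE]]; have := card_sdiff2 (hset v) (hset x) nab.
by rewrite -yE /g; lia.
Qed.

Lemma hrel_pred v y : 0 < g v y -> exists z, hrel z y /\ g v z < g v y.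
Proof.
move=> lt0; have [|a [b [nab va vb]]] := @sdiff_pair (hset v) (hset y); first by move: lt0; rewrite /g; lia.
exists (Sub (sdiff (hset y) [set a; b]) (hflip_proof y nab)); rewrite hrel_sym hrel_flip; split=> //.
by move: lt0; rewrite /g hsetK; have := card_sdiff2 (hset v) (hset y) nab; rewrite va vb; lia.
Qed.

Lemma hdist0 A B : g A B = 0 -> A = B.
Proof. by rewrite /g => gAB; apply: hset_inj; apply: sdiff_eq0; have := sdiff_even A B; lia. Qed.

Lemma hrel_conn : connected_graph hrel.
Proof. exact: (@metric_connected _ _ g hrel_pred hdist0). Qed.

Lemma hrel_dist A B : dist hrel A B = #|sdiff (hset A) (hset B)|./2.
Proof.
move: A B; apply: (dist_uniq hrel_conn (g := g) _ hrel_step hrel_pred hdist0) => x.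
by rewrite /g sdiffxx.
Qed.

Lemma halved_reflective : reflective_graph hrel.
Proof.
split; [exact: hrel_sym| |exact: hrel_conn|]; first by move=> A; rewrite /hrel sdiffxx.
move=> y z y' ryz; have := ryz; case/hrelP: ryz => a [b [nab zE]] /eqP dyz.
move=> ryy'; have := ryy'; case/hrelP: ryy' => c [d [ncd y'E]] /eqP dyy'.
rewrite hrel_dist => dy'z; have := card_sdiff2 (hset y') (hset y) nab.
rewrite -zE (sdiffC _ (hset y)) dyy' => flip.
have even_d := sdiff_even y' z.
(* Distance 2 forces y and y' to agree at a and b, so flipping the pair is the same vector at
   both. *)
have [/eqP y'a /eqP y'b] : (a \in hset y') == (a \in hset y) /\ (b \in hset y') == (b \in hset y).
  by split; apply/negP; lia.
exists (Sub (sdiff (hset y') [set a; b]) (hflip_proof y' nab)); apply/forallP => v.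
have := card_sdiff2 (hset v) (hset y) nab; have := card_sdiff2 (hset v) (hset y') nab.
rewrite y'a y'b -zE !hrel_dist hsetK.
have := sdiff_even v y; have := sdiff_even v z; have := sdiff_even v y'.
have := sdiff_even v (Sub (sdiff (hset y') [set a; b]) (hflip_proof y' nab)); rewrite hsetK.
by move: #|_| #|_| #|_| #|_| (nat_of_bool _) (nat_of_bool _) => *; lia.
Qed.

End Halved.

Section Cocktail.
Variable I : finType.
Definition crel : rel (I * bool) := fun p q => p.1 != q.1.

Let g (p q : I * bool) := if p.1 != q.1 then 1 else if p == q then 0 else 2.

Lemma cocktail_reflective : 1 < #|I| -> reflective_graph crel.
Proof.
move=> I2; have g_pred v y : 0 < g v y -> exists z, crel z y /\ g v z < g v y.
  rewrite /g; case: (eqVneq v.1 y.1) => [eq_vy|n_vy _] /=; last first.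
    by exists v; rewrite /crel n_vy !eqxx.
  case: (v == y) => // _; have /card_gt0P[i] : 0 < #|[set~ y.1]| by rewrite cardsC1; lia.
  rewrite !inE => niy; exists (i, true); split; first exact: niy.
  by rewrite /= eq_vy eq_sym niy.
have g0 x y : g x y = 0 -> x = y by rewrite /g; case: eqVneq => //= _; case: eqP.
have conn := metric_connected g_pred g0.
have dE : forall p q, dist crel p q = g p q.
  apply: (dist_uniq conn _ _ g_pred g0) => [x|v x y exy]; first by rewrite /g !eqxx.
  rewrite /g; case: (eqVneq v x) => [->|_]; first by move: exy; rewrite /crel => ->.
  by case: (v.1 != x.1); case: (v.1 != y.1); case: (v == y).
split=> [p q|p||y z y' yz yy'] //; rewrite /crel ?eqxx 1?eq_sym //.
rewrite dE /g; case: eqVneq => // y'z; case: eqP => // ny'z _.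
(* The vertices y' and z are antipodal, and the fourth corner is the antipode of y: distances to two
   antipodes always sum to 2. *)
exists (y.1, ~~ y.2); apply/forallP => v; rewrite !dE /g /=.
case: v y z y' yz yy' y'z ny'z => [v1 v2] [y1 y2] [z1 z2] [y'1 y'2] /=; rewrite /crel /=.
move=> yz yy' y'z; rewrite y'z !xpair_eqE => ny'z.
have {}ny'z : y'2 = ~~ z2 by case: y'2 z2 ny'z yy' => [] [] //; rewrite y'z.
have pairE (i : I) c : (if v1 != i then 1 else if (v1 == i) && (v2 == c) then 0 else 2)
    + (if v1 != i then 1 else if (v1 == i) && (v2 == ~~ c) then 0 else 2) = 2.
  by case: (v1 == i) => //=; case: v2 c => [] [].
by rewrite {}ny'z !pairE.
Qed.

End Cocktail.

(** * The Gosset graph *)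

Section Gosset.

Definition gvert := {p : {set 'I_8} * bool | #|p.1| == 2}.
Definition gset (p : gvert) : {set 'I_8} := (val p).1.
Definition gsgn (p : gvert) : bool := (val p).2.
(** With m common positions the inner product of the vectors is 16 m - 8 for equal signs and 8 - 16
    m for opposite ones; it is 8 exactly here. *)
Definition grel : rel gvert := fun p q =>
  if gsgn p == gsgn q then #|gset p :&: gset q| == 1 else #|gset p :&: gset q| == 0.

Lemma gset_card p : #|gset p| = 2.
Proof. exact/eqP/(valP p). Qed.

Lemma gvert_inj p q : gset p = gset q -> gsgn p = gsgn q -> p = q.
Proof.
rewrite /gset /gsgn => eq1 eq2; apply: val_inj.
by rewrite (surjective_pairing (val p)) eq1 eq2 -surjective_pairing.
Qed.

Lemma gvert_make (A : {set 'I_8}) s : #|A| = 2 -> exists p, gset p = A /\ gsgn p = s.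
Proof. by move/eqP=> cA; exists (Sub (A, s) cA); rewrite /gset /gsgn SubK. Qed.

Lemma cardI2 (T : finType) (V : {set T}) a b :
  a != b -> #|V :&: [set a; b]| = (a \in V) + (b \in V).
Proof.
move=> nab; rewrite (cardsD1 a) (cardsD1 b) !inE !eqxx !andbT orbT andbT.
rewrite [b == a]eq_sym nab /=.
rewrite [#|_|](_ : _ = 0) ?addn0 // -[RHS](@cards0 T); apply: eq_card => i; rewrite !inE.
by case: (i == b); case: (i == a); rewrite ?andbF.
Qed.

Lemma card2P (T : finType) (A : {set T}) a :
  #|A| = 2 -> a \in A -> exists2 b, a != b & A = [set a; b].
Proof.
move=> cA Aa; have /cards1P[b bE] : #|A :\ a| == 1 by have := cardsD1 a A; rewrite cA Aa; lia.
have : b \in A :\ a by rewrite bE inE.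
rewrite !inE => /andP[nba Ab]; exists b; first by rewrite eq_sym.
by rewrite -(finset.setD1K Aa) bE.
Qed.

Lemma gvert_pair p : exists a b, a != b /\ gset p = [set a; b].
Proof. by have /eqP/cards2P[a [b [nab ->]]] := gset_card p; exists a, b. Qed.

Lemma fresh8 (S : {set 'I_8}) : #|S| < 8 -> exists x, x \notin S.
Proof.
move=> S8; have /card_gt0P[x] : 0 < #|~: S| by have := cardsC S; rewrite card_ord; lia.
by rewrite inE; exists x.
Qed.

Let g (p q : gvert) :=
  if gsgn p == gsgn q then 2 - #|gset p :&: gset q| else #|gset p :&: gset q|.+1.

Lemma gcardI_le p q : #|gset p :&: gset q| <= 2.
Proof. by apply: leq_trans (eq_leq (gset_card p)); rewrite subset_leq_card // subsetIl. Qed.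

Lemma gcardI_eq p q : 1 < #|gset p :&: gset q| -> gset p = gset q.
Proof.
move=> c2; have pI : gset p = gset p :&: gset q.
  by apply/esym/eqP; rewrite eqEcard subsetIl gset_card.
have qI : gset q = gset p :&: gset q.
  by apply/esym/eqP; rewrite eqEcard subsetIr gset_card.
by rewrite pI -qI.
Qed.

Lemma grel_sym : symmetric grel.
Proof. by move=> p q; rewrite /grel eq_sym finset.setIC. Qed.

Lemma grel_irr : irreflexive grel.
Proof. by move=> p; rewrite /grel eqxx finset.setIid gset_card. Qed.

Lemma gdist0 p q : g p q = 0 -> p = q.
Proof.
rewrite /g; case: eqP => // eq_s I0; apply: gvert_inj => //; apply: gcardI_eq; lia.
Qed.

Lemma gdistxx p : g p p = 0.
Proof. by rewrite /g eqxx finset.setIid gset_card. Qed.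

Lemma cardI_disjoint (T : finType) (V A B : {set T}) :
  #|A :&: B| = 0 -> #|V :&: A| + #|V :&: B| <= #|V|.
Proof.
move=> AB0; rewrite -cardsUI -[X in _ + X](_ : 0 = _) ?addn0.
  by rewrite -finset.setIUr subset_leq_card // subsetIl.
apply/esym/eqP; rewrite -leqn0 -AB0 subset_leq_card //; apply/fintype.subsetP => i; rewrite !inE.
by case/andP=> /andP[_ ->] /andP[_ ->].
Qed.

Lemma cardI_diff (T : finType) (V A B : {set T}) :
  #|V :&: A| <= #|V :&: B| + (#|A| - #|A :&: B|).
Proof.
rewrite -(cardsID B (V :&: A)) leq_add //.
  by rewrite subset_leq_card //; apply/fintype.subsetP => i; rewrite !inE => /andP[/andP[-> _] ->].
rewrite -(cardsID B A) addKn subset_leq_card //; apply/fintype.subsetP => i.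
by rewrite !inE => /andP[-> /andP[_ ->]].
Qed.

Lemma grel_step v x y : grel x y -> g v y <= (g v x).+1.
Proof.
rewrite /grel /g; case: (eqVneq (gsgn x) (gsgn y)) => [eq_s|ne_s] /eqP Ixy.
  have := cardI_diff (gset v) (gset x) (gset y); have := cardI_diff (gset v) (gset y) (gset x).
  rewrite (finset.setIC (gset y)) Ixy !gset_card eq_s.
  have := gcardI_le v x; have := gcardI_le v y.
  by case: ifP => _; move: #|_| #|_| => m n; lia.
have := cardI_disjoint (gset v) Ixy; rewrite gset_card.
have [->|nvx] := eqVneq (gsgn v) (gsgn x); first by rewrite (negPf ne_s); lia.
have -> : gsgn v = gsgn y by case: (gsgn v) (gsgn x) (gsgn y) nvx ne_s => [] [] [].
by rewrite eqxx; lia.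
Qed.

Lemma grel_pred v y : 0 < g v y -> exists z, grel z y /\ g v z < g v y.
Proof.
move=> g_gt0; have [gvy|g_gt1] : g v y = 1 \/ 1 < g v y by lia.
  exists v; rewrite gvy gdistxx; split=> //; move: gvy; rewrite /g /grel.
  have := gcardI_le v y; case: ifP; lia.
have [a [b [nab vE]]] := gvert_pair v; have [c [c' [ncc' yE]]] := gvert_pair y.
case: (eqVneq (gsgn v) (gsgn y)) g_gt1 => [eq_s|ne_s] g_gt1.
  move: g_gt1; rewrite /g eq_s eqxx yE cardI2 // vE !inE => vy.
  have [nca nc'a] : c != a /\ c' != a by split; apply/eqP => eq_a; move: vy; rewrite eq_a eqxx; lia.
  have [ncb nc'b] : c != b /\ c' != b by split; apply/eqP => eq_a; move: vy; rewrite eq_a eqxx orbT; lia.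
  have [|z [zE zs]] := @gvert_make [set a; c] (gsgn y); first by rewrite cards2 eq_sym nca.
  have nac : a != c by rewrite eq_sym.
  exists z; split.
    by rewrite /grel zs eqxx zE yE cardI2 // !inE eqxx orbT (negPf nc'a) [c' == c]eq_sym (negPf ncc').
  rewrite zs eqxx zE !cardI2 // !inE eqxx.
  by rewrite (negPf nca) (negPf ncb) (negPf nc'a) (negPf nc'b).
have gE : g v y = #|gset v :&: gset y|.+1 by rewrite /g (negPf ne_s).
rewrite gE ltnS in g_gt1; have [d] : exists d, d \in gset v :&: gset y by apply/card_gt0P.
rewrite inE => /andP[vd yd].
have [d' ndd' vE'] := card2P (gset_card v) vd; have [d'' ndd'' yE'] := card2P (gset_card y) yd.
have [|x] := @fresh8 (gset v :|: gset y).
  by have := cardsUI (gset v) (gset y); rewrite !gset_card; clear; lia.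
rewrite !inE negb_or => /andP[nvx nyx].
have [|z [zE zs]] := @gvert_make [set d''; x] (gsgn y).
  by rewrite cards2; case: eqP => // eq_x; move: nyx; rewrite yE' -eq_x !inE eqxx orbT.
have nd''x : d'' != x by apply: contraNneq nyx => <-; rewrite yE' !inE eqxx orbT.
exists z; rewrite /grel gE /g zs eqxx (negPf ne_s) zE finset.setIC !cardI2 // (negPf nyx) (negPf nvx).
split; first by rewrite yE' !inE eqxx orbT.
rewrite yE' cardI2 // vd; case: (d'' \in gset v) => //.
Qed.

Lemma grel_conn : connected_graph grel.
Proof. exact: metric_connected grel_pred gdist0. Qed.

Lemma grel_dist p q : dist grel p q =
  if gsgn p == gsgn q then 2 - #|gset p :&: gset q| else #|gset p :&: gset q|.+1.
Proof. by move: p q; apply: (dist_uniq grel_conn gdistxx grel_step grel_pred gdist0). Qed.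

(** In each case z' is the vector y' + z - y. If both edges change the sign, the pairs of y, z and
    y' are disjoint and z' is the remaining pair of the eight positions. *)
Lemma gosset_reflective : reflective_graph grel.
Proof.
split; [exact: grel_sym|exact: grel_irr|exact: grel_conn|].
move=> y z y'; rewrite grel_dist /grel => yz yy' y'z.
suff [z' z'P] : exists z', forall v, g v y + g v z' = g v z + g v y'.
  by exists z'; apply/forallP => v; rewrite !grel_dist; apply/eqP/z'P.
case: (eqVneq (gsgn y) (gsgn z)) yz => [eq_yz|ne_yz] /eqP yz.
  have [c] : exists c, c \in gset y :&: gset z by apply/card_gt0P; rewrite yz.
  rewrite inE => /andP[yc zc].
  have [a nca yE] := card2P (gset_card y) yc; have [b ncb zE] := card2P (gset_card z) zc.
  have nya : b \notin gset y by apply/negP => yb; move: yz; rewrite zE cardI2 // yc yb.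
  case: (eqVneq (gsgn y) (gsgn y')) yy' y'z => [eq_s|ne_s] /eqP yy'.
    rewrite -eq_s eq_yz eqxx => y'z.
    move: y'z yy'; rewrite (finset.setIC (gset y)) yE zE !cardI2 // => y'z yy'.
    have [nc [nb ya]] : c \notin gset y' /\ b \notin gset y' /\ a \in gset y'.
      by move: y'z yy'; clear; case: (c \in _); case: (b \in _); case: (a \in _).
    have [d nad y'E] := card2P (gset_card y') ya.
    have nbd : b != d by apply: contraNneq nb => ->; rewrite y'E !inE eqxx orbT.
    have [|z' [z'E z's]] := @gvert_make [set b; d] (gsgn z); first by rewrite cards2 nbd.
    exists z' => v; rewrite /g z's -eq_s eq_yz z'E yE zE y'E !cardI2 //.
    by clear; case: ifP => _; case: (a \in _); case: (b \in _); case: (c \in _); case: (d \in _).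
  rewrite [gsgn y' == _]eq_sym -eq_yz (negPf ne_s) => y'z.
  move: y'z yy'; rewrite (finset.setIC (gset y)) yE zE !cardI2 // => y'z yy'.
  have [nc [nb ya]] : c \notin gset y' /\ a \notin gset y' /\ b \in gset y'.
    by move: y'z yy'; clear; case: (c \in _); case: (b \in _); case: (a \in _).
  have [d nbd y'E] := card2P (gset_card y') ya.
  have nad : a != d by apply: contraNneq nb => ->; rewrite y'E !inE eqxx orbT.
  have [|z' [z'E z's]] := @gvert_make [set a; d] (gsgn y'); first by rewrite cards2 nad.
  exists z' => v; rewrite /g z's -eq_yz z'E yE zE y'E !cardI2 //.
  have -> : gsgn y' = ~~ gsgn y by case: (gsgn y) (gsgn y') ne_s => [] [].
  by clear; case: (gsgn v); case: (gsgn y); case: (a \in _); case: (b \in _); case: (c \in _); case: (d \in _).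
have zs : gsgn z = ~~ gsgn y by case: (gsgn y) (gsgn z) ne_yz => [] [].
case: (eqVneq (gsgn y) (gsgn y')) yy' y'z => [eq_s|ne_s] /eqP yy'.
  rewrite -eq_s (negPf ne_yz) => -[y'z].
  have [a] : exists a, a \in gset y :&: gset y' by apply/card_gt0P; rewrite yy'.
  have [b] : exists b, b \in gset y' :&: gset z by apply/card_gt0P; rewrite y'z.
  rewrite !inE => /andP[y'b zb] /andP[ya y'a].
  have [a' naa' yE] := card2P (gset_card y) ya; have [b' nbb' zE] := card2P (gset_card z) zb.
  have disj i : i \in gset y -> i \in gset z -> False.
    by move=> yi zi; have /eqP := yz; rewrite cards_eq0 => /eqP/setP/(_ i); rewrite !inE yi zi.
  have nab : a != b by apply/eqP => eq_ab; apply: (disj a); rewrite // eq_ab.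
  have y'E : gset y' = [set a; b].
    have [c nac y'E] := card2P (gset_card y') y'a.
    by move: y'b; rewrite y'E !inE eq_sym (negPf nab) => /eqP ->.
  have na'b' : a' != b'.
    by apply/eqP => eq_ab; apply: (disj a'); [rewrite yE|rewrite zE eq_ab]; rewrite !inE eqxx orbT.
  have [|z' [z'E z's]] := @gvert_make [set a'; b'] (gsgn z); first by rewrite cards2 na'b'.
  exists z' => v; rewrite /g z's -eq_s zs z'E yE zE y'E !cardI2 //.
  by clear; case: (gsgn v); case: (gsgn y); case: (a \in _); case: (b \in _); case: (a' \in _); case: (b' \in _).
have y's : gsgn y' = gsgn z by case: (gsgn y) (gsgn y') (gsgn z) ne_s ne_yz => [] [] [].
rewrite y's eqxx => y'z; have {}y'z : #|gset y' :&: gset z| = 0 by have := gcardI_le y' z; lia.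
pose rest := ~: (gset y :|: gset z :|: gset y').
have part (V : {set 'I_8}) : #|V :&: gset y| + #|V :&: gset z| + #|V :&: gset y'| + #|V :&: rest| = #|V|.
  have dis (A B : {set 'I_8}) i : #|A :&: B| = 0 -> (i \in A) && (i \in B) = false.
    by move/eqP; rewrite cards_eq0 => /eqP/setP/(_ i); rewrite !inE.
  rewrite -!sum1_card !(big_mkcond (fun i => i \in _)) -!big_split /=.
  apply: eq_bigr => i _; rewrite !inE; move: (dis _ _ i yz) (dis _ _ i yy') (dis _ _ i y'z).
  by case: (i \in V); case: (i \in gset y); case: (i \in gset z); case: (i \in gset y').
have [|z' [z'E z's]] := @gvert_make rest (gsgn y).
  by have := part finset.setT; rewrite !finset.setTI !gset_card cardsT card_ord; lia.
exists z' => v; rewrite /g z's y's zs z'E; have := part (gset v); rewrite gset_card.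
by clear; case: (gsgn v); case: (gsgn y) => /=; lia.
Qed.

End Gosset.

(** * Strongly regular graphs with the Schlaefli parameters *)

Section SchlaefliParameters.
Variables (T : finType) (e : rel T).
Hypotheses (e_sym : symmetric e) (e_irr : irreflexive e) (e_conn : connected_graph e).
Hypothesis e_srg : srg e 27 16 10 8.
Local Notation d := (dist e).

(* Collinearity in the generalized quadrangle of order (2,4) of which e is the complement. *)
Let col x y := (x != y) && ~~ e x y.

Let colC x y : col x y = col y x.
Proof. by rewrite /col eq_sym e_sym. Qed.

(** The vertices x, y and their 16 + 16 - 8 neighbours make 26 of 27; the missing one is the third
    point of the line through x and y. *)
Lemma srg27_third x y : x != y -> ~~ e x y ->
  exists w, forall v, (col v x && col v y) = (v == w).
Proof.
case: e_srg => cT cD _ mu nxy nexy; pose N u := [set w | e u w].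
have cN u : #|N u| = 16 by apply: cD.
have cNN : #|N x :|: N y| = 24.
  have := cardsUI (N x) (N y); rewrite !cN [#|N x :&: N y|](_ : _ = 8); first by clear; lia.
  by rewrite -(mu x y nxy nexy); apply: eq_card => w; rewrite !inE.
have cU : #|x |: (y |: (N x :|: N y))| = 26.
  by rewrite !cardsU1 cNN !inE !e_irr (negPf nxy) (negPf nexy) e_sym (negPf nexy).
have /cards1P[w wE] : #|~: (x |: (y |: (N x :|: N y)))| == 1.
  by have := cardsC (x |: (y |: (N x :|: N y))); rewrite cU cT; clear; lia.
exists w => v; have /setP/(_ v) := wE; rewrite !inE /col => <-.
rewrite !negb_or ![e v _]e_sym.
by case: (v == x); case: (v == y); case: (e x v); case: (e y v).
Qed.

Lemma srg27_dist x y : d x y = if x == y then 0 else if e x y then 1 else 2.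
Proof.
case: eqVneq => [->|nxy]; first exact: distxx.
case: ifPn => exy; first exact: dist_edge.
case: e_srg => _ _ _ /(_ x y nxy exy) mu.
have /card_gt0P[w] : 0 < #|[set w | e x w & e y w]| by rewrite mu.
rewrite inE => /andP[exw eyw]; apply: (dist2 e_sym e_irr e_conn (v := w)) => //.
  by rewrite e_sym.
by rewrite e_sym.
Qed.

Let line x y w := [&& x != y, ~~ e x y & [forall v, (col v x && col v y) == (v == w)]].

Lemma line_col x y w : line x y w -> [/\ col x y, col w x & col w y].
Proof.
case/and3P=> nxy nexy /forallP/(_ w)/eqP; rewrite eqxx => /andP[wx wy].
by split=> //; rewrite /col nxy nexy.
Qed.

Lemma line_uniq x y w v : line x y w -> col v x -> col v y -> v = w.
Proof. by case/and3P=> _ _ /forallP/(_ v)/eqP vE vx vy; apply/eqP; rewrite -vE vx vy. Qed.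

Lemma line_rot x y w : line x y w -> line w x y.
Proof.
case/line_col=> xy wx wy; case/andP: (wx) => nwx newx.
have [z zP] := srg27_third nwx newx; rewrite /line nwx newx; apply/forallP => v.
have /eqP -> : y == z by rewrite -zP colC wy colC xy.
by rewrite zP.
Qed.

(* Off the line, the eight points collinear with w are the eight common neighbours of x and y. *)
Lemma line_cover x y w v : line x y w -> e v x -> e v y -> col v w.
Proof.
move=> lxyw evx evy; have [xy wx wy] := line_col lxyw.
case: (e_srg) => cT cD _ mu; pose C := [set u | col u w] :\ x :\ y.
have cC : #|C| = 8.
  have cw : #|[set u | col u w]| = 10.
    have -> : [set u | col u w] = ~: (w |: [set u | e w u]).
      by apply/setP => z; rewrite !inE negb_or /col e_sym.
    have := cardsC (w |: [set u | e w u]); rewrite cardsU1 inE e_irr cT.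
    by have := cD w; rewrite /Deg => ->; clear; lia.
  have := cardsD1 x [set u | col u w]; have := cardsD1 y ([set u | col u w] :\ x).
  rewrite !inE cw [col x w]colC [col y w]colC wx wy [y == x]eq_sym.
  by case/andP: xy => -> _; rewrite -/C; clear; lia.
have CP : C = [set u | e x u & e y u].
  case/andP: (xy) => nxy nexy; apply/eqP; rewrite eqEcard cC mu // leqnn andbT.
  apply/fintype.subsetP => u; rewrite !inE => /andP[nuy /andP[nux uw]].
  rewrite !(e_sym _ u); apply/andP; split; apply/negPn/negP => neu.
    have := line_uniq (line_rot lxyw) uw; rewrite /col nux neu => /(_ isT) eq_u.
    by rewrite eq_u eqxx in nuy.
  have := line_uniq (line_rot (line_rot lxyw)); rewrite /col => /(_ u).
  by rewrite nuy neu => /(_ isT uw) eq_u; rewrite eq_u eqxx in nux.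
have : v \in C by rewrite CP inE !(e_sym _ v) evx.
by rewrite !inE => /and3P[].
Qed.

(** A point of the line has distances 0, 2, 2. Any other point is collinear with exactly one of the
    three, the axiom of generalized quadrangles, and has distances 2, 1, 1. *)
Lemma srg27_line x y w v : line x y w -> d v x + d v y + d v w = 4.
Proof.
move=> lxyw; have lwxy := line_rot lxyw; have lywx := line_rot lwxy.
have [xy wx wy] := line_col lxyw.
have two a b : col a b -> d a b = 2 by rewrite srg27_dist => /andP[/negPf-> /negPf->].
have [->|nvx] := eqVneq v x; first by rewrite (distxx e_conn) !two // colC.
have [->|nvy] := eqVneq v y; first by rewrite (distxx e_conn) !two // colC.
have [->|nvw] := eqVneq v w; first by rewrite (distxx e_conn) !two.
have near u : v != u -> ~~ col v u -> d v u = 1.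
  by rewrite srg27_dist /col => nvu; rewrite (negPf nvu) /= negbK => ->.
have adj u : v != u -> ~~ col v u -> e v u by rewrite /col => -> /negPn.
have [vx|nx] := boolP (col v x).
  rewrite (two _ _ vx) (near y) ?(near w) //.
    by apply: contra nvy => vw; rewrite (line_uniq lwxy vw vx).
  by apply: contra nvw => vy; rewrite (line_uniq lxyw vx vy).
have [vy|ny] := boolP (col v y).
  rewrite (two _ _ vy) (near x) ?(near w) //.
  by apply: contra nvx => vw; rewrite (line_uniq lywx vy vw).
by rewrite (near x) ?(near y) // (two v w) // (line_cover lxyw) ?adj.
Qed.

(** Let p be the third point on the line y'z, and z' that on the line yp. Both lines have distance
    sum 4 from every v, and subtracting cancels p. *)
Lemma srg27_completable : completable e.
Proof.
move=> y z y' eyz eyy' dy'z.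
have [ny'z ney'z] : y' != z /\ ~~ e y' z.
  by split; apply/negP; [move/eqP|] => h; move: dy'z; rewrite srg27_dist h ?eqxx //; case: eqP.
have [p pP] := srg27_third ny'z ney'z.
have l1 : line y' z p by rewrite /line ny'z ney'z; apply/forallP => v; rewrite pP.
have dyp : d y p = 2.
  have := srg27_line y l1; rewrite (dist_edge e_irr e_conn eyz) (dist_edge e_irr e_conn eyy'); lia.
have [nyp neyp] : y != p /\ ~~ e y p.
  by split; apply/negP; [move/eqP|] => h; move: dyp; rewrite srg27_dist h ?eqxx //; case: eqP.
have [z' z'P] := srg27_third nyp neyp.
have l2 : line y p z' by rewrite /line nyp neyp; apply/forallP => v; rewrite z'P.
exists z'; apply/parP => v; have := srg27_line v l1; have := srg27_line v l2; lia.
Qed.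

End SchlaefliParameters.

(** * Reconstruction from a local graph *)

Section Reconstruction.
Variables (T U : finType) (e : rel T) (r : rel U) (x : T) (x' : U) (s : T -> U) (t : U -> T).
Hypotheses (eG : reflective_graph e) (rG : reflective_graph r).
Hypotheses (sN : forall p, e x p -> r x' (s p)) (st : forall p, e x p -> t (s p) = p).
Hypotheses (tN : forall p, r x' p -> e x (t p)) (ts : forall p, r x' p -> s (t p) = p).
Hypothesis se : forall p q, e x p -> e x q -> r (s p) (s q) = e p q.

(* When edges are vectors of squared norm 2, <v - x, p - x> = d v x + 1 - d v p: linked vertices have the
   same coordinates. *)
Definition linked v v' := forall p, e x p -> dist e v x + dist r v' (s p) = dist r v' x' + dist e v p.

Let e_sym := rg_sym eG. Let e_irr := rg_irr eG. Let e_conn := rg_conn eG. Let e_compl := rg_compl eG.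
Let r_sym := rg_sym rG. Let r_irr := rg_irr rG. Let r_conn := rg_conn rG. Let r_compl := rg_compl rG.
Local Notation dC := (distC e_sym e_conn).
Local Notation dC' := (distC r_sym r_conn).
Local Notation dxx := (distxx e_conn).
Local Notation dE := (dist_edge e_irr e_conn).

Lemma linked_base : linked x x'.
Proof. by move=> p exp; rewrite !distxx // (dE exp) (dist_edge r_irr r_conn (sN exp)). Qed.

Lemma nbr_dist p q : e x p -> e x q -> dist r (s p) (s q) = dist e p q.
Proof.
move=> exp exq; have [->|npq] := eqVneq p q; first by rewrite !distxx.
have nspq : s p != s q by apply: contraNneq npq => eq_s; rewrite -(st exp) -(st exq) eq_s.
have [epq|nepq] := boolP (e p q).
  by rewrite (dE epq) (dist_edge r_irr r_conn) // se.
rewrite (dist2 e_sym e_irr e_conn exp exq npq nepq).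
by apply: (dist2 r_sym r_irr r_conn (sN exp) (sN exq) nspq); rewrite se.
Qed.

(** Linked vertices lie on the same side of corresponding edges, and the reflections change their
    coordinates by amounts that depend only on distances between neighbours of the centre, equal by
    [nbr_dist]. *)
Lemma linked_rfl_center v v' p : e x p -> linked v v' ->
  linked (rfl e x p v) (rfl r x' (s p) v').
Proof.
move=> exp lv q exq; have lp := lv p exp; have lq := lv q exq; have dpq := nbr_dist exq exp.
have dxp := dE exp; have dxq := dE exq.
have dxp' := dist_edge r_irr r_conn (sN exp); have dxq' := dist_edge r_irr r_conn (sN exq).
case: (rflP e_sym e_irr e_conn e_compl v exp) => [dv|w dv /parP pw _|w dv /parP pw _];
 case: (rflP r_sym r_irr r_conn r_compl v' (sN exp)) => [dv'|w' dv' /parP pw' _|w' dv' /parP pw' _];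
 rewrite ?lq //; try (clear -lp dv dv'; lia).
- have := pw q; have := pw x; have := pw' (s q); have := pw' x'.
  rewrite dpq dxp dxp' !dxx !(distxx r_conn) !(dC _ w) !(dC' _ w') !(dC _ v) !(dC' _ v').
  rewrite (dC q x) dxq (dC' (s q) x') dxq'; clear -lp lq dv dv'; lia.
- have := pw q; have := pw x; have := pw' (s q); have := pw' x'.
  rewrite dpq dxp dxp' !dxx !(distxx r_conn) !(dC _ w) !(dC' _ w') !(dC _ v) !(dC' _ v').
  rewrite (dC q x) dxq (dC' (s q) x') dxq'; clear -lp lq dv dv'; lia.
Qed.

Lemma linked_rfl_local v v' p q : e x p -> e x q -> e p q -> linked v v' ->
  linked (rfl e p q v) (rfl r (s p) (s q) v').
Proof.
move=> exp exq epq lv u exu; have lp := lv p exp; have lq := lv q exq; have lu := lv u exu.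
have dup := nbr_dist exu exp; have duq := nbr_dist exu exq.
have dxp := dE exp; have dxq := dE exq.
have dxp' := dist_edge r_irr r_conn (sN exp); have dxq' := dist_edge r_irr r_conn (sN exq).
have rpq : r (s p) (s q) by rewrite se.
case: (rflP e_sym e_irr e_conn e_compl v epq) => [dv|w dv /parP pw _|w dv /parP pw _];
 case: (rflP r_sym r_irr r_conn r_compl v' rpq) => [dv'|w' dv' /parP pw' _|w' dv' /parP pw' _];
 rewrite ?lu //; try (clear -lp lq dv dv'; lia).
- have := pw u; have := pw x; have := pw' (s u); have := pw' x'.
  rewrite dup duq dxp dxp' dxq dxq' !(dC _ w) !(dC' _ w') !(dC _ v) !(dC' _ v').
  by clear -lp lq lu dv dv'; lia.
- have := pw u; have := pw x; have := pw' (s u); have := pw' x'.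
  rewrite dup duq dxp dxp' dxq dxq' !(dC _ w) !(dC' _ w') !(dC _ v) !(dC' _ v').
  by clear -lp lq lu dv dv'; lia.
Qed.

Lemma toward v : v != x -> exists2 p, e x p & (dist e v p).+1 = dist e v x.
Proof.
move=> nvx; have [|p [epx dp]] := @dist_pred _ _ e_conn v x.
  by rewrite lt0n (dist_eq0 e_conn).
by exists p; rewrite 1?e_sym.
Qed.

(** Reflecting in xp, with p on a geodesic to v, brings v one step closer to x; the partner found
    there is reflected back in the other graph. *)
Lemma linked_total v : exists v', linked v v'.
Proof.
have [n le_n] := ubnP (dist e v x); elim: n v le_n => // n IHn v lt_n.
have [->|/toward[p exp dp]] := eqVneq v x; first by exists x'; exact: linked_base.
have [|w' lw] := IHn (rfl e x p v).
  by rewrite rfl_dist_left //; clear -dp lt_n; lia.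
exists (rfl r x' (s p) w'); rewrite -[v](rflK e_sym e_irr e_conn e_compl exp).
exact: linked_rfl_center.
Qed.

Lemma linked_inj v w v' : linked v v' -> linked w v' -> v = w.
Proof.
have [n le_n] := ubnP (dist e v x); elim: n v w v' le_n => // n IHn v w v' lt_n lv lw.
have [eq_v|/toward[p exp dp]] := eqVneq v x.
  apply/esym; rewrite eq_v; apply/eqP; apply/negPn/negP => /toward[p exp dp].
  have := lv p exp; have := lw p exp; rewrite eq_v dxx (dE exp).
  by clear -dp; lia.
have dw : dist e (rfl e x p v) x < n by rewrite rfl_dist_left //; clear -dp lt_n; lia.
have := IHn _ _ _ dw (linked_rfl_center exp lv) (linked_rfl_center exp lw).
exact: (rfl_inj e_sym e_irr e_conn e_compl exp).
Qed.

Lemma linked_swap v v' : linked v v' -> forall p', r x' p' ->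
  dist r v' x' + dist e v (t p') = dist e v x + dist r v' p'.
Proof. by move=> lv p' rp'; have := lv _ (tN rp'); rewrite ts //; lia. Qed.

(** This is [linked_inj] for the reversed relation, supplied when the two graphs exchange roles. *)
Hypothesis linked_fun : forall v v' w', linked v v' -> linked v w' -> v' = w'.

(** An edge pointing away from x is parallel to some edge xp, so w is the reflection of v in xp and
    w' that of v' in the corresponding edge. *)
Lemma linked_edge_up v w v' w' : linked v v' -> linked w w' -> e v w ->
  dist e x w = (dist e x v).+1 -> r v' w'.
Proof.
move=> lv lw evw dw.
have side_x : dist e x v < dist e x w by rewrite dw.
have par_vw := rfl_par e_sym e_irr e_conn e_compl evw side_x; set p := rfl e v w x in par_vw.
have exp : e x p by apply: (par_edge e_irr e_conn evw dw par_vw).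
have dvp : dist e v p = (dist e v x).+1.
  by have /parP/(_ v) := par_vw; rewrite dxx (dE evw); clear; lia.
have wE : rfl e x p v = w.
  by apply: rfl_parE; rewrite // ?dvp // -par_swap.
have w'E : w' = rfl r x' (s p) v'.
  by apply: linked_fun lw _; rewrite -wE; apply: linked_rfl_center.
rewrite w'E; case: (rflP r_sym r_irr r_conn r_compl v' (sN exp)) => // dv'.
by have := lv p exp; rewrite dvp dv'; clear; lia.
Qed.

(** The edges left lie within a sphere around x. Take p on a geodesic from x to v. If v and w are
    equally far from p, reflecting in xp moves v closer to x; otherwise vw is parallel to an edge pq
    between neighbours of x. *)
Lemma linked_edge v w v' w' : linked v v' -> linked w w' -> e v w -> r v' w'.
Proof.
have [n le_n] := ubnP (dist e v x); elim: n v w v' w' le_n => // n IHn v w v' w' lt_n lv lw evw.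
have [dvw|dvw|dvw] := edge_side e_sym e_conn x evw; last first.
- by rewrite r_sym; apply: (linked_edge_up lw lv); rewrite 1?e_sym.
- exact: (linked_edge_up lv lw).
have [eq_v|/toward[p exp dp]] := eqVneq v x.
  by move: dvw; rewrite eq_v dxx => /esym/(dist0P e_conn) eq_w; move: evw; rewrite eq_v eq_w e_irr.
have [dwp|ndwp] := eqVneq (dist e w p) (dist e v p).
  rewrite -(rfl_edge r_sym r_irr r_conn r_compl v' w' (sN exp)).
  apply: (IHn (rfl e x p v) (rfl e x p w)); [|exact: linked_rfl_center|exact: linked_rfl_center|].
    by rewrite rfl_dist_left //; clear -dp lt_n; lia.
  by rewrite rfl_edge.
have dpw : dist e p w = (dist e p v).+1.
  have := edge_side e_sym e_conn p evw; have := dist_step e_conn w exp.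
  have := dist_stepC e_sym e_conn w exp; move: dp ndwp dvw.
  rewrite !(dC _ v) !(dC _ w); clear => dp ndwp dvw st1 st2 [?|?|?]; lia.
have side_p : dist e p v < dist e p w by rewrite dpw.
have par_vw := rfl_par e_sym e_irr e_conn e_compl evw side_p; set q := rfl e v w p in par_vw.
have epq : e p q by apply: (par_edge e_irr e_conn evw dpw par_vw).
have exq : e x q by rewrite -(rfl_fix dvw) rfl_edge.
have dvq : dist e v q = (dist e v p).+1.
  by have /parP/(_ v) := par_vw; rewrite dxx (dE evw); clear; lia.
have wE : rfl e p q v = w.
  by apply: rfl_parE; rewrite // ?dvq // -par_swap.
have w'E : w' = rfl r (s p) (s q) v'.
  by apply: linked_fun lw _; rewrite -wE; apply: linked_rfl_local.
have rpq : r (s p) (s q) by rewrite se.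
rewrite w'E; case: (rflP r_sym r_irr r_conn r_compl v' rpq) => // dv'.
by have := lv p exp; have := lv q exq; rewrite dvq dv'; clear; lia.
Qed.

End Reconstruction.

Lemma reflective_local_iso (T U : finType) (e : rel T) (r : rel U) x x' (s : T -> U) (t : U -> T) :
  reflective_graph e -> reflective_graph r ->
  (forall p, e x p -> r x' (s p)) -> (forall p, e x p -> t (s p) = p) ->
  (forall p, r x' p -> e x (t p)) -> (forall p, r x' p -> s (t p) = p) ->
  (forall p q, e x p -> e x q -> r (s p) (s q) = e p q) -> giso e r.
Proof.
move=> eG rG sN st tN ts se.
have te p q : r x' p -> r x' q -> e (t p) (t q) = r p q.
  by move=> rp rq; rewrite -se ?tN // !ts.
have swapL v v' : linked e r x x' s v v' -> linked r e x' x t v' v.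
  exact: (linked_swap tN ts).
have swapR v v' : linked r e x' x t v' v -> linked e r x x' s v v'.
  exact: (linked_swap sN st).
have fun1 v v' w' : linked e r x x' s v v' -> linked e r x x' s v w' -> v' = w'.
  by move=> /swapL lv /swapL lw; apply: (linked_inj rG eG tN ts te lv lw).
have fun2 v' v w : linked r e x' x t v' v -> linked r e x' x t v' w -> v = w.
  by move=> /swapR lv /swapR lw; apply: (linked_inj eG rG sN st se lv lw).
have [f fP] := choice (linked_total eG rG sN st se).
have [g gP] := choice (linked_total rG eG tN ts te).
have gK v' : f (g v') = v' by apply: fun1 (fP (g v')) (swapR _ _ (gP v')).
have fK v : g (f v) = v by apply: fun2 (gP (f v)) (swapL _ _ (fP v)).
exists f, g; split=> // v w; apply/idP/idP => [rvw|evw].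
  exact: (linked_edge rG eG tN ts te fun2 (swapL _ _ (fP v)) (swapL _ _ (fP w)) rvw).
exact: (linked_edge eG rG sN st se fun1 (fP v) (fP w) evw).
Qed.

Lemma giso_inj (T U : finType) (e : rel T) (r : rel U) (f : T -> U) :
  injective f -> (forall y, exists x, f x = y) -> (forall x y, r (f x) (f y) = e x y) -> giso e r.
Proof.
move=> f_inj /choice[g gK] fe; exists f, g; split=> // x; exact: f_inj.
Qed.

Lemma rg_dist_le (T : finType) (e : rel T) x n : reflective_graph e ->
  (forall z, dist e x z != n.+1) -> forall z, dist e x z <= n.
Proof.
move=> [_ _ e_conn _] no z; have [m le_m] := ubnP (dist e x z).
elim: m z le_m => // m IHm z lt_m; rewrite leqNgt; apply/negP => lt_n.
have [|y [_ dy]] := @dist_pred _ _ e_conn x z; first by clear -lt_n; lia.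
have := no z; have := IHm y; clear -lt_n lt_m dy; lia.
Qed.

(** * Local graphs *)

Section LocalGraph.
Variables (T : finType) (e : rel T) (x : T).

Definition nbv := {y : T | e x y}.
Definition nbval (a : nbv) : T := val a.
Definition nbrel : rel nbv := fun a b => e (nbval a) (nbval b).

Lemma nbvalP (a : nbv) : e x (nbval a).
Proof. exact: (valP a). Qed.

Lemma nbval_inj : injective nbval.
Proof. exact: val_inj. Qed.

Lemma nbv_make y : e x y -> exists a, nbval a = y.
Proof. by move=> exy; exists (Sub y exy); rewrite /nbval SubK. Qed.

Hypothesis eG : reflective_graph e.
Hypothesis mid : forall p q, e x p -> e x q -> p != q -> ~~ e p q ->
  exists s, [/\ e x s, e p s & e q s].

Let e_sym := rg_sym eG. Let e_irr := rg_irr eG. Let e_conn := rg_conn eG. Let e_compl := rg_compl eG.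

Let g (a b : nbv) := dist e (nbval a) (nbval b).

Lemma nb_pred a b : 0 < g a b -> exists z, nbrel z b /\ g z b <= g a b /\ g a z < g a b.
Proof.
move=> g_gt0; have nab : nbval a != nbval b by rewrite -(dist_eq0 e_conn) -lt0n.
have [eab|neab] := boolP (e (nbval a) (nbval b)).
  by exists a; split=> //; split=> //; rewrite {1}/g distxx.
have [s [exs eas ebs]] := mid (nbvalP a) (nbvalP b) nab neab.
have [z zs] := nbv_make exs; have dab := dist2 e_sym e_irr e_conn (nbvalP a) (nbvalP b) nab neab.
exists z; rewrite /nbrel /g zs dab e_sym ebs; split=> //; split.
  by rewrite (dist_edge e_irr e_conn) // e_sym.
by rewrite (dist_edge e_irr e_conn).
Qed.

Lemma nb_conn : connected_graph nbrel.
Proof.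
apply: (@metric_connected _ _ g) => [a b|a b /(dist0P e_conn)/nbval_inj //].
by case/nb_pred => z [? [? ?]]; exists z.
Qed.

Lemma nb_dist a b : dist nbrel a b = dist e (nbval a) (nbval b).
Proof.
move: a b; apply: (dist_uniq nb_conn (g := g)) => [a|v a b|a b|a b].
- exact: distxx.
- exact: (dist_step e_conn).
- by case/nb_pred => z [? [? ?]]; exists z.
- by move/(dist0P e_conn)/nbval_inj.
Qed.

(** Three corners at distance 1 from x force the fourth to distance 1, and [mid] makes the local
    graph isometric; so parallelograms stay inside. *)
Lemma local_reflective : reflective_graph nbrel.
Proof.
split; [by move=> a b; rewrite /nbrel e_sym|by move=> a; rewrite /nbrel e_irr|exact: nb_conn|].
move=> y z y' yz yy'; rewrite nb_dist => /(e_compl yz yy')[w pw].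
have /(nbv_make)[z' z'w] : e x w.
  have /parP/(_ x) := pw; rewrite !(edge_dist e_irr e_conn).
  by rewrite !(dist_edge e_irr e_conn (nbvalP _)); clear; lia.
by exists z'; apply/forallP => v; rewrite !nb_dist z'w; move/forallP: pw; apply.
Qed.

Lemma nb_dist_le a b : dist nbrel a b <= 2.
Proof. by rewrite nb_dist; apply: common_dist (nbvalP a) (nbvalP b). Qed.

Lemma nb_card : #|{: nbv}| < #|T|.
Proof.
rewrite card_sig -[X in _ < X](cardC (e x)) -addn1 leq_add2l; apply/card_gt0P; exists x.
by rewrite inE unfold_in e_irr.
Qed.

Lemma nb_no_claw s p q t : nbrel s p -> nbrel s q -> nbrel s t ->
  dist nbrel p q = 2 -> dist nbrel p t = 2 -> dist nbrel q t = 2 -> False.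
Proof.
rewrite !nb_dist; apply: (no_claw e_sym e_irr e_conn e_compl (v := x)); exact: nbvalP.
Qed.

(* A vertex at distance 3 is reached from x along three mutually orthogonal edge vectors. *)
Lemma dist3_anticlique z : dist e x z = 3 -> exists a b c : nbv,
  [/\ dist nbrel a b = 2, dist nbrel a c = 2 & dist nbrel b c = 2].
Proof.
move=> dz; have dC := distC e_sym e_conn; have dE := dist_edge e_irr e_conn.
have nzx : z != x by rewrite -(dist_eq0 e_conn) dC dz.
have [p1 exp1 d1] := toward eG nzx.
have e1x : e p1 x by rewrite e_sym.
have lt1 : dist e z p1 < dist e z x by rewrite -d1.
(* Reflections strip the directions of p1 and p2 off z; what remains is z2, the third direction. *)
have /parP pz := rfl_par e_sym e_irr e_conn e_compl e1x lt1; set z1 := rfl e p1 x z in pz.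
have dz1 : dist e z1 x = 2.
  by have := pz x; rewrite (distxx e_conn) (dE _ _ exp1) dz (dC z1 x); clear; lia.
have nz1x : z1 != x by rewrite -(dist_eq0 e_conn) dz1.
have [p2 exp2 d2] := toward eG nz1x.
have e2x : e p2 x by rewrite e_sym.
have lt2 : dist e z1 p2 < dist e z1 x by rewrite -d2.
have /parP pz1 := rfl_par e_sym e_irr e_conn e_compl e2x lt2; set z2 := rfl e p2 x z1 in pz1.
have ex2 : e x z2.
  rewrite (edge_dist e_irr e_conn); apply/eqP.
  by have := pz1 x; rewrite (distxx e_conn) (dE _ _ exp2) (dC x z1) dz1; clear; lia.
have far p : e x p -> 2 <= dist e p z.
  by move=> exp; have := dist_stepC e_sym e_conn z exp; rewrite (dC z x) dz (dC z p); clear; lia.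
have le2 p q : e x p -> e x q -> dist e p q <= 2 by apply: common_dist.
have d12 : dist e z1 z2 = 1.
  have := pz1 z1; rewrite (distxx e_conn) dz1; move: d2; rewrite dz1; clear; lia.
have [[a av] [b bv]] := (nbv_make exp1, nbv_make exp2); have [c cv] := nbv_make ex2.
exists a, b, c; rewrite !nb_dist av bv cv.
have := pz p2; have := far _ exp2; have := le2 _ _ exp1 exp2; have := le2 _ _ exp1 ex2.
have := le2 _ _ exp2 ex2; have := far _ ex2; have := pz z2; have := pz1 z2.
move: d2.
rewrite (distxx e_conn) !(dC _ x) (dE _ _ ex2) (dE _ _ exp2) (dC z2 z1) d12 (dC x z1) dz1.
rewrite (dC p2 z1) (dC p2 p1) (dC z2 p1) (dC z2 p2).
move: (dist e p1 p2) (dist e p1 z2) (dist e p2 z2) (dist e p2 z) (dist e z2 z) (dist e z1 p2).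
by clear => *; split; lia.
Qed.

End LocalGraph.

Lemma local_iso_giso (T U : finType) (e : rel T) (r : rel U) x x' :
  reflective_graph e -> reflective_graph r -> giso (@nbrel _ e x) (@nbrel _ r x') -> giso e r.
Proof.
move=> eG rG [f [g [fK gK fe]]].
pose s p := oapp (fun a : nbv e x => nbval (f a)) x' (insub p).
pose t p := oapp (fun a : nbv r x' => nbval (g a)) x (insub p).
have sE a : s (nbval a) = nbval (f a) by rewrite /s valK.
have tE a : t (nbval a) = nbval (g a) by rewrite /t valK.
apply: (@reflective_local_iso _ _ e r x x' s t eG rG).
- by move=> p /nbv_make[a <-]; rewrite sE; apply: nbvalP.
- by move=> p /nbv_make[a <-]; rewrite sE tE fK.
- by move=> p /nbv_make[a <-]; rewrite tE; apply: nbvalP.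
- by move=> p /nbv_make[a <-]; rewrite tE sE gK.
- by move=> p q /nbv_make[a <-] /nbv_make[b <-]; rewrite !sE; apply: fe.
Qed.

(** * Products of two cliques *)

Section Grid.
Variables P Q : finType.
Definition grid : rel (P * Q) := fun u v => (u.1 == v.1) != (u.2 == v.2).
End Grid.

Section NotLocallyConnected.
Variables (T : finType) (e : rel T).
Hypotheses (eG : reflective_graph e) (diam2 : forall a b, dist e a b <= 2).
Hypothesis claw : forall s p q t, e s p -> e s q -> e s t ->
  dist e p q = 2 -> dist e p t = 2 -> dist e q t = 2 -> False.
Local Notation d := (dist e).
Local Notation par := (parallel e).
Let e_sym := rg_sym eG. Let e_irr := rg_irr eG. Let e_conn := rg_conn eG. Let e_compl := rg_compl eG.

(** In a disconnected neighbourhood of h, a component A and the rest B are cliques: two nonadjacent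
    vertices of one and any vertex of the other would be a claw. By diameter 2 every vertex is the
    fourth corner over h of some p in A or h and q in B or h; these are its coordinates. *)
Lemma not_locally_connected_grid : ~ locally_connected e ->
  exists P Q : finType, [/\ 0 < #|P|, 0 < #|Q| & giso e (@grid P Q)].
Proof.
move=> nloc; have dC := distC e_sym e_conn; have dE := dist_edge e_irr e_conn.
have dxx := distxx e_conn; have eE := edge_dist e_irr e_conn.
pose lrel h : rel T := fun a b => [&& e h a, e h b & e a b].
have [h [a [b [eha ehb nab]]]] : exists h a b, [/\ e h a, e h b & ~~ connect (lrel h) a b].
  apply: contrapT => none; apply: nloc => h a b eha ehb; apply: contrapT => /negP nab.
  by apply: none; exists h, a, b.
pose A := [set p | e h p & connect (lrel h) a p].
pose B := [set p | e h p & ~~ connect (lrel h) a p].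
have noAB p q : p \in A -> q \in B -> d p q = 2.
  rewrite !inE => /andP[ehp cp] /andP[ehq ncq]; apply: (dist2 e_sym e_irr e_conn ehp ehq).
    by apply: contraNneq ncq => <-.
  apply: contra ncq => epq; apply: connect_trans cp (connect1 _).
  by rewrite /lrel ehp ehq epq.
have Aa : a \in A by rewrite inE eha connect0.
have Bb : b \in B by rewrite inE ehb nab.
have clique_aux p q t : e h p -> e h q -> e h t -> d p t = 2 -> d q t = 2 -> p != q -> d p q = 1.
  move=> ehp ehq eht dpt dqt npq; apply: dE; apply/negPn/negP => nepq.
  by apply: (claw ehp ehq eht _ dpt dqt); apply: (dist2 e_sym e_irr e_conn ehp ehq).
have AH p : p \in A -> e h p by rewrite inE => /andP[].
have BH p : p \in B -> e h p by rewrite inE => /andP[].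
have AC p q : p \in A -> q \in A -> p != q -> d p q = 1.
  by move=> Ap Aq; exact: clique_aux (AH _ Ap) (AH _ Aq) ehb (noAB _ _ Ap Bb) (noAB _ _ Aq Bb).
have BC p q : p \in B -> q \in B -> p != q -> d p q = 1.
  by move=> Bp Bq; apply: clique_aux (BH _ Bp) (BH _ Bq) eha _ _; rewrite dC noAB.
have ABcase p : e h p -> p \in A \/ p \in B.
  by rewrite !inE => ->; case: (connect _ _ _); [left|right].
pose C := h |: A; pose D := h |: B.
have Ch : h \in C by rewrite !inE eqxx.
have Dh : h \in D by rewrite !inE eqxx.
have CD p q : p \in C -> q \in D -> d p q = d p h + d q h.
  rewrite !in_setU1 => /orP[/eqP->|Ap] /orP[/eqP->|Bq].
  - by rewrite !dxx.
  - by rewrite dxx dC.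
  - by rewrite dxx addn0.
  - by rewrite noAB // !(dC _ h) (dE _ _ (AH _ Ap)) (dE _ _ (BH _ Bq)).
have cliqC (p q : T) : p \in C -> q \in C -> d p q = (p != q).
  rewrite !in_setU1; case: (eqVneq p q) => [->|npq] /=; first by rewrite dxx.
  move=> /orP[/eqP eqp|Ap] /orP[/eqP eqq|Aq].
  - by rewrite eqp eqq eqxx in npq.
  - by rewrite eqp (dE _ _ (AH _ Aq)).
  - by rewrite eqq dC (dE _ _ (AH _ Ap)).
  - exact: AC.
have cliqD (p q : T) : p \in D -> q \in D -> d p q = (p != q).
  rewrite !in_setU1; case: (eqVneq p q) => [->|npq] /=; first by rewrite dxx.
  move=> /orP[/eqP eqp|Ap] /orP[/eqP eqq|Aq].
  - by rewrite eqp eqq eqxx in npq.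
  - by rewrite eqp (dE _ _ (BH _ Aq)).
  - by rewrite eqq dC (dE _ _ (BH _ Ap)).
  - exact: BC.
have parh p : par h p h p by apply/parP => v; rewrite addnC.
have parh' q : par h h q q by apply/parP => v.
have corner p q : p \in C -> q \in D -> exists w, par h p q w.
  rewrite !in_setU1 => /orP[/eqP->|Ap] /orP[/eqP->|Bq]; [by exists h|by exists q|by exists p|].
  by apply: e_compl (AH _ Ap) (BH _ Bq) _; rewrite dC noAB.
have coord w : exists pq : T * T, [/\ pq.1 \in C, pq.2 \in D & par h pq.1 pq.2 w].
  have [->|nwh] := eqVneq w h; first by exists (h, h); split=> //; apply: parh'.
  have [ehw|nehw] := boolP (e h w).
    case: (ABcase w ehw) => Xw; [exists (w, h)|exists (h, w)]; split=> //; rewrite /= ?in_setU1 ?Xw ?eqxx ?orbT //.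
  have dhw : d h w = 2.
    have := diam2 h w; have := eE h w; have := dist_eq0 e_conn h w.
    by rewrite [h == w]eq_sym (negPf nwh) (negPf nehw); clear; lia.
  have [|s [esw ds]] := @dist_pred _ _ e_conn h w; first by rewrite dhw.
  have ehs : e h s by rewrite eE; clear -ds dhw; lia.
  have esh : e s h by rewrite e_sym.
  (* Moving the edge sh to w yields t with h, s, w, t a parallelogram; s and t are not adjacent, so
     one is in A and the other in B. *)
  have [t /parP pt] : exists t, par s h w t by apply: e_compl => //; rewrite dC.
  have eht : e h t.
    by rewrite eE; have := pt h; rewrite dxx dhw (dE _ _ ehs); clear; lia.
  have dst : d s t = 2 by have := pt s; rewrite dxx (dE _ _ esh) (dE _ _ esw); clear; lia.
  have nst : s != t by rewrite -(dist_eq0 e_conn) dst.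
  case: (ABcase s ehs) => Xs; case: (ABcase t eht) => Xt.
  - by have := AC _ _ Xs Xt nst; rewrite dst.
  - exists (s, t); split; rewrite /= ?in_setU1 ?Xs ?Xt ?orbT //.
    by apply/parP => v; have := pt v; clear; lia.
  - exists (t, s); split; rewrite /= ?in_setU1 ?Xs ?Xt ?orbT //.
    by apply/parP => v; have := pt v; clear; lia.
  - by have := BC _ _ Xs Xt nst; rewrite dst.
have metric p q w p2 q2 w2 : p \in C -> q \in D -> par h p q w ->
    p2 \in C -> q2 \in D -> par h p2 q2 w2 -> d w w2 = (p != p2) + (q != q2).
  move=> Cp Dq /parP pw Cp2 Dq2 /parP pw2; rewrite -cliqC // -cliqD //.
  have := pw w2; have := pw2 h; have := pw2 p; have := pw2 q; have := CD p q2 Cp Dq2; have := CD p2 q Cp2 Dq.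
  rewrite !dxx !(dC w2) !(dC h) (dC q p2); clear; lia.
have [f fP] := choice coord.
pose Pt := {p : T | p \in C}; pose Qt := {q : T | q \in D}.
pose F w : Pt * Qt := (insubd (Sub h Ch) (f w).1, insubd (Sub h Dh) (f w).2).
have F1 w : val (F w).1 = (f w).1 by case: (fP w) => Cp _ _; rewrite insubdK.
have F2 w : val (F w).2 = (f w).2 by case: (fP w) => _ Dq _; rewrite insubdK.
have Fd w w2 : d w w2 = ((F w).1 != (F w2).1) + ((F w).2 != (F w2).2).
  case: (fP w) (fP w2) => [Cp Dq pw] [Cp2 Dq2 pw2].
  by rewrite (metric _ _ _ _ _ _ Cp Dq pw Cp2 Dq2 pw2) -!F1 -!F2 !(inj_eq val_inj).
exists Pt, Qt; split.
- by apply/card_gt0P; exists (Sub h Ch).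
- by apply/card_gt0P; exists (Sub h Dh).
apply: (@giso_inj _ _ _ _ F) => [w w2 eqF|[p q]|w w2].
- by apply: (dist0P e_conn); rewrite Fd eqF !eqxx.
- have [w pw] := corner _ _ (valP p) (valP q); exists w.
  case: (fP w) => Cp Dq pw'; have := metric _ _ _ _ _ _ (valP p) (valP q) pw Cp Dq pw'.
  rewrite dxx -F1 -F2 !(inj_eq val_inj) [F w]surjective_pairing.
  by case: eqP => [->|//]; case: eqP => [->|//].
- by rewrite /grid eE Fd; case: ((F w).1 == _); case: ((F w).2 == _).
Qed.

End NotLocallyConnected.

(** * Change of ground set and local graphs of the families *)

Lemma bijection_of_card (V W : finType) : #|V| = #|W| ->
  exists (f : V -> W) g, cancel f g /\ cancel g f.
Proof.
move=> eqVW; exists (fun v => enum_val (cast_ord eqVW (enum_rank v))).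
exists (fun w => enum_val (cast_ord (esym eqVW) (enum_rank w))).
by split=> v; rewrite enum_valK ?cast_ordK ?cast_ordKV enum_rankK.
Qed.

Lemma jvert_make (V : finType) k (S : {set V}) : #|S| = k -> exists A : jvert V k, jset A = S.
Proof. by move/eqP=> cS; exists (Sub S cS); rewrite jsetK. Qed.

Lemma hvert_make (V : finType) (S : {set V}) : ~~ odd #|S| -> exists A : hvert V, hset A = S.
Proof. by move=> cS; exists (Sub S cS); rewrite hsetK. Qed.

Lemma card_preim_bij (V W : finType) (f : V -> W) g (S : {set V}) :
  cancel f g -> cancel g f -> #|[set w | g w \in S]| = #|S|.
Proof.
move=> fK gK; rewrite -(card_imset _ (can_inj fK)); apply: eq_card => w; rewrite inE.
by rewrite -{2}[w]gK mem_imset //; apply: can_inj fK.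
Qed.

Lemma jrel_card (V W : finType) k : #|V| = #|W| -> giso (@jrel V k) (@jrel W k).
Proof.
case/bijection_of_card=> f [g [fK gK]].
have pre S := card_preim_bij S fK gK.
have /choice[F FP] : forall A : jvert V k, exists B : jvert W k, jset B = [set w | g w \in jset A].
  by move=> A; apply: jvert_make; rewrite pre jvert_card.
apply: (@giso_inj _ _ _ _ F) => [A B eqF|B|A B].
- apply: jset_inj; apply/setP => v; have := FP A; rewrite eqF FP => /setP/(_ (f v)).
  by rewrite !inE fK.
- have [|A AE] := @jvert_make V k [set v | f v \in jset B].
    by rewrite (card_preim_bij _ gK fK) jvert_card.
  by exists A; apply: jset_inj; rewrite FP AE; apply/setP => w; rewrite !inE gK.
- by rewrite /jrel !FP -(pre (jset A :&: jset B)); congr (#|pred_of_set _| + _ == _);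
    apply/setP => w; rewrite !inE.
Qed.

Lemma hrel_card (V W : finType) : #|V| = #|W| -> giso (@hrel V) (@hrel W).
Proof.
case/bijection_of_card=> f [g [fK gK]].
have pre S := card_preim_bij S fK gK.
have /choice[F FP] : forall A : hvert V, exists B : hvert W, hset B = [set w | g w \in hset A].
  by move=> A; apply: hvert_make; rewrite pre hset_even.
apply: (@giso_inj _ _ _ _ F) => [A B eqF|B|A B].
- apply: hset_inj; apply/setP => v; have := FP A; rewrite eqF FP => /setP/(_ (f v)).
  by rewrite !inE fK.
- have [|A AE] := @hvert_make V [set v | f v \in hset B].
    by rewrite (card_preim_bij _ gK fK) hset_even.
  by exists A; apply: hset_inj; rewrite FP AE; apply/setP => w; rewrite !inE gK.
- by rewrite /hrel !FP -(pre (sdiff (hset A) (hset B))); congr (#|pred_of_set _| == _);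
    apply/setP => w; rewrite !inE.
Qed.

Lemma crel_card (V W : finType) : #|V| = #|W| -> giso (@crel V) (@crel W).
Proof.
case/bijection_of_card=> f [g [fK gK]].
exists (fun p => (f p.1, p.2)), (fun p => (g p.1, p.2)); split=> [[i b]|[i b]|[i b] [j c]] /=.
- by rewrite fK.
- by rewrite gK.
- by rewrite /crel /= (inj_eq (can_inj fK)).
Qed.

Lemma jrel_compl (V : finType) k : k <= #|V| -> giso (@jrel V k) (@jrel V (#|V| - k)).
Proof.
move=> le_k; have /choice[F FP] : forall A : jvert V k, exists B : jvert V (#|V| - k), jset B = ~: jset A.
  by move=> A; apply: jvert_make; have := cardsC (jset A); rewrite jvert_card; clear; lia.
apply: (@giso_inj _ _ _ _ F) => [A B eqF|B|A B].
- by apply: jset_inj; apply: (can_inj (@finset.setCK V)); rewrite -!FP eqF.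
- have [|A AE] := @jvert_make V k (~: jset B).
    by have := cardsC (jset B); rewrite jvert_card; clear -le_k; lia.
  by exists A; apply: jset_inj; rewrite FP AE finset.setCK.
- rewrite /jrel !FP -finset.setCU; have := cardsC (jset A :|: jset B).
  have := cardsUI (jset A) (jset B); rewrite !jvert_card; have := cardI_le A B.
  have := max_card (mem (jset A :|: jset B)).
  move: #|jset A :|: _| #|_ :&: _| #|~: _| #|V| le_k => n1 n2 n3 n4; clear => *.
  by apply/eqP/eqP; lia.
Qed.

Lemma hrel_local (V : finType) (h0 : hvert V) : hset h0 = finset.set0 ->
  giso (@nbrel _ (@hrel V) h0) (@jrel V 2).
Proof.
move=> h0E; have sd0 A : sdiff finset.set0 A = A :> {set V}.
  by apply/setP => i; rewrite !inE; case: (i \in A).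
have c2 (a : nbv (@hrel V) h0) : #|hset (nbval a)| = 2.
  by have := nbvalP a; rewrite /hrel h0E sd0 => /eqP.
have /choice[F FP] : forall a : nbv (@hrel V) h0, exists B : jvert V 2, jset B = hset (nbval a).
  by move=> a; apply: jvert_make.
apply: (@giso_inj _ _ _ _ F) => [a b eqF|B|a b].
- by apply: nbval_inj; apply: hset_inj; rewrite -!FP eqF.
- have [|A AE] := @hvert_make V (jset B); first by rewrite jvert_card.
  have [|a aE] := @nbv_make _ (@hrel V) h0 A; first by rewrite /hrel h0E sd0 AE jvert_card.
  by exists a; apply: jset_inj; rewrite FP aE AE.
- rewrite /jrel /nbrel /hrel !FP; have := card_sdiff (hset (nbval a)) (hset (nbval b)).
  by rewrite !c2; clear; move: #|_| #|_| => *; apply/eqP/eqP; lia.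
Qed.

Lemma crel_local (I : finType) : giso (@nbrel _ (@crel (option I)) (None, true)) (@crel I).
Proof.
apply: giso_sym.
have /choice[F FP] : forall p : I * bool, exists a : nbv (@crel (option I)) (None, true),
    nbval a = (Some p.1, p.2) by move=> p; apply: nbv_make.
apply: (@giso_inj _ _ _ _ F) => [[i b] [j c] eqF|a|p q].
- by have := FP (i, b); rewrite eqF FP /= => -[-> ->].
- have := nbvalP a; case aE: (nbval a) => [[i|] b] //= _.
  by exists (i, b); apply: nbval_inj; rewrite FP aE.
- by rewrite /nbrel !FP /crel /=.
Qed.

Definition left_set (P Q : finType) : {set P + Q} := [set s | if s is inl _ then true else false].

Lemma card_left_set (P Q : finType) : #|left_set P Q| = #|P|.
Proof.
have inl_inj : injective (@inl P Q) by move=> ? ? [].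
rewrite -cardsT -(card_imset _ inl_inj); apply: eq_card => -[p|q]; rewrite !inE.
  by apply/esym/imsetP; exists p.
by apply/esym/negP => /imsetP[].
Qed.

(** A neighbour of the base set P exchanges one p for one q, and the pair (p, q) is its place in the
    grid. *)
Lemma jrel_local (P Q : finType) (j0 : jvert (P + Q)%type #|P|) : jset j0 = left_set P Q ->
  giso (@nbrel _ (@jrel (P + Q)%type #|P|) j0) (@grid P Q).
Proof.
move=> j0E; apply: giso_sym.
have inP (p : P) : inl p \in jset j0 by rewrite j0E inE.
have inQ (q : Q) : inr q \notin jset j0 by rewrite j0E inE.
have /choice[F FP] : forall u : P * Q, exists a : nbv (@jrel (P + Q)%type #|P|) j0,
    jset (nbval a) = inr u.2 |: jset j0 :\ inl u.1.
  by move=> u; have [a aE] := nbv_make (jrel_swap (inP u.1) (inQ u.2)); exists a; rewrite aE jsetK.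
apply: (@giso_inj _ _ _ _ F) => [[p q] [p' q'] eqF|a|[p q] [p' q']].
- have := FP (p, q); rewrite eqF FP /= => /setP E.
  have := E (inl p); rewrite !inE (inP p) eqxx !andbT /= => /negbFE/eqP[<-].
  by have := E (inr q); rewrite !inE (negPf (inQ q)) eqxx !andbF !orbF /= => /eqP[<-].
- have [s [t [ins int aE]]] := jrelP (nbvalP a).
  case: s ins aE => [p|q] ins aE; last by rewrite (negPf (inQ q)) in ins.
  case: t int aE => [p'|q] int aE; first by rewrite inP in int.
  by exists (p, q); apply: nbval_inj; apply: jset_inj; rewrite FP.
- rewrite /grid /nbrel /jrel /=.
  set V := jset (nbval (F (p', q'))); set S := jset (nbval (F (p, q))).
  have nb : #|jset j0 :&: V| + 1 = #|P| by apply/eqP/(nbvalP (F (p', q'))).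
  have Vp : (inl p \in V) = (p != p').
    by rewrite /V FP !inE (inP p) andbT (inj_eq (@inl_inj _ _)).
  have Vq : (inr q \in V) = (q == q').
    by rewrite /V FP !inE (negPf (inQ q)) andbF orbF (inj_eq (@inr_inj _ _)).
  have swap : #|S :&: V| + (p != p') = #|jset j0 :&: V| + (q == q').
    have := cardI_swap V (inP p) (inQ q).
    by rewrite -(FP (p, q)) -/S Vp Vq (finset.setIC V) (finset.setIC V).
  have aux (m n k : nat) (b c : bool) : n + 1 = k -> m + ~~ b = n + c -> (m + 1 == k) = (b != c).
    by case: b; case: c => /= h1 h2; case: eqP => //; lia.
  exact: aux nb swap.
Qed.

(** * Recognition of the small cases *)

Lemma cocktail_of_antipode (T : finType) (e : rel T) : symmetric e -> irreflexive e ->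
  (forall x, exists y, forall z, (z != x) && ~~ e x z = (z == y)) ->
  exists I : finType, giso e (@crel I).
Proof.
move=> e_sym e_irr /choice[m mP].
have mx x : m x != x /\ ~~ e x (m x) by apply/andP; rewrite mP.
have mK : involutive m.
  move=> x; apply/esym/eqP; rewrite -mP eq_sym (mx x).1 e_sym; exact: (mx x).2.
(* The vertex of smaller rank represents its antipodal pair and gets the label [true]. *)
pose low x := enum_rank x < enum_rank (m x).
have low_m x : low (m x) = ~~ low x.
  rewrite /low mK; case: ltngtP => // /ord_inj/enum_rank_inj eq_m.
  by have := (mx x).1; rewrite eq_m eqxx.
have low_rep x : low (if low x then x else m x) by case: ifPn => // nlow; rewrite low_m.
pose f x : {x | low x} * bool := (Sub (if low x then x else m x) (low_rep x), low x).
have f1 x : val (f x).1 = if low x then x else m x by [].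
exists {x : T | low x}; apply: (@giso_inj _ _ _ _ f) => [x y eqf|[[i lowi] b]|x y].
- have := f1 x; rewrite eqf f1; have -> : low x = low y by have := congr1 snd eqf.
  by case: (low y) => // /(can_inj mK).
- exists (if b then i else m i); case: b; congr (_, _); rewrite ?low_m ?lowi //.
    by apply: val_inj; rewrite /= lowi.
  by apply: val_inj; rewrite /= low_m lowi mK.
- have -> : crel (f x) (f y) = (val (f x).1 != val (f y).1) by [].
  rewrite !f1; have nE z : (z == x) || (z == m x) = ~~ e x z.
    rewrite -mP; case: eqVneq => [->|] //=; by rewrite e_irr.
  rewrite -[RHS]negbK -nE; congr (~~ _).
  case: (boolP (low x)) => lx; case: (boolP (low y)) => ly.
  + rewrite eq_sym; case: (eqVneq y (m x)) => [ym|]; last by rewrite orbF.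
    by move: ly; rewrite ym low_m lx.
  + rewrite eq_sym (can2_eq mK mK); case: (eqVneq y x) => [yx|] //.
    by move: ly; rewrite yx lx.
  + rewrite eq_sym; case: (eqVneq y x) => [yx|] //.
    by move: ly; rewrite yx (negPf lx).
  + rewrite (inj_eq (can_inj mK)) eq_sym; case: (eqVneq y (m x)) => [ym|]; last by rewrite orbF.
    by move: ly; rewrite ym low_m lx.
Qed.

Lemma complete_johnson (T : finType) (e : rel T) : irreflexive e ->
  (forall x y, x != y -> e x y) -> giso e (@jrel T 1).
Proof.
move=> e_irr cmpl; have /choice[f fP] : forall x : T, exists A : jvert T 1, jset A = [set x].
  by move=> x; apply: jvert_make; rewrite cards1.
apply: (@giso_inj _ _ _ _ f) => [x y eqf|A|x y].
- by have := fP x; rewrite eqf fP => /finset.set1_inj.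
- have /eqP/cards1P[x xE] := jvert_card A.
  by exists x; apply: jset_inj; rewrite fP.
- rewrite /jrel !fP; have [->|nxy] := eqVneq x y; first by rewrite finset.setIid cards1 e_irr.
  rewrite cmpl // [#|_|](_ : _ = 0) //; apply: eq_card0 => z; rewrite !inE.
  by case: eqP => // ->; rewrite (negPf nxy).
Qed.

(** If y lay between x and a z at distance 2, moving the edge yx to z would give a neighbour of x
    not adjacent to y. *)
Lemma local_complete (T : finType) (e : rel T) x : reflective_graph e ->
  (forall a b, e x a -> e x b -> a != b -> e a b) -> forall a b, a != b -> e a b.
Proof.
move=> eG cmpl; have [e_sym e_irr e_conn e_compl] := eG.
have dE := dist_edge e_irr e_conn; have dC := distC e_sym e_conn.
have le1 : forall z, dist e x z <= 1.
  apply: rg_dist_le => // z; apply/negP => /eqP dz.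
  have [|y [eyz dy]] := @dist_pred _ _ e_conn x z; first by rewrite dz.
  have exy : e x y by rewrite (edge_dist e_irr e_conn); move: dy; rewrite dz => -[->].
  have eyx : e y x by rewrite e_sym.
  have [w /parP pw] : exists w, parallel e y x z w by apply: e_compl; rewrite // 1?e_sym // dC.
  have dyw : dist e y w = 2 by have := pw y; rewrite (distxx e_conn) (dE _ _ eyx) (dE _ _ eyz); clear; lia.
  have exw : e x w.
    rewrite (edge_dist e_irr e_conn); have := pw x.
    by rewrite (distxx e_conn) (dE _ _ exy) dz; clear; lia.
  have nyw : y != w by rewrite -(dist_eq0 e_conn) dyw.
  by have := dE _ _ (cmpl _ _ exy exw nyw); rewrite dyw.
have nbr z : z != x -> e x z.
  move=> nzx; rewrite (edge_dist e_irr e_conn); have := le1 z.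
  by have := dist_eq0 e_conn x z; rewrite [x == z]eq_sym (negPf nzx); clear; lia.
move=> a b nab; have [eq_a|nax] := eqVneq a x; first by rewrite eq_a nbr // eq_sym -eq_a.
have [eq_b|nbx] := eqVneq b x; first by rewrite eq_b e_sym nbr.
by apply: cmpl; rewrite ?nbr.
Qed.

(** With K = 10 + 2 the Laplacian of d(u,.) is 16 - 12 d(u,.). Its sum is zero while the distances
    sum to 2n - 18, so n = 27. At distance 2 it is minus the number of common neighbours, which is
    therefore 24 - 16 = 8. *)
Lemma srg27_parameters (R : realType) (T : finType) (e : rel T) x y :
  reflective_graph e -> locally_connected e -> (forall a b, dist e a b <= 2) ->
  e x y -> Deg e x = 16 -> triangles e x y = 10 -> srg e 27 16 10 8.
Proof.
move=> [e_sym e_irr e_conn e_compl] loc diam2 exy deg16 tri10.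
have T2 : 1 < #|T|.
  by apply/card_gt1P; exists x, y; split=> //; apply: contraTneq exy => ->; rewrite e_irr.
have DegE v : Deg e v = 16 by rewrite -deg16; apply: Deg_const.
have triE u v : e u v -> triangles e u v = 10.
  by move=> euv; rewrite -tri10; apply: triangles_const.
have lapE u v : lap e (realdist R e u) v = (16%:R - 12%:R * realdist R e u v)%R.
  by rewrite lap_realdist // DegE (completable_Kmin R e_sym e_irr e_conn e_compl loc exy) tri10.
have distE u v : dist e u v + e u v + (u == v).*2 = 2.
  rewrite (edge_dist e_irr e_conn) -(dist_eq0 e_conn); have := diam2 u v.
  by case: (dist e u v) => [|[|[|]]].
split=> // [|u v nuv neuv].
  have sumE : \sum_z dist e x z + 16 + 2 = 2 * #|T|.
    have twoE : \sum_z (x == z).*2 = 2.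
      by rewrite (bigD1 x) //= eqxx big1 ?addn0 // => z; rewrite eq_sym => /negPf->.
    have degE : \sum_z (e x z : nat) = 16.
      rewrite -(DegE x) /Deg -sum1_card [in RHS]big_mkcond; apply: eq_bigr => z _.
      by rewrite inE; case: (e x z).
    have : \sum_z (dist e x z + e x z + (x == z).*2) = #|T| * 2.
      by under eq_bigr do rewrite distE; rewrite sum_nat_const.
    by rewrite !big_split /= twoE degE; clear; lia.
  have /eqP := sum_lap e_sym (realdist R e x); under eq_bigr do rewrite lapE.
  have sumR : (\sum_z realdist R e x z = (\sum_z dist e x z)%:R)%R by rewrite natr_sum.
  rewrite sumrB sumr_const -mulr_sumr sumR -natrM -mulrnA subr_eq0 eqr_nat => /eqP.
  rewrite [#|_|](_ : _ = #|T|) // ; move: sumE; clear; lia.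
have duv : dist e u v = 2 by have := distE u v; rewrite (negPf nuv) (negPf neuv); clear; lia.
have := lapE u v; rewrite /lap /realdist duv.
have -> : (\sum_(w | e v w) ((dist e u w)%:R - 2%:R) = - (#|[set w | e u w & e v w]|)%:R :> R)%R.
  rewrite -sum1_card natr_sum -sumrN big_mkcond [in RHS]big_mkcond; apply: eq_bigr => w _.
  rewrite inE andbC; case evw: (e v w) => //=.
  have nuw : u != w by apply: contraNneq neuv => ->; rewrite e_sym.
  have := distE u w; rewrite (negPf nuw) addn0; case: (e u w) => /= dw.
    by rewrite (_ : dist e u w = 1); [lra|clear -dw; lia].
  by rewrite (_ : dist e u w = 2); [lra|clear -dw; lia].
rewrite -natrM => eqR; apply/eqP; rewrite -(eqr_nat R); apply/eqP; lra.
Qed.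

(** * Computations in the Gosset graph *)

Definition gcode := (nat * nat * bool)%type.
Definition gcodes : seq gcode :=
  [seq (ij, s) | ij <- [seq ij <- [seq (i, j) | i <- iota 0 8, j <- iota 0 8] | ij.1 < ij.2],
                 s <- [:: true; false]].
(** The right side, a boolean read as a number, is the required number of common positions: 1 for
    equal signs, 0 for opposite ones. *)
Definition cadj (c c' : gcode) : bool :=
  (((c.1.1 == c'.1.1) + (c.1.1 == c'.1.2)) + ((c.1.2 == c'.1.1) + (c.1.2 == c'.1.2)))%N
  == (c.2 == c'.2 :> bool).
Definition cset (c : gcode) : {set 'I_8} := [set inord c.1.1; inord c.1.2].
Definition coded (c : gcode) (p : gvert) := gset p = cset c /\ gsgn p = c.2.

Lemma gcodesP c : reflect (c.1.1 < c.1.2 < 8) (c \in gcodes).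
Proof.
have sound : all (fun c : gcode => c.1.1 < c.1.2 < 8) gcodes by vm_compute.
have complete : all (fun j => all (fun i => (i < j) ==>
  all (fun s => (i, j, s) \in gcodes) [:: true; false]) (iota 0 8)) (iota 0 8) by vm_compute.
apply: (iffP idP) => [/(allP sound)//|]; case: c => [[i j] s] /= /andP[lt_ij lt_j].
have ij : i \in iota 0 8 by rewrite mem_iota; apply: ltn_trans lt_ij lt_j.
have jj : j \in iota 0 8 by rewrite mem_iota.
have /implyP/(_ lt_ij)/allP := allP (allP complete j jj) i ij.
by apply; case: s; rewrite !inE.
Qed.

Lemma inord_eq i j : i < 8 -> j < 8 -> (inord i == inord j :> 'I_8) = (i == j).
Proof. by move=> i8 j8; rewrite -val_eqE /= !inordK. Qed.

Lemma gcode_exists p : exists2 c, c \in gcodes & coded c p.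
Proof.
have [i [j [nij pE]]] := gvert_pair p.
have [lt|lt|eq_ij] := ltngtP i j; last by rewrite (val_inj eq_ij) eqxx in nij.
  exists (nat_of_ord i, nat_of_ord j, gsgn p); first by apply/gcodesP; rewrite /= lt /=.
  by split=> //; rewrite pE /cset !inord_val.
exists (nat_of_ord j, nat_of_ord i, gsgn p); first by apply/gcodesP; rewrite /= lt /=.
by split=> //; rewrite pE /cset !inord_val finset.setUC.
Qed.

Lemma gcode_vert c : c \in gcodes -> exists p, coded c p.
Proof.
move=> /gcodesP/andP[lt_ij lt_j]; have [|p [pE ps]] := @gvert_make (cset c) c.2.
  by rewrite cards2 inord_eq ?(ltn_trans lt_ij) // ltn_eqF.
by exists p.
Qed.

Lemma coded_inj c p q : coded c p -> coded c q -> p = q.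
Proof. by move=> [p1 p2] [q1 q2]; apply: gvert_inj; [rewrite p1 q1|rewrite p2 q2]. Qed.

Lemma coded_adj c c' p p' : c \in gcodes -> c' \in gcodes -> coded c p -> coded c' p' ->
  grel p p' = cadj c c'.
Proof.
move=> /gcodesP/andP[lt_ij lt_j] /gcodesP/andP[lt_ij' lt_j'] [pE ps] [p'E p's].
have i8 := ltn_trans lt_ij lt_j; have i'8 := ltn_trans lt_ij' lt_j'.
have nij : inord c'.1.1 != inord c'.1.2 :> 'I_8 by rewrite inord_eq // ltn_eqF.
rewrite /grel /cadj pE p'E ps p's cardI2 // !inE !inord_eq //.
rewrite [c'.1.1 == c.1.1]eq_sym [c'.1.2 == c.1.1]eq_sym [c'.1.1 == c.1.2]eq_sym [c'.1.2 == c.1.2]eq_sym.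
move: lt_ij lt_ij'; case: c c' {lt_j lt_j' pE ps p'E p's i8 i'8 nij} => [[i j] s] [[k l] t] /= ij kl.
have -> : ((i == k) || (j == k)) + ((i == l) || (j == l)) = (i == k) + (i == l) + ((j == k) + (j == l)).
  by case: (eqVneq i k); case: (eqVneq j k); case: (eqVneq i l); case: (eqVneq j l) => //=; lia.
by case: (s == t).
Qed.

(** A triangle. The common neighbours of its first one, two and three vertices form the Schlaefli
    graph, the halved 5-cube and J(5,2). *)
Definition cbase := [:: (0, 1, true); (0, 2, true); (1, 2, true)].

Definition common_code n c := all (cadj c) (take n cbase).

(** The hypothesis [mid] of local graphs, as a finite test evaluated by [vm_compute]. *)
Definition mid_check n := all (fun c => all (fun c' =>
  [&& common_code n c, common_code n c', c != c' & ~~ cadj c c'] ==>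
  has (fun s => [&& common_code n s, cadj c s & cadj c' s]) gcodes) gcodes) gcodes.

Lemma mid_check_ok : mid_check 1 && mid_check 2.
Proof. by vm_compute. Qed.

Lemma common3_code : all (fun c => common_code 3 c ==> ~~ c.2 && (2 < c.1.1)) gcodes.
Proof. by vm_compute. Qed.

Definition gpoint0 : gcode := (0, 1, true).
Definition gpoint1 : gcode := (0, 2, true).
Definition gpoint2 : gcode := (1, 2, true).

Lemma gvert0_proof : #|(cset gpoint0, true).1| == 2.
Proof. by rewrite cards2 inord_eq. Qed.

Definition gvert0 : gvert := Sub (cset gpoint0, true) gvert0_proof.

Lemma gvert0_coded : coded gpoint0 gvert0.
Proof. by split; rewrite /gset /gsgn SubK. Qed.

Lemma gosset_mid n (P : pred gvert) :
  mid_check n -> (forall c p, c \in gcodes -> coded c p -> common_code n c = P p) ->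
  forall p q, P p -> P q -> p != q -> ~~ grel p q -> exists s, [/\ P s, grel p s & grel q s].
Proof.
move=> check codeP p q Pp Pq npq nepq.
have [[c cc cp] [c' cc' cq]] := (gcode_exists p, gcode_exists q).
have /implyP imp := allP (allP check c cc) c' cc'.
have ncc : c != c' by apply: contraNneq npq => eq_c; rewrite (coded_inj cp (q := q)) // eq_c.
have /imp/hasP[s sc /and3P[sP cs c's]] : [&& common_code n c, common_code n c', c != c' & ~~ cadj c c'].
  by rewrite (codeP _ _ cc cp) (codeP _ _ cc' cq) Pp Pq ncc -(coded_adj cc cc' cp cq).
have [t st] := gcode_vert sc.
by exists t; rewrite -(codeP _ _ sc st) (coded_adj cc sc cp st) (coded_adj cc' sc cq st).
Qed.

Definition schlaefli := @nbrel _ grel gvert0.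

Lemma gvert0_mid p q : grel gvert0 p -> grel gvert0 q -> p != q -> ~~ grel p q ->
  exists s, [/\ grel gvert0 s, grel p s & grel q s].
Proof.
have /andP[check _] := mid_check_ok; apply: (gosset_mid check) => c p' cc cp.
by rewrite /common_code /= andbT -(coded_adj cc _ cp gvert0_coded) // grel_sym.
Qed.

Lemma schlaefli_reflective : reflective_graph schlaefli.
Proof. exact: local_reflective gosset_reflective gvert0_mid. Qed.

Definition upper5 := {i : 'I_8 | 2 < i}.

Lemma card_upper5 : #|{: upper5}| = 5.
Proof. by rewrite card_sig -sum1_card big_mkcond !big_ord_recl big_ord0. Qed.

Lemma card_trace (S : {set 'I_8}) : (forall i, i \in S -> 2 < i) ->
  #|[set u : upper5 | val u \in S]| = #|S|.
Proof.
move=> S2; rewrite -(card_imset _ val_inj); apply: eq_card => i; apply/imsetP/idP => [[u + ->]|Si].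
  by rewrite inE.
by exists (Sub i (S2 i Si)); rewrite ?inE SubK.
Qed.

(** The sixteen vertices are not matched directly: a local graph of L is J(5,2), as in the halved
    5-cube, and reconstruction gives the rest. *)
Lemma schlaefli_local : exists y0, giso (@nbrel _ schlaefli y0) (@hrel upper5).
Proof.
have [y1 cy] := @gcode_vert gpoint1 isT; have [z1 cz] := @gcode_vert gpoint2 isT.
have cx := gvert0_coded.
have [y0 y0E] : exists y0 : nbv grel gvert0, nbval y0 = y1.
  by apply: nbv_make; rewrite (coded_adj _ _ cx cy).
have [z0 z0E] : exists z0 : nbv grel gvert0, nbval z0 = z1.
  by apply: nbv_make; rewrite (coded_adj _ _ cx cz).
have [z00 z00E] : exists z00 : nbv schlaefli y0, nbval z00 = z0.
  by apply: nbv_make; rewrite /schlaefli /nbrel y0E z0E (coded_adj _ _ cy cz).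
exists y0; set L := nbrel (e := schlaefli) (x := y0).
have LG : reflective_graph L.
  apply: (local_reflective schlaefli_reflective) => p q yp yq npq nepq.
  have [||||||s [/andP[xs ys] ps qs]] := @gosset_mid 2 [pred p | grel gvert0 p && grel y1 p] _ _ (nbval p) (nbval q).
  - by case/andP: mid_check_ok.
  - move=> c r cc cr; rewrite /common_code /= andbT -(coded_adj cc _ cr cx) //.
    by rewrite -(coded_adj cc _ cr cy) // !(grel_sym r).
  - by rewrite /= nbvalP -y0E.
  - by rewrite /= nbvalP -y0E.
  - by rewrite (inj_eq (@nbval_inj _ _ _)).
  - by [].
  - have [t tE] := nbv_make xs; exists t.
    by rewrite /schlaefli /nbrel y0E tE.
have [h0 h0E] := @hvert_make upper5 finset.set0 (introT idP (negbT (congr1 odd (cards0 _)))).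
apply: (local_iso_giso LG (halved_reflective _)) (giso_trans _ (giso_sym (hrel_local h0E))).
pose pt (a : nbv L z00) : gvert := nbval (nbval (nbval a)).
have yadj (a : nbv schlaefli y0) : grel y1 (nbval (nbval a)).
  by rewrite -y0E; exact: (nbvalP a).
have zadj (a : nbv L z00) : grel z1 (pt a) by rewrite -z0E -z00E; exact: (nbvalP a).
have ptP a : gsgn (pt a) = false /\ forall i, i \in gset (pt a) -> 2 < i.
  have [c cc cp] := gcode_exists (pt a).
  have common : common_code 3 c.
    rewrite /common_code /= andbT -(coded_adj cc _ cp cx) // -(coded_adj cc _ cp cy) //.
    rewrite -(coded_adj cc _ cp cz) // !(grel_sym (pt a)) nbvalP.
    by rewrite yadj zadj.
  have /implyP/(_ common)/andP[/negPf c2 lt2] := allP common3_code c cc.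
  case: cp => pE ps; rewrite ps c2; split=> // i; rewrite pE !inE.
  have /gcodesP/andP[lt_ij lt8] := cc.
  by case/orP=> /eqP->; rewrite inordK //; [exact: ltn_trans lt_ij lt8|exact: ltn_trans lt2 lt_ij].
have /choice[F FP] : forall a, exists B : jvert upper5 2, jset B = [set u : upper5 | val u \in gset (pt a)].
  by move=> a; apply: jvert_make; rewrite card_trace ?gset_card //; case: (ptP a).
have pt_inj a b : gset (pt a) = gset (pt b) -> a = b.
  move=> eq_ab; do 3!apply: nbval_inj; apply: gvert_inj => //.
  by rewrite (ptP a).1 (ptP b).1.
apply: (@giso_inj _ _ _ _ F) => [a b eqF|B|a b].
- apply: pt_inj; apply/setP => i; apply/idP/idP => h.
    have := FP b; rewrite -eqF FP => /setP/(_ (Sub i ((ptP a).2 i h))).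
    by rewrite !inE SubK h => <-.
  have := FP a; rewrite eqF FP => /setP/(_ (Sub i ((ptP b).2 i h))).
  by rewrite !inE SubK h => <-.
- pose S := val @: jset B.
  have S2 i : i \in S -> 2 < i by case/imsetP=> u _ ->; exact: (valP u).
  have [|p [pE ps]] := @gvert_make S false; first by rewrite card_imset ?jvert_card //; exact: val_inj.
  have away c q : coded c q -> c.2 = true -> c.1.1 < 3 -> c.1.2 < 3 -> grel q p.
    move=> [qE qs] c2 c11 c12; rewrite /grel qs c2 ps /=; apply/eqP; apply: eq_card0 => i.
    rewrite !inE qE pE !inE; apply/negP => /andP[/orP[]/eqP-> /S2]; rewrite inordK; lia.
  have [a3 a3E] := nbv_make (away _ _ cx erefl isT isT).
  have [a2 a2E] : exists a2 : nbv schlaefli y0, nbval a2 = a3.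
    by apply: nbv_make; rewrite /schlaefli /nbrel y0E a3E (away _ _ cy).
  have [a1 a1E] : exists a1 : nbv L z00, nbval a1 = a2.
    by apply: nbv_make; rewrite /L /schlaefli /nbrel z00E z0E a2E a3E (away _ _ cz).
  exists a1; apply: jset_inj; rewrite FP /pt a1E a2E a3E pE; apply/setP => u; rewrite inE.
  by rewrite mem_imset //; exact: val_inj.
- have -> : nbrel a b = grel (pt a) (pt b) by [].
  rewrite /jrel /grel !FP (ptP a).1 (ptP b).1 eqxx.
  rewrite [#|_ :&: [set _ | _]|](_ : _ = #|gset (pt a) :&: gset (pt b)|); first by lia.
  rewrite -card_trace; last by move=> i; rewrite inE => /andP[/((ptP a).2)].
  by apply: eq_card => u; rewrite !inE.
Qed.

(** * Classification *)

Lemma subset_of_card (V : finType) (S : {set V}) m : m <= #|S| ->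
  exists2 S' : {set V}, S' \subset S & #|S'| = m.
Proof.
move=> /card_geqP[s [us ss sS]]; exists [set x in s].
  by apply/fintype.subsetP => x; rewrite inE; apply: sS.
by rewrite cardsE (card_uniqP us).
Qed.

Lemma giso_diam (T U : finType) (e : rel T) (r : rel U) (n : nat) :
  connected_graph e -> giso e r -> (forall a b, dist e a b <= n) -> forall a b, dist r a b <= n.
Proof.
move=> e_conn [f [g [fK gK fe]]] le_n a b.
by rewrite -[a]gK -[b]gK (giso_dist e_conn fK gK fe).
Qed.

Lemma giso_dist2 (T U : finType) (e : rel T) (r : rel U) (n : nat) : connected_graph e ->
  giso e r -> (exists a b, dist e a b = n) -> exists a b, dist r a b = n.
Proof.
move=> e_conn [f [g [fK gK fe]]] [a [b <-]].
by exists (f a), (f b); rewrite (giso_dist e_conn fK gK fe).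
Qed.

Lemma johnson_far (V : finType) k : 3 <= k -> k + 3 <= #|V| ->
  exists A B : jvert V k, dist (@jrel V k) A B = 3.
Proof.
move=> k3 V3; have [|S _ cS] := @subset_of_card V finset.setT k; first by rewrite cardsT; lia.
have [A AE] := jvert_make cS.
have [|S1 sS1 cS1] := @subset_of_card V S 3; first by rewrite cS.
have [|S2 sS2 cS2] := @subset_of_card V (~: S) 3; first by have := cardsC S; rewrite cS; clear -V3; lia.
have dis i : i \in S -> i \in S2 -> False.
  by move=> Si /(fintype.subsetP sS2); rewrite inE Si.
have cD : #|S :\: S1| = k - 3.
  by rewrite cardsD (finset.setIidPr sS1) cS cS1.
have [|B BE] := @jvert_make V k ((S :\: S1) :|: S2).
  rewrite cardsU cD cS2 [#|_ :&: _|](_ : _ = 0); first by clear -k3; lia.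
  by apply: eq_card0 => i; rewrite !inE; apply/negP => /andP[/andP[_ /dis]].
exists A, B; rewrite jrel_dist AE BE [_ :&: _](_ : _ = S :\: S1).
  by rewrite cD; clear -k3; lia.
apply/setP => i; rewrite !inE; case Si: (i \in S); rewrite ?andbF //= andbT.
by case S2i: (i \in S2); rewrite ?orbF //; case: (dis i).
Qed.

Lemma halved_far (V : finType) : 6 <= #|V| -> exists A B : hvert V, dist (@hrel V) A B = 3.
Proof.
move=> V6; have [|S _ cS] := @subset_of_card V finset.setT 6; first by rewrite cardsT.
have [|A AE] := @hvert_make V finset.set0; first by rewrite cards0.
have [|B BE] := @hvert_make V S; first by rewrite cS.
exists A, B; rewrite hrel_dist AE BE [sdiff _ _](_ : _ = S) ?cS //.
by apply/setP => i; rewrite !inE; case: (i \in S).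
Qed.

Lemma gosset_far : exists p q, dist grel p q = 3.
Proof.
have [|p [pE ps]] := @gvert_make (gset gvert0) true; first exact: gset_card.
have [|q [qE qs]] := @gvert_make (gset gvert0) false; first exact: gset_card.
by exists p, q; rewrite grel_dist ps qs /= pE qE finset.setIid gset_card.
Qed.

Lemma halved4_cocktail (V : finType) : #|V| = 4 -> exists I : finType, giso (@hrel V) (@crel I).
Proof.
move=> V4; apply: cocktail_of_antipode => [|A|A]; [exact: hrel_sym|by rewrite /hrel sdiffxx|].
have [|B BE] := @hvert_make V (~: hset A).
  by have := cardsC (hset A); have := hset_even A; rewrite V4; clear; lia.
exists B => C; have eC := sdiff_even C A; rewrite /hrel sdiffC.
have le4 : #|sdiff (hset C) (hset A)| <= 4 by rewrite -V4 max_card.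
have eqB : (C == B) = (#|sdiff (hset C) (hset A)| == 4).
  apply/eqP/eqP => [->|cd].
    by rewrite -V4 -cardsT; apply: eq_card => i; rewrite BE !inE; case: (i \in _).
  apply: hset_inj; rewrite BE; apply/setP => i; rewrite inE.
  have : i \in sdiff (hset C) (hset A).
    rewrite (_ : sdiff _ _ = finset.setT) ?inE //; apply/eqP.
    by rewrite eqEcard finset.subsetT cardsT V4 cd.
  by rewrite inE; case: (i \in hset A); case: (i \in hset C).
have eqA : (C == A) = (#|sdiff (hset C) (hset A)| == 0).
  by apply/eqP/eqP => [->|/sdiff_eq0/hset_inj//]; rewrite sdiffxx.
rewrite eqA eqB; move: #|sdiff _ _| le4 eC => n; clear.
by case: n => [|[|[|[|[|n]]]]].
Qed.

Lemma halved5_card (V : finType) : #|V| = 5 -> #|{: hvert V}| = 16.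
Proof.
move=> V5; rewrite card_sig; pose E := [set A : {set V} | ~~ odd #|A|].
have EC : #|~: E| = #|E|.
  rewrite -(card_imset _ (can_inj (@finset.setCK V))); apply: eq_card => A.
  apply/imsetP/idP => [[B + ->]|]; rewrite !inE ?negbK.
    by have := cardsC B; rewrite V5; clear; lia.
  by exists (~: A); rewrite ?finset.setCK // !inE negbK; have := cardsC A; rewrite V5; move: H; clear; lia.
have := cardsC E; rewrite EC -cardsT -powersetT card_powerset cardsT V5.
have -> : #|[pred A : {set V} | ~~ odd #|A|]| = #|E| by apply: eq_card => A; rewrite !inE.
by clear; lia.
Qed.

Lemma halved_base_deg (V : finType) (h0 : hvert V) : hset h0 = finset.set0 ->
  #|[set A | hrel h0 A]| = 'C(#|V|, 2).
Proof.
move=> h0E; rewrite -card_draws -(card_imset _ (@hset_inj V)); apply: eq_card => S.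
have sd0 A : sdiff finset.set0 A = A :> {set V} by apply/setP => i; rewrite !inE; case: (i \in A).
apply/imsetP/idP => [[A + ->]|]; rewrite !inE; first by rewrite /hrel h0E sd0.
move/eqP=> cS; have [|A AE] := @hvert_make V S; first by rewrite cS.
by exists A; rewrite ?AE // inE /hrel h0E sd0 AE cS.
Qed.

(** Two 4-sets whose symmetric difference has 4 elements meet in 2 and cover 6, more than 5. Through
    [dist3_anticlique] this bounds the diameter of the graph above. *)
Lemma halved5_no_anticlique (V : finType) (A B C : hvert V) : #|V| = 5 ->
  dist (@hrel V) A B = 2 -> dist (@hrel V) A C = 2 -> dist (@hrel V) B C = 2 -> False.
Proof.
rewrite !hrel_dist => V5 AB AC BC.
have eAB := sdiff_even A B; have eAC := sdiff_even A C; have eBC := sdiff_even B C.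
have sdE : sdiff (hset B) (hset C) = sdiff (sdiff (hset A) (hset B)) (sdiff (hset A) (hset C)).
  by apply/setP => i; rewrite !inE; case: (i \in hset A); case: (i \in hset B); case: (i \in hset C).
have := card_sdiff (sdiff (hset A) (hset B)) (sdiff (hset A) (hset C)); rewrite -sdE.
have := cardsUI (sdiff (hset A) (hset B)) (sdiff (hset A) (hset C)).
have : #|sdiff (hset A) (hset B) :|: sdiff (hset A) (hset C)| <= 5 by rewrite -V5 max_card.
move: #|sdiff (hset A) (hset B)| #|sdiff (hset A) (hset C)| #|sdiff (hset B) (hset C)| AB AC BC eAB eAC eBC.
by move: #|_ :|: _| #|_ :&: _| => u w a b c; clear; lia.
Qed.

(** Stronger than [in_family] in the Schlaefli case: the parameters serve the statement, the
    isomorphism the next induction step, which leads to the Gosset graph. *)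
Definition classified (T : finType) (e : rel T) : Prop :=
  (exists (V : finType) k, giso e (@jrel V k))
  \/ (exists I : finType, 3 <= #|I| /\ giso e (@crel I))
  \/ (exists V : finType, giso e (@hrel V))
  \/ (srg e 27 16 10 8 /\ giso e schlaefli)
  \/ giso e grel.

Section Step.
Variables (R : realType) (T : finType) (e : rel T) (x : T).
Hypotheses (eG : reflective_graph e) (loc : locally_connected e).
Let e_sym := rg_sym eG. Let e_irr := rg_irr eG. Let e_conn := rg_conn eG. Let e_compl := rg_compl eG.

Let mid p q (exp : e x p) (exq : e x q) :=
  @local_mid T e e_sym e_irr e_conn e_compl x p q exp exq (loc exp exq).

Let H := @nbrel T e x.
Let HG : reflective_graph H := local_reflective eG mid.
Let H_le2 : forall a b, dist H a b <= 2 := nb_dist_le eG mid.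

Hypothesis H_far : exists a b, dist H a b = 2.

Let no_far (U : finType) (r : rel U) : giso H r -> (exists p q, dist r p q = 3) -> False.
Proof.
move=> Hr [p [q dpq]]; have := giso_diam (rg_conn HG) Hr H_le2 p q.
by rewrite dpq.
Qed.

Lemma step_grid : ~ locally_connected H -> classified e.
Proof.
move=> nloc; have [|P [Q [P0 Q0 HPQ]]] := not_locally_connected_grid HG H_le2 _ nloc.
  by move=> s p q t; apply: (nb_no_claw eG mid).
left; exists (P + Q)%type, #|P|; have [j0 j0E] := jvert_make (card_left_set P Q).
exact: local_iso_giso eG (johnson_reflective _ _) (giso_trans HPQ (giso_sym (jrel_local j0E))).
Qed.

Lemma step_cocktail (I : finType) : giso H (@crel I) -> classified e.
Proof.
move=> HI; right; left; exists (option I).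
have [p [q dpq]] := giso_dist2 (rg_conn HG) HI H_far.
have [|z [ezq _]] := @dist_pred _ _ (giso_connected HI (rg_conn HG)) p q; first by rewrite dpq.
have I2 : 1 < #|I| by apply/card_gt1P; exists z.1, q.1.
rewrite card_option ltnS; split=> //.
apply: (local_iso_giso eG _ (giso_trans HI (giso_sym (crel_local I)))).
by apply: cocktail_reflective; rewrite card_option; apply: leqW.
Qed.

Lemma step_halved2 (V : finType) : giso H (@jrel V 2) -> classified e.
Proof.
move=> HV; right; right; left; exists V.
have [|h0 h0E] := @hvert_make V finset.set0; first by rewrite cards0.
exact: local_iso_giso eG (halved_reflective V) (giso_trans HV (giso_sym (hrel_local h0E))).
Qed.

(** Distance 2 occurs in H and distance 3 does not, so k = 2 or n = k + 2; complements reduce the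
    latter to k = 2. *)
Lemma step_johnson (V : finType) k : giso H (@jrel V k) -> classified e.
Proof.
move=> HV; have [A [B]] := giso_dist2 (rg_conn HG) HV H_far; rewrite jrel_dist => dAB.
have le_kV : k + 2 <= #|V|.
  have := cardsUI (jset A) (jset B); rewrite !jvert_card; have := max_card (mem (jset A :|: jset B)).
  by move: #|_ :&: _| #|_ :|: _| dAB; clear; lia.
have k2 : 2 <= k by clear -dAB; lia.
have [k_eq|k_ne] := eqVneq k 2; first by apply: (@step_halved2 V); rewrite -k_eq.
have [V_eq|V_ne] := eqVneq #|V| (k + 2).
  apply: (@step_halved2 V); apply: giso_trans HV _.
  by have := @jrel_compl V k; rewrite V_eq addKn; apply; rewrite leq_addr.
case: (no_far HV); apply: johnson_far; first by clear -k2 k_ne; lia.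
by clear -le_kV V_ne; lia.
Qed.

(** The degree 16 counts the even subsets of a 5-set, and the 10 triangles on an edge its pairs. *)
Lemma step_halved5 (V : finType) : #|V| = 5 -> giso H (@hrel V) -> classified e.
Proof.
move=> V5 HV; right; right; right; left; split; last first.
  have [y0 y0L] := schlaefli_local.
  apply: (local_iso_giso eG schlaefli_reflective (x' := y0)).
  apply: giso_trans HV (giso_trans (hrel_card _) (giso_sym y0L)).
  by rewrite V5 card_upper5.
have [f [g [fK gK fH]]] := HV.
have [|h0 h0E] := @hvert_make V finset.set0; first by rewrite cards0.
apply: (@srg27_parameters R T e x (nbval (g h0)) eG loc) => [a b||| ].
- move: b; apply: rg_dist_le => // z; apply/negP => /eqP dz.
  have [F FA Fa] := vertex_trans e_sym e_irr e_conn e_compl a x.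
  have [|u [v [w []]]] := dist3_anticlique eG mid (z := F z).
    by rewrite -Fa (aut_dist e_conn).
  rewrite -!(giso_dist (rg_conn HG) fK gK fH); exact: halved5_no_anticlique.
- exact: nbvalP.
- transitivity #|{: nbv e x}|.
    by rewrite card_sig; apply: eq_card => w; rewrite inE.
  by rewrite -(halved5_card V5); apply: (bij_eq_card (f := f)); exists g.
- rewrite /triangles -[RHS](_ : #|[set A | hrel h0 A]| = 10); last by rewrite halved_base_deg // V5.
  rewrite -(card_imset _ (can_inj gK)) -[RHS](card_imset _ (@nbval_inj T e x)).
  apply: eq_card => w; rewrite inE; apply/andP/imsetP => [[exw egw]|[a /imsetP[A + ->] ->]].
    have [a aE] := nbv_make exw; exists a => //; apply/imsetP; exists (f a); rewrite ?fK //.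
    by rewrite inE -[h0]gK fH /H /nbrel aE.
  by rewrite inE -[h0]gK -[A]gK fH !gK => egA; split; [exact: nbvalP|].
Qed.

(** Fewer than 4 coordinates leave no distance 2, more than 5 reach distance 3; with 4 the graph is
    a cocktail party graph. *)
Lemma step_halved (V : finType) : giso H (@hrel V) -> classified e.
Proof.
move=> HV; have [A [B]] := giso_dist2 (rg_conn HG) HV H_far; rewrite hrel_dist => dAB.
have V4 : 4 <= #|V|.
  by have : #|sdiff (hset A) (hset B)| <= #|V| := max_card _; clear -dAB; lia.
have [V6|V5] := leqP 6 #|V|; first by case: (no_far HV); apply: halved_far.
have [V_eq|V_ne] := eqVneq #|V| 5; first exact: step_halved5 V_eq HV.
have [|I VI] := @halved4_cocktail V; first by clear -V4 V5 V_ne; lia.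
exact: step_cocktail (giso_trans HV VI).
Qed.

End Step.

Lemma classification (R : realType) (T : finType) (e : rel T) :
  reflective_graph e -> locally_connected e -> 0 < #|T| -> classified e.
Proof.
have [n le_n] := ubnP #|T|; elim: n T e le_n => // n IHn T e lt_n eG loc /card_gt0P[x _].
have [e_sym e_irr e_conn e_compl] := eG.
have [cmpl|ncmpl] := pselect (forall a b, e x a -> e x b -> a != b -> e a b).
  by left; exists T, 1; apply: complete_johnson e_irr (local_complete eG cmpl).
pose mid p q exp exq := @local_mid T e e_sym e_irr e_conn e_compl x p q exp exq (loc x p q exp exq).
have HG := local_reflective eG mid.
have far : exists a b, dist (@nbrel T e x) a b = 2.
  apply: contrapT => none; apply: ncmpl => a b exa exb nab; apply/negPn/negP => neab.
  have [[a' a'E] [b' b'E]] := (nbv_make exa, nbv_make exb).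
  by apply: none; exists a', b'; rewrite (nb_dist eG mid) a'E b'E; apply: dist2 exa exb nab neab.
have [locH|nlocH] := pselect (locally_connected (@nbrel T e x)); last exact: step_grid nlocH.
have ltH : #|{: nbv e x}| < n by have := nb_card x eG; clear -lt_n; lia.
have H0 : 0 < #|{: nbv e x}| by case: far => a _; apply/card_gt0P; exists a.
case: (IHn _ _ ltH HG locH H0) => [[V [k HV]]|[[I [_ HI]]|[[V HV]|[[_ HS]|HG']]]].
- exact: step_johnson HV.
- exact: step_cocktail HI.
- exact: step_halved HV.
- by do 4 right; apply: local_iso_giso eG gosset_reflective HS.
- have [p [q dpq]] := gosset_far.
  by have := giso_diam (rg_conn HG) HG' (nb_dist_le eG mid) p q; rewrite dpq.
Qed.

(** * Comparison with the families of the statement *)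

Lemma iso_toP (T U V : finType) (e : rel T) (S : {set U}) (r : rel U) (rv : rel V) (h : V -> U) :
  injective h -> (forall u, u \in S <-> exists v, h v = u) ->
  (forall v w, r (h v) (h w) = rv v w) -> iso_to e S r <-> giso e rv.
Proof.
move=> h_inj hS hr; split=> [[f [f_inj fS fe]]|[f [g [fK gK fe]]]].
  have /choice[g gP] : forall x, exists v, h v = f x.
    by move=> x; apply/hS; rewrite -fS; apply/imsetP; exists x.
  apply: (@giso_inj _ _ _ _ g) => [x y eq_g|v|x y].
  - by apply: f_inj; rewrite -!gP eq_g.
  - have : h v \in S by apply/hS; exists v.
    by rewrite -fS => /imsetP[x _ hv]; exists x; apply: h_inj; rewrite gP.
  - by rewrite -hr !gP -fe.
exists (h \o f); split=> [||x y]; first exact: inj_comp h_inj (can_inj fK).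
  apply/setP => u; apply/imsetP/idP => [[x _ ->]|/hS[v <-]]; first by apply/hS; exists (f x).
  by exists (g v); rewrite //= gK.
by rewrite /= hr fe.
Qed.

Lemma johnsonP (T : finType) (e : rel T) n k :
  iso_to e (johnson_verts n k) (@johnson_rel n k) <-> giso e (@jrel 'I_n k).
Proof.
apply: (@iso_toP _ _ _ _ _ _ _ (@jset 'I_n k)) => // [|S]; first exact: jset_inj.
by rewrite inE; split=> [/eqP/jvert_make//|[A <-]]; rewrite jvert_card.
Qed.

Lemma cocktailP (T : finType) (e : rel T) k :
  iso_to e [set: 'I_k * bool] (@cocktail_rel k) <-> giso e (@crel 'I_k).
Proof. by apply: (@iso_toP _ _ _ _ _ _ _ id) => // u; rewrite inE; split=> // _; exists u. Qed.

Lemma halvedP (T : finType) (e : rel T) n :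
  iso_to e (halved_verts n) (@halved_rel n) <-> giso e (@hrel 'I_n).
Proof.
pose h (A : hvert 'I_n) : {ffun 'I_n -> bool} := [ffun i => i \in hset A].
have hE A : [set i | h A i] = hset A by apply/setP => i; rewrite inE ffunE.
apply: (@iso_toP _ _ _ _ _ _ _ h) => [A B eq_h|f|A B].
- by apply: hset_inj; rewrite -!hE eq_h.
- rewrite inE; split=> [/hvert_make[A AE]|[A <-]]; last by rewrite hE hset_even.
  by exists A; apply/ffunP => i; rewrite ffunE AE inE.
- by rewrite /halved_rel /hrel; congr (#|pred_of_set _| == _); apply/setP => i; rewrite !inE !ffunE.
Qed.

(** A coordinate is the sign times 4 [i in A] - 1. Expanding the product and summing, with m common
    positions, leaves 16 m - 8 - 8 + 8 up to sign. *)
Lemma gosset_vec_prod (p q : gvert) :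
  (\sum_(i < 8) gosset_vec (val p) i * gosset_vec (val q) i =
   (if gsgn p == gsgn q then 1 else -1) * (#|gset p :&: gset q|%:Z * 16 - 8))%R.
Proof.
have cardE (S : {set 'I_8}) : (\sum_(i < 8) (i \in S)%:R = #|S|%:Z :> int)%R.
  by rewrite -natz -sum1_card natr_sum [in RHS]big_mkcond; apply: eq_bigr => i _; case: (i \in S).
transitivity (\sum_(i < 8) (if gsgn p == gsgn q then 1 else -1) *
    ((i \in gset p :&: gset q)%:R * 16 - (i \in gset p)%:R * 4 - (i \in gset q)%:R * 4 + 1) : int)%R.
  apply: eq_bigr => i _; rewrite /gosset_vec -/(gset p) -/(gset q) -/(gsgn p) -/(gsgn q) inE.
  by case: (gsgn p); case: (gsgn q); case: (i \in gset p); case: (i \in gset q).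
rewrite -mulr_sumr !(big_split, sumrN) /= -!mulr_suml !cardE !gset_card sumr_const card_ord.
by congr (_ * _)%R; ring.
Qed.

Lemma gossetP (T : finType) (e : rel T) :
  iso_to e gosset_verts gosset_rel <-> giso e grel.
Proof.
apply: (@iso_toP _ _ _ _ _ _ _ (val : gvert -> _)) => [|[S s]|p q]; first exact: val_inj.
  rewrite inE; split=> [cS|[p pE]]; last first.
    by rewrite -pE; exact: (valP p).
  by exists (Sub (S, s) cS); rewrite SubK.
rewrite /gosset_rel gosset_vec_prod /grel; move: #|_| => n.
by case: ifP => _; apply/eqP/eqP; lia.
Qed.

Lemma family_classified (T : finType) (e : rel T) : classified e -> in_family e.
Proof.
case=> [[V [k eV]]|[[I [I3 eI]]|[[V eV]|[[e_srg _]|eG]]]].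
- right; left; exists #|V|, k; apply/johnsonP; apply: giso_trans eV (jrel_card _ _).
  by rewrite card_ord.
- left; exists #|I|; split=> //; apply/cocktailP; apply: giso_trans eI (crel_card _).
  by rewrite card_ord.
- do 2 right; left; exists #|V|; apply/halvedP; apply: giso_trans eV (hrel_card _).
  by rewrite card_ord.
- by do 3 right; left.
- by do 4 right; apply/gossetP.
Qed.

Lemma family_completable (T : finType) (e : rel T) : symmetric e -> irreflexive e ->
  connected_graph e -> in_family e -> completable e.
Proof.
move=> e_sym e_irr e_conn.
have transfer (U : finType) (r : rel U) : reflective_graph r -> giso e r -> completable e.
  by move=> rG /giso_sym/giso_reflective/(_ rG)/rg_compl.
case=> [[k [k3 /cocktailP eI]]|[[n [k /johnsonP eV]]|[[n /halvedP eV]|[e_srg|/gossetP eG]]]].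
- by apply: transfer eI; apply: cocktail_reflective; rewrite card_ord; apply: leq_trans k3.
- exact: transfer (johnson_reflective _ _) eV.
- exact: transfer (halved_reflective _) eV.
- exact: srg27_completable.
- exact: transfer gosset_reflective eG.
Qed.

Theorem theorem4p1 (R : realType) (T : finType) (e : rel T) :
  simple_graph e -> connected_graph e -> locally_connected e -> 1 < #|T| ->
  [<-> eff_BM_sharp e R;
       reflective e;
       distance_regular e /\ Lichnerowicz_sharp e R;
       in_family e].
Proof.
move=> [e_sym e_simple] e_conn e_loc T2.
have e_irr : irreflexive e by move=> x; apply/negbTE/e_simple.
tfae.
- move=> e_sharp; apply: completable_reflective => //.
  exact: eff_BM_sharp_completable e_sharp.
- move=> /(reflective_completable e_sym e_irr e_conn) compl.
  by split; [exact: completable_distance_regular|exact: completable_Lichnerowicz].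
- move=> [e_dr e_lich]; have compl := Lichnerowicz_sharp_completable e_sym e_irr e_conn e_dr e_lich.
  apply: family_classified; apply: (classification R) => //; exact: ltnW.
- move=> /(family_completable e_sym e_irr e_conn) compl.
  exact: completable_eff_BM_sharp.
Qed.
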